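(* Let $Q_1,\dots,Q_n$ be smooth manifolds, $Q=Q_1\times\cdots\times Q_n$, let $L_i:TQ_i\to\mathbb{R}$ be smooth (possibly degenerate) Lagrangians and $L=\sum_{i=1}^n L_i:TQ\to\mathbb{R}$. Let $\Delta_{Q_i}\subset TQ_i$ and $\Sigma_Q\subset TQ$ be smooth constraint distributions such that $\Delta_{Q_1}\oplus\cdots\oplus\Delta_{Q_n}$ and $\Sigma_Q$ intersect cleanly, and set $\Delta_Q=(\Delta_{Q_1}\oplus\cdots\oplus\Delta_{Q_n})\cap\Sigma_Q$. Let $D_{\mathrm{int}}=\Sigma_{\mathrm{int}}\oplus\Sigma_{\mathrm{int}}^\circ$ with $\Sigma_{\mathrm{int}}=(T\pi_Q)^{-1}(\Sigma_Q)$, and let $D_{\Delta_Q}=(D_{\Delta_{Q_1}}\oplus\cdots\oplus D_{\Delta_{Q_n}})\boxtimes D_{\mathrm{int}}$. Let $(q,v,p)(t)$, $t\in[t_1,t_2]$, be a curve in $TQ\oplus T^*Q$, with components $(q_i,v_i,p_i)(t)\in TQ_i\oplus T^*Q_i$. Then the following statements are equivalent: (i) The curve $(q,v,p)$ satisfies $$((q,p,\dot q,\dot p),\mathbf{d}_DL(q,v))\in D_{\Delta_Q}(q,p).$$ (ii) There exist constraint force fields $F_i:TQ\to T^*Q_i$, $i=1,\dots,n$, such that $$((q_i,p_i,\dot q_i,\dot p_i),\mathbf{d}_DL_i(q_i,v_i)-\pi_{Q_i}^*F_i(q,v))\in D_{\Delta_{Q_i}}(q_i,p_i),\qquad i=1,\dots,n,$$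 together with $(\dot q_1,\dots,\dot q_n)\in\Sigma_Q(q_1,\dots,q_n)$ and $(F_1(q,v),\dots,F_n(q,v))\in\Sigma_Q^\circ(q_1,\dots,q_n)$. (iii) The curve $(q,v,p)(t)$ satisfies the Lagrange-d'Alembert-Pontryagin principle $$\delta\int_{t_1}^{t_2}L(q,v)+\langle p,\dot q-v\rangle\,dt=0$$ for variations $\delta q(t)\in\Delta_Q(q(t))$ with fixed endpoints and arbitrary $\delta v,\delta p$, together with the constraint $\dot q(t)\in\Delta_Q(q(t))$. (iv) There exist constraint force fields $F_i:TQ\to T^*Q_i$, $i=1,\dots,n$, such that the curves $(q_i,v_i,p_i)(t)$ satisfy the Lagrange-d'Alembert-Pontryagin principles $$\delta\int_{t_1}^{t_2}L_i(q_i,v_i)+\langle p_i,\dot q_i-v_i\rangle\,dt+\int_{t_1}^{t_2}\langle F_i(q,v),\delta q_i\rangle\,dt=0,\qquad i=1,\dots,n,$$ for variations $\delta q_i(t)\in\Delta_{Q_i}(q_i(t))$ with fixed endpoints and arbitrary $\delta v_i,\delta p_i$, with $\dot q_i(t)\in\Delta_{Q_i}(q_i(t))$, together with $(\dot q_1,\dots,\dot q_n)\in\Sigma_Q(q_1,\dots,q_n)$ and $(F_1(q,v),\dots,F_n(q,v))\in\Sigma_Q^\circ(q_1,\dots,q_n)$.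
   Context: All objects are smooth. $\pi_Q:T^*Q\to Q$ is the cotangent bundle projection; ${}^\circ$ denotes the annihilator. ''Intersect cleanly'' means that the intersection has locally constant rank. An (almost) Dirac structure on a manifold $M$ is a subbundle $D\subset TM\oplus T^*M$ equal to its own orthogonal complement for the symmetric pairing $\langle\!\langle(v,\alpha),(\bar v,\bar\alpha)\rangle\!\rangle=\langle\alpha,\bar v\rangle+\langle\bar\alpha,v\rangle$. For a distribution $\Delta_Q\subset TQ$, put $\Delta_{T^*Q}=(T\pi_Q)^{-1}(\Delta_Q)\subset TT^*Q$; the induced Dirac structure on $T^*Q$ is $$D_{\Delta_Q}(q,p)=\{(v,\alpha)\in T_{(q,p)}T^*Q\times T^*_{(q,p)}T^*Q\mid v\in\Delta_{T^*Q}(q,p),\ \langle\alpha,w\rangle=\Omega(q,p)(v,w)\ \forall w\in\Delta_{T^*Q}(q,p)\},$$ where $\Omega$ is the canonical symplectic form on $T^*Q$, with sign convention $\Omega^\flat(q,p)\cdot(\delta q,\delta p)=(-\delta p,\delta q)$ in local coordinates. Locally, $((\delta q,\delta p),(\gamma,u))\in D_{\Delta_Q}(q,p)$ iff $\delta q\in\Delta_Q(q)$, $u=\delta q$, $\gamma+\delta p\in\Delta_Q^\circ(q)$. The direct sum $D_1\oplus\cdots\oplus D_n$ of Dirac structures on $M_1,\dots,M_n$ is the direct sum vector bundle over $M_1\times\cdots\times M_n$. The Dirac tensor product of two Dirac structures on the same manifold $M$ is $$D_a\boxtimes D_b=\{(v,\alpha)\in TM\oplus T^*M\mid\exists\beta\in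 T^*M:\ (v,\alpha+\beta)\in D_a,\ (v,-\beta)\in D_b\}$$ (with all elements over the same base point). The Dirac differential of $L:TQ\to\mathbb{R}$ is $\mathbf{d}_DL=\gamma_Q\circ\mathbf{d}L:TQ\to T^*T^*Q$, where $\gamma_Q:T^*TQ\to T^*T^*Q$ is the canonical diffeomorphism given locally by $(q,\delta q,\delta p,p)\mapsto(q,p,-\delta p,\delta q)$. Locally $\mathbf{d}_DL(q,v)=(q,\partial L/\partial v,-\partial L/\partial q,v)$. Membership such as in (i) includes equality of base points, i.e. $p=\partial L/\partial v$. A force field $F_i:TQ\to T^*Q_i$ satisfies $F_i(q,v)\in T^*_{q_i}Q_i$; its horizontal lift $\pi_{Q_i}^*F_i(q,v)$ is defined by $\langle\pi_{Q_i}^*F_i(q,v),w\rangle=\langle F_i(q,v),T\pi_{Q_i}(w)\rangle$ for $w\in TT^*Q_i$, locally $(q_i,p_i,F_i(q,v),0)$. In (iii) and (iv), the variational condition means that the first variation of the integral along the given curve (plus the force term in (iv)) vanishes for all variations of the stated type; the distribution constraint is imposed on the variations $\delta q$ and separately on $\dot q$ (d'Alembert style), not on the varied curves.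
   Formalization: The constraint force fields F_i in (ii) and (iv) may depend on time, F_i(t,q,v), smooth on [t_1,t_2]×TQ; with F_i: TQ → T*Q_i alone, (i)⇒(ii) and (iii)⇒(iv) fail for curves passing the same (q,v) with different accelerations. *)

(* Defs.v *)
From mathcomp Require Export all_boot all_order all_algebra.
From mathcomp Require Export all_classical all_reals all_analysis.
#[export] Set Implicit Arguments.
#[export] Unset Strict Implicit.
#[export] Unset Printing Implicit Defensive.
Export Order.TTheory GRing.Theory Num.Theory numFieldNormedType.Exports.
Open Scope classical_set_scope.
Open Scope ring_scope.

(* All iterated directional derivatives of order < k are differentiable on the
   (open) set U, and those of order k are continuous there. *)
Fixpoint Ck {R : realType} {m n : nat} (k : nat) (U : set 'rV[R]_m)
    (f : 'rV[R]_m -> 'rV[R]_n) : Prop :=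
  match k with
  | 0%N => forall x, U x -> {for x, continuous f}
  | k'.+1 => (forall x, U x -> differentiable f x) /\
             (forall w, Ck k' U (fun x => 'D_w f x))
  end.

Definition Coo {R : realType} {m n : nat} (U : set 'rV[R]_m)
    (f : 'rV[R]_m -> 'rV[R]_n) : Prop :=
  forall k, Ck k U f.

Definition Coo_at {R : realType} {m n : nat} (f : 'rV[R]_m -> 'rV[R]_n)
    (x : 'rV[R]_m) : Prop :=
  exists U : set 'rV[R]_m, [/\ open U, U x & Coo U f].

(* A manifold is a set with an atlas; the topology is the one generated by
   the charts.  [chart_inv i] is relevant only on the image of [chart i].
   Each point x comes with a preferred chart [chart_at x] around it, and
   T_xM and T*_xM are the row vectors of components in that chart.  Total
   spaces of bundles are thus plain products as sets, but their charts (hence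
   their topology and smooth structure) are the usual natural ones, with
   components converted from the preferred chart by the Jacobian of the
   transition map: the choice of preferred charts plays no role in the
   resulting smooth structures. *)
Record charted (R : realType) : Type := Charted {
  pt :> Type;
  dim : nat;
  idx : Type;
  dom : idx -> set pt;
  chart : idx -> pt -> 'rV[R]_dim;
  chart_inv : idx -> 'rV[R]_dim -> pt;
  chart_at : pt -> idx
}.
Arguments Charted {R} pt dim idx dom chart chart_inv chart_at.
Arguments chart_at {R} M x : rename.
Arguments dom {R} M i : rename.
Arguments chart {R} M i x : rename.
Arguments chart_inv {R} M i y : rename.

Definition pcoord {R : realType} (M : charted R) (x : M) : 'rV[R]_(dim M) :=
  chart M (chart_at M x) x.

(* P holds on a neighbourhood of x *)
Definition near_pt {R : realType} (M : charted R) (x : M) (P : set M) : Prop :=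
  \forall y \near pcoord x, P (chart_inv M (chart_at M x) y).

Definition open_in {R : realType} (M : charted R) (A : set M) : Prop :=
  forall x, A x -> near_pt x A.

Record smooth_manifold {R : realType} (M : charted R) : Prop := SmoothManifold {
  chart_atP : forall x : M, dom M (chart_at M x) x;
  chartK : forall i x, dom M i x -> chart_inv M i (chart M i x) = x;
  chart_open : forall i j, open (chart M i @` (dom M i `&` dom M j));
  transition_smooth : forall i j,
    Coo (chart M i @` (dom M i `&` dom M j)) (chart M j \o chart_inv M i);
  manifold_hausdorff : forall x y : M, x <> y ->
    exists A B : set M,
      [/\ open_in A, open_in B, A x, B y & A `&` B = set0];
  manifold_second_countable : exists B : nat -> set M,
    (forall k, open_in (B k)) /\
    (forall (A : set M) x, open_in A -> A x ->
       exists k, B k x /\ B k `<=` A)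
}.

Definition smooth_at {R : realType} (M N : charted R) (f : M -> N) (x : M) :
    Prop :=
  near_pt x [set y | dom N (chart_at N (f x)) (f y)] /\
  Coo_at (chart N (chart_at N (f x)) \o f \o chart_inv M (chart_at M x))
         (pcoord x).

Definition pair {R : realType} {n : nat} (a w : 'rV[R]_n) : R :=
  \sum_(j < n) a 0 j * w 0 j.

(* the covector a \o A, for A linear *)
Definition transp {R : realType} {m n : nat} (A : 'rV[R]_m -> 'rV[R]_n)
    (a : 'rV[R]_n) : 'rV[R]_m :=
  \row_j pair a (A (delta_mx 0 j)).

(* change of components at x, from chart i to chart j *)
Definition tchange {R : realType} (M : charted R) (i j : idx M) (x : M) :
    'rV[R]_(dim M) -> 'rV[R]_(dim M) :=
  'd (chart M j \o chart_inv M i) (chart M i x).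

Definition line (R : realType) : charted R :=
  Charted R 1 unit (fun _ => setT) (fun _ x => const_mx x)
    (fun _ y => y 0 0) (fun _ => tt).

Definition prod2 {R : realType} (M N : charted R) : charted R :=
  Charted (M * N)%type (dim M + dim N) (idx M * idx N)%type
    (fun i => [set z | dom M i.1 z.1 /\ dom N i.2 z.2])
    (fun i z => row_mx (chart M i.1 z.1) (chart N i.2 z.2))
    (fun i y => (chart_inv M i.1 (lsubmx y), chart_inv N i.2 (rsubmx y)))
    (fun z => (chart_at M z.1, chart_at N z.2)).

(* By the choice of preferred charts, the canonical isomorphisms between
   T_qQ (resp. T*_qQ), Q = Q_1 x ... x Q_n, and the direct sum of the
   T_{q_i}Q_i (resp. T*_{q_i}Q_i) are given by [submxrow] and [\mxrow]. *)
Definition prodn {R : realType} {n : nat} (M : 'I_n -> charted R) : charted R :=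
  Charted (forall i, M i) (\sum_(i < n) dim (M i)) (forall i, idx (M i))
    (fun c => [set x | forall i, dom (M i) (c i) (x i)])
    (fun c x => \mxrow_(i < n) chart (M i) (c i) (x i))
    (fun c y => fun i => chart_inv (M i) (c i) (submxrow y i))
    (fun x => fun i => chart_at (M i) (x i)).

Definition tangent {R : realType} (M : charted R) : charted R :=
  Charted (M * 'rV[R]_(dim M))%type (dim M + dim M) (idx M)
    (fun i => [set z | dom M i z.1])
    (fun i z => row_mx (chart M i z.1) (tchange (chart_at M z.1) i z.1 z.2))
    (fun i y => let x := chart_inv M i (lsubmx y) in
                (x, tchange i (chart_at M x) x (rsubmx y)))
    (fun z => chart_at M z.1).

Definition cotangent {R : realType} (M : charted R) : charted R :=
  Charted (M * 'rV[R]_(dim M))%type (dim M + dim M) (idx M)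
    (fun i => [set z | dom M i z.1])
    (fun i z => row_mx (chart M i z.1)
                  (transp (tchange i (chart_at M z.1) z.1) z.2))
    (fun i y => let x := chart_inv M i (lsubmx y) in
                (x, transp (tchange (chart_at M x) i x) (rsubmx y)))
    (fun z => chart_at M z.1).

(* TM (+) T*M, with points (x, v, p) *)
Definition pontryagin {R : realType} (M : charted R) : charted R :=
  Charted (M * 'rV[R]_(dim M) * 'rV[R]_(dim M))%type (dim M + dim M + dim M) (idx M)
    (fun i => [set z | dom M i z.1.1])
    (fun i z => let x := z.1.1 in
       row_mx (row_mx (chart M i x) (tchange (chart_at M x) i x z.1.2))
              (transp (tchange i (chart_at M x) x) z.2))
    (fun i y => let x := chart_inv M i (lsubmx (lsubmx y)) in
       (x, tchange i (chart_at M x) x (rsubmx (lsubmx y)),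
        transp (tchange (chart_at M x) i x) (rsubmx y)))
    (fun z => chart_at M z.1.1).

Definition cotangent_proj {R : realType} (M : charted R) : cotangent M -> M :=
  fst.
Arguments cotangent_proj {R} M _.

Definition tmap {R : realType} (M N : charted R) (f : M -> N) (x : M) :
    'rV[R]_(dim M) -> 'rV[R]_(dim N) :=
  'd (chart N (chart_at N (f x)) \o f \o chart_inv M (chart_at M x)) (pcoord x).

(* the pull-back T*_{f x}N -> T*_xM *)
Definition pull {R : realType} (M N : charted R) (f : M -> N) (x : M)
    (a : 'rV[R]_(dim N)) : 'rV[R]_(dim M) :=
  transp (tmap f x) a.

Definition velocity {R : realType} (M : charted R) (c : R -> M) (t : R) :
    'rV[R]_(dim M) :=
  'D_1 (chart M (chart_at M (c t)) \o c : R -> 'rV[R]_(dim M)) t.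

Definition differential {R : realType} (M : charted R) (f : M -> R) (x : M) :
    cotangent M :=
  (x, \row_j 'D_(delta_mx 0 j)
        (f \o chart_inv M (chart_at M x) : 'rV[R]_(dim M) -> R) (pcoord x)).

Definition distribution {R : realType} (M : charted R) : Type :=
  forall x : M, {vspace 'rV[R]_(dim M)}.

(* a smooth vector subbundle of TM *)
Definition smooth_distribution {R : realType} (M : charted R)
    (D : distribution M) : Prop :=
  forall x : M, exists (k : nat) (X : 'I_k -> M -> 'rV[R]_(dim M)),
    (forall j, smooth_at (N := tangent M) (fun y => (y, X j y)) x) /\
    near_pt x [set y | basis_of (D y) [tuple X j y | j < k]].

Definition dist_sum {R : realType} {n : nat} (M : 'I_n -> charted R)
    (D : forall i, distribution (M i)) : distribution (prodn M) :=
  fun x => (\bigcap_(i < n)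
    (linfun (fun w : 'rV[R]_(\sum_(i < n) dim (M i)) => submxrow w i)
       @^-1: D i (x i)))%VS.

Definition dist_cap {R : realType} (M : charted R) (D E : distribution M) :
    distribution M :=
  fun x => (D x :&: E x)%VS.

Definition intersect_cleanly {R : realType} (M : charted R)
    (D E : distribution M) : Prop :=
  forall x, near_pt x [set y | \dim (dist_cap D E y) = \dim (dist_cap D E x)].

Definition ann {R : realType} {n : nat} (A : set 'rV[R]_n) : set 'rV[R]_n :=
  [set a | forall w, A w -> pair a w = 0].

(* (T pi)^{-1}(D), with pi : T*M -> M *)
Definition dist_lift {R : realType} (M : charted R) (D : distribution M)
    (z : cotangent M) : set 'rV[R]_(dim (cotangent M)) :=
  [set w | tmap (cotangent_proj M) z w \in D (cotangent_proj M z)].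

(* fibrewise subsets of TM (+) T*M *)
Definition dirac {R : realType} (M : charted R) : Type :=
  forall x : M, 'rV[R]_(dim M) -> 'rV[R]_(dim M) -> Prop.

(* dq /\ dp in natural coordinates: Omega^flat (dq, dp) = (- dp, dq) *)
Definition Omega {R : realType} (M : charted R) (z : cotangent M)
    (v w : 'rV[R]_(dim M + dim M)) : R :=
  pair (row_mx (- rsubmx v) (lsubmx v)) w.

Definition induced_dirac {R : realType} (M : charted R) (D : distribution M) :
    dirac (cotangent M) :=
  fun z v a => dist_lift D z v /\
    forall w, dist_lift D z w -> pair a w = Omega z v w.

Definition int_dirac {R : realType} (M : charted R) (S : distribution M) :
    dirac (cotangent M) :=
  fun z v a => dist_lift S z v /\ ann (dist_lift S z) a.

Definition dirac_sum {R : realType} {n : nat} (M : 'I_n -> charted R)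
    (D : forall i, dirac (M i)) : dirac (prodn M) :=
  fun x v a => forall i, D i (x i) (submxrow v i) (submxrow a i).

Definition dirac_tensor {R : realType} (M : charted R) (Da Db : dirac M) :
    dirac M :=
  fun x v a => exists b, Da x v (a + b) /\ Db x v (- b).

(* transport of D from N to M along a diffeomorphism f : M -> N *)
Definition dirac_pull {R : realType} (M N : charted R) (f : M -> N)
    (D : dirac N) : dirac M :=
  fun x v a => exists b, D (f x) (tmap f x v) b /\ a = pull f x b.

(* the canonical diffeomorphism T*(Q_1 x ... x Q_n) -> T*Q_1 x ... x T*Q_n *)
Definition cotangent_prod {R : realType} {n : nat} (Q : 'I_n -> charted R)
    (z : cotangent (prodn Q)) : prodn (fun i => cotangent (Q i)) :=
  fun i => (z.1 i, submxrow z.2 i).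
Arguments cotangent_prod {R n} Q z.

Definition interconnected_dirac {R : realType} {n : nat} (Q : 'I_n -> charted R)
    (D : forall i, distribution (Q i)) (S : distribution (prodn Q)) :
    dirac (cotangent (prodn Q)) :=
  dirac_tensor
    (dirac_pull (cotangent_prod Q) (dirac_sum (fun i => induced_dirac (D i))))
    (int_dirac S).

(* (u, a) \in D x, where a \in T*M carries its base point *)
Definition in_dirac {R : realType} (M : charted R) (D : dirac M) (x : M)
    (u : 'rV[R]_(dim M)) (a : cotangent M) : Prop :=
  a.1 = x /\ D x u a.2.

(* T*TQ -> T*T*Q, (q, dq, dp, p) |-> (q, p, - dp, dq) in natural coordinates *)
Definition gammaQ {R : realType} (Q : charted R)
    (z : cotangent (tangent Q)) : cotangent (cotangent Q) :=
  let: ((q, v), a) := z in ((q, rsubmx a), row_mx (- lsubmx a) v).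

Definition dirac_differential {R : realType} (Q : charted R)
    (L : tangent Q -> R) (z : tangent Q) : cotangent (cotangent Q) :=
  gammaQ (differential L z).

Definition smooth_lagrangian {R : realType} (Q : charted R)
    (L : tangent Q -> R) : Prop :=
  forall z, smooth_at (N := line R) L z.

Definition tangent_comp {R : realType} {n : nat} (Q : 'I_n -> charted R)
    (z : tangent (prodn Q)) (i : 'I_n) : tangent (Q i) :=
  (z.1 i, submxrow z.2 i).

Definition lagrangian_sum {R : realType} {n : nat} (Q : 'I_n -> charted R)
    (L : forall i, tangent (Q i) -> R) (z : tangent (prodn Q)) : R :=
  \sum_(i < n) L i (tangent_comp z i).

(* The covector a - pi^* F, where pi^* F is the horizontal lift of F. *)
Definition sub_force {R : realType} (Q : charted R)
    (a : cotangent (cotangent Q)) (F : 'rV[R]_(dim Q)) :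
    cotangent (cotangent Q) :=
  (a.1, a.2 - pull (cotangent_proj Q) a.1 F).

(* Force fields (t, (q, v)) |-> F_i t (q, v) \in T*_{q_i}Q_i, smooth on
   [t1, t2] x TQ.  They may depend on time: the constraint forces are
   determined by the accelerations as well, and a curve satisfying the
   interconnected equations may pass through the same (q, v) twice with
   different accelerations (e.g. Q_1 = Q_2 = R, L_1 = v^2/2, L_2 = - v^2/2
   and the constraint dq_1 = dq_2, for which any motion is admissible). *)
Definition force_fields {R : realType} {n : nat} (Q : 'I_n -> charted R)
    (t1 t2 : R) (F : forall i, R -> tangent (prodn Q) -> 'rV[R]_(dim (Q i))) :
    Prop :=
  forall i t z, t1 <= t <= t2 ->
    smooth_at (M := prod2 (line R) (tangent (prodn Q)))
      (N := cotangent (Q i)) (fun y => (y.2.1 i, F i y.1 y.2)) (t, z).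

(* A map is smooth on [t1, t2] when it is smooth near each of its points. *)
Definition smooth_curve {R : realType} (M : charted R) (t1 t2 : R)
    (c : R -> M) : Prop :=
  forall t, t1 <= t <= t2 -> smooth_at (M := line R) c t.

Definition pontryagin_comp {R : realType} {n : nat} (Q : 'I_n -> charted R)
    (i : 'I_n) (z : pontryagin (prodn Q)) : pontryagin (Q i) :=
  (z.1.1 i, submxrow z.1.2 i, submxrow z.2 i).
Arguments pontryagin_comp {R n} Q i z.

Definition base {R : realType} {Q : charted R} (z : pontryagin Q) : Q := z.1.1.
Definition tpart {R : realType} {Q : charted R} (z : pontryagin Q) :
  tangent Q := z.1.
Definition cpart {R : realType} {Q : charted R} (z : pontryagin Q) :
  cotangent Q := (z.1.1, z.2).

Definition pontryagin_action {R : realType} (Q : charted R)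
    (L : tangent Q -> R) (t1 t2 : R) (c : R -> pontryagin Q) : R :=
  \int[@lebesgue_measure R]_(t in `[t1, t2])
    (L (tpart (c t)) + pair (c t).2 (velocity (base \o c) t - (c t).1.2)).

(* delta q *)
Definition base_variation {R : realType} (Q : charted R)
    (g : R -> R -> pontryagin Q) (t : R) : 'rV[R]_(dim Q) :=
  velocity (fun e => base (g e t)) 0.

(* smooth families g e of curves through g 0 = c, e near 0, whose projections
   to Q have fixed endpoints, and with delta q \in D along c *)
Definition admissible_variation {R : realType} (Q : charted R)
    (D : distribution Q) (t1 t2 : R) (c : R -> pontryagin Q)
    (g : R -> R -> pontryagin Q) : Prop :=
  [/\ forall t, t1 <= t <= t2 ->
        smooth_at (M := prod2 (line R) (line R)) (fun y => g y.1 y.2) (0, t),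
      forall t, t1 <= t <= t2 -> g 0 t = c t,
      \forall e \near (0 : R), base (g e t1) = base (c t1) /\
                               base (g e t2) = base (c t2) &
      forall t, t1 <= t <= t2 -> base_variation g t \in D (base (c t))].

Definition lda_pontryagin {R : realType} (Q : charted R) (L : tangent Q -> R)
    (D : distribution Q) (t1 t2 : R) (c : R -> pontryagin Q) : Prop :=
  forall g, admissible_variation D t1 t2 c g ->
    derivable (fun e => pontryagin_action L t1 t2 (g e)) 0 1 /\
    'D_1 (fun e => pontryagin_action L t1 t2 (g e)) 0 = 0.

(* the same with the external force F t \in T*_{q(t)}Q *)
Definition forced_lda_pontryagin {R : realType} (Q : charted R)
    (L : tangent Q -> R) (F : R -> 'rV[R]_(dim Q)) (D : distribution Q)
    (t1 t2 : R) (c : R -> pontryagin Q) : Prop :=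
  forall g, admissible_variation D t1 t2 c g ->
    derivable (fun e => pontryagin_action L t1 t2 (g e)) 0 1 /\
    'D_1 (fun e => pontryagin_action L t1 t2 (g e)) 0 +
      \int[@lebesgue_measure R]_(t in `[t1, t2])
        pair (F t) (base_variation g t) = 0.

(* Main.v *)
From HB Require Import structures.
From mathcomp Require Import ring lra finmap.
Require Import Defs.

(* In any chart, integration by parts turns the first variation of the action
   into the integral of
     <dL/dq - p', dq> + <dL/dv - p, dv> + <dp, q' - v>.
   Testing the principle on variations cut off by bump functions, it is
   therefore equivalent to pointwise equations, which are also what the Dirac
   inclusions say in coordinates; they do not depend on the chart.
   If the covector dL/dq - p' vanishes on the intersection of the direct sum
   of the Delta_i with Sigma, it remains to find a smooth F annihilating
   Sigma such that dL/dq - p' + F vanishes on the whole direct sum. By clean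
   intersection, the matrix stacking local frames of the two distributions
   along the curve has locally constant rank, hence a smooth generalized
   inverse W. It provides smooth sections of the intersection, used as
   variations, and a smooth splitting of the covectors that vanish on the
   intersection, used as the force. The conditions on F at a given time are
   convex, so the local forces can be glued by a partition of unity. *)

(** * Smooth germs on normed spaces *)

(** Vectors, covectors and distributions are given by components in a preferred chart at each point,
    and this chart may jump from one point to the next. Derivatives are therefore taken in a chart
    held fixed near the time considered, and the results are converted by Jacobians. Neither dL/dq
    nor p' transforms as a covector, so chart independence is not obtained by transforming them.
    Instead, the pointwise expression is recognised as the derivative in [e] of the integrand minus
    the derivative in [t] of <p, dq>, both of which are defined without choosing a chart. Variations
    agree with the curve only on the closed interval [[t1, t2]]. Time derivatives at the endpoints
    are therefore compared through one-sided limits, and the equations at the endpoints are reached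
    from interior times, where a cut-off leaves the endpoints fixed. The four statements are
    compared through a common one: the unforced implicit Lagrange equations on Delta_Q together with
    the velocity constraint. *)

Section Calculus.
Context {R : realType}.
Implicit Types (V W : normedModType R).

(** [g - f] vanishes near [x], so it is a little-o and its differential is zero. *)
Lemma near_eq_differentiable V W (f g : V -> W) x :
  (\forall y \near x, f y = g y) -> differentiable f x -> differentiable g x.
Proof.
move=> fg df.
have -> : g = f + (g - f) by rewrite addrC subrK.
apply: differentiableD => //.
have d0 : \forall y \near x, (g - f) y = 0.
  by apply: filterS fg => y; rewrite /GRing.add /GRing.opp /= => ->; rewrite subrr.
have dx0 := nbhs_singleton d0.
have o0 : (g - f) \o shift x = cst ((g - f) x) + (\0 : V -> W) +o_ 0 id.
  apply/eqaddoP => e e0; rewrite dx0.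
  have : \forall y \near 0, (g - f) (y + x) = 0.
    by move: d0; rewrite (near_shift 0) /= subr0.
  apply: filterS => y /= y0; rewrite /GRing.add /GRing.opp /= in y0 *.
  by rewrite y0 /cst !addr0 subr0 normr0 mulr_ge0// ltW.
have c0 : continuous (\0 : V -> W) by move=> ?; exact: cvg_cst.
by apply/diff_locallyP; rewrite (diff_unique c0 o0).
Qed.

(** Scalar counterpart of [Ck] on an arbitrary normed space: values can be multiplied and inverted,
    and the source can be [R], for time, as well as a space of row vectors. [Ck_Cr] relates the two
    notions. *)
Fixpoint Cr V (k : nat) (U : set V) (f : V -> R) : Prop :=
  match k with
  | 0%N => forall x, U x -> {for x, continuous f}
  | k'.+1 => (forall x, U x -> differentiable f x) /\
             (forall w, Cr k' U (fun x => 'D_w f x))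
  end.

Lemma Cr_eq V k (U : set V) f g : open U -> {in U, f =1 g} ->
  Cr k U f -> Cr k U g.
Proof.
move=> oU; have nU x : U x -> \forall y \near x, U y.
  by move=> Ux; apply: open_nbhs_nbhs.
elim: k f g => [|k IH] f g fg /=.
  move=> cf x Ux; rewrite /prop_for /continuous_at -fg ?inE//.
  apply: cvg_trans (cf x Ux); apply: near_eq_cvg.
  by apply: filterS (nU _ Ux) => y Uy; rewrite fg// inE.
move=> [df Df]; split => [x Ux|w].
  apply: near_eq_differentiable (df x Ux).
  by apply: filterS (nU _ Ux) => y Uy; rewrite fg// inE.
apply: IH (Df w) => x; rewrite inE => Ux; apply: near_eq_derive.
by apply: filterS (nU _ Ux) => y Uy; rewrite fg// inE.
Qed.

Lemma Cr_sub V k (U U' : set V) f : U' `<=` U -> Cr k U f -> Cr k U' f.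
Proof.
move=> UU; elim: k f => [|k IH] f /=; first by move=> cf x /UU; exact: cf.
by move=> [df Df]; split => [x /UU|w]; [exact: df|exact: IH].
Qed.

Lemma CrW V k (U : set V) f : Cr k.+1 U f -> Cr k U f.
Proof.
elim: k f => [|k IH] f.
  by move=> [df _] x Ux; apply/differentiable_continuous/df.
by move=> [df Df]; split => // w; apply: IH.
Qed.

Lemma Cr_cst V k (U : set V) (a : R) : open U -> Cr k U (fun=> a).
Proof.
move=> oU; elim: k a => [|k IH] a /=; first by move=> x _; exact: cvg_cst.
split => [x _|w]; first exact: differentiable_cst.
by apply: Cr_eq (IH 0) => // x _; rewrite derive_cst.
Qed.

Lemma CrD V k (U : set V) f g : open U -> Cr k U f -> Cr k U g ->
  Cr k U (fun x => f x + g x).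
Proof.
move=> oU; elim: k f g => [|k IH] f g /=.
  by move=> cf cg x Ux; apply: cvgD; [exact: cf|exact: cg].
move=> [df Df] [dg Dg]; split => [x Ux|w].
  by apply: (@differentiableD _ _ _ f g); [exact: df|exact: dg].
apply: Cr_eq (IH _ _ (Df w) (Dg w)) => // x; rewrite inE => Ux.
by rewrite (@deriveD _ _ _ f g)//; apply: diff_derivable; [exact: df|exact: dg].
Qed.

Lemma CrM V k (U : set V) f g : open U -> Cr k U f -> Cr k U g ->
  Cr k U (fun x => f x * g x).
Proof.
move=> oU; elim: k f g => [|k IH] f g /=.
  by move=> cf cg x Ux; apply: cvgM; [exact: cf|exact: cg].
move=> Cf Cg; have [df Df] := Cf; have [dg Dg] := Cg; split => [x Ux|w].
  by apply: (@differentiableM _ _ f g); [exact: df|exact: dg].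
apply: Cr_eq (CrD oU (IH _ _ (CrW Cf) (Dg w)) (IH _ _ (CrW Cg) (Df w))) => //.
move=> x; rewrite inE => Ux.
by rewrite (@deriveM _ _ f g)//; apply: diff_derivable; [exact: df|exact: dg].
Qed.

Lemma Cr_sum V k (U : set V) (I : Type) (s : seq I) (P : pred I) F : open U ->
  (forall i, P i -> Cr k U (F i)) -> Cr k U (fun x => \sum_(i <- s | P i) F i x).
Proof.
move=> oU CF; elim: s => [|i s IH].
  by apply: Cr_eq (@Cr_cst _ k U 0 oU) => // x _; rewrite big_nil.
have [Pi|Pi] := boolP (P i).
  by apply: Cr_eq (CrD oU (CF i Pi) IH) => // x _; rewrite big_cons Pi.
by apply: Cr_eq IH => // x _; rewrite big_cons (negbTE Pi).
Qed.

Lemma differentiable_mx V m n (f : V -> 'M[R]_(m, n)) x :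
  (forall i j, differentiable (fun y => f y i j) x) -> differentiable f x.
Proof.
move=> df.
have -> : f = \sum_(i < m) (fun y => \sum_(j < n) (f y i j *: delta_mx i j : 'M[R]_(m,n))).
  by apply/funext => y; rewrite fct_sumE [LHS]matrix_sum_delta.
apply: differentiable_sum => i.
have -> : (fun y => \sum_(j < n) (f y i j *: delta_mx i j : 'M[R]_(m,n))) = \sum_(j < n) (fun y => f y i j *: delta_mx i j).
  by apply/funext => y; rewrite fct_sumE.
by apply: differentiable_sum => j; apply: differentiableZl.
Qed.

Lemma derive_sum_delta n (g : 'rV[R]_n -> R) y u : differentiable g y ->
  'D_u g y = \sum_(j < n) u 0 j * 'D_(delta_mx 0 j) g y.
Proof.
move=> dg; rewrite deriveE// [u in LHS]row_sum_delta linear_sum.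
by apply: eq_bigr => j _; rewrite linearZ /= deriveE.
Qed.

Lemma derive_comp V W W' (f : V -> W) (g : W -> W') x w :
  differentiable f x -> differentiable g (f x) ->
  'D_w (g \o f) x = 'D_('D_w f x) g (f x).
Proof.
move=> df dg; rewrite deriveE; last exact: differentiable_comp.
by rewrite diff_comp //= -!deriveE.
Qed.

Lemma derive_compE V n (f : V -> 'rV[R]_n) (g : 'rV[R]_n -> R) x w :
  differentiable f x -> differentiable g (f x) ->
  'D_w (g \o f) x =
  \sum_(j < n) 'D_w (fun y => f y 0 j) x * 'D_(delta_mx 0 j) g (f x).
Proof.
move=> df dg; rewrite derive_comp// derive_sum_delta//; apply: eq_bigr => j _.
by rewrite derive_mx ?mxE//; apply: diff_derivable.
Qed.

Lemma continuous_mx V m n (f : V -> 'M[R]_(m, n)) x :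
  (forall i j, {for x, continuous (fun y => f y i j)}) -> {for x, continuous f}.
Proof.
move=> cf; apply/cvgrPdist_le => /= e e0; near=> y.
rewrite /Num.Def.normr/= mx_normrE (bigmax_le _ (ltW e0))//= => i _.
rewrite !mxE/=; move: i; near: y; apply: filter_forall => /= i.
exact: ((cvgrPdist_le _ _).1 (cf i.1 i.2)).
Unshelve. all: by end_near. Qed.

(** By the chain rule, a derivative of [g \o f] is a sum of products of a derivative of a component
    of [f] and a partial derivative of [g] composed with [f]. The induction hypothesis applies to
    the latter. *)
Lemma Cr_comp V n k (U : set V) (U' : set 'rV[R]_n) (f : V -> 'rV[R]_n) g :
  open U -> open U' -> (forall x, U x -> U' (f x)) ->
  (forall j, Cr k U (fun x => f x 0 j)) -> Cr k U' g -> Cr k U (g \o f).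
Proof.
move=> oU oU' UU'; elim: k f g UU' => [|k IH] f g UU'.
  move=> cf cg x Ux; apply: continuous_comp; last exact/cg/UU'.
  by apply: continuous_mx => i j; rewrite (ord1 i); apply: cf.
move=> Cf Cg.
have df x : U x -> differentiable f x.
  by move=> Ux; apply: differentiable_mx => i j; rewrite (ord1 i); apply: (Cf j).1.
split => [x Ux|w].
  by apply: differentiable_comp; [exact: df|exact/Cg.1/UU'].
apply: (@Cr_eq _ _ _ (fun x => \sum_(j < n) 'D_w (fun y => f y 0 j) x *
   ('D_(delta_mx 0 j) g \o f) x)) => //.
  by move=> x; rewrite inE => Ux; rewrite derive_compE; [|exact: df|exact/Cg.1/UU'].
apply: Cr_sum => // j _; apply: CrM => //; first by case: (Cf j) => _; apply.
apply: IH => //; first by move=> i; apply: CrW (Cf i).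
by case: Cg => _; apply.
Qed.

(** The derivative of the inverse is [- f^-1 * f^-1 * 'D_w f], so each order of regularity follows
    from the preceding one. *)
Lemma Cr_inv V k (U : set V) f : open U -> (forall x, U x -> f x != 0) ->
  Cr k U f -> Cr k U (fun x => (f x)^-1).
Proof.
move=> oU f0; elim: k => [|k IH] Cf.
  by move=> x Ux; apply: cvgV; [exact: f0|exact: Cf].
have [df Df] := Cf; split => [x Ux|w].
  by apply: differentiableV; [exact: df|exact: f0].
have Ci := IH (CrW Cf).
apply: Cr_eq (CrM oU (@Cr_cst _ k U (-1) oU) (CrM oU (CrM oU Ci Ci) (Df w))) => //.
move=> x; rewrite inE => Ux; rewrite deriveV ?f0//; last exact/diff_derivable/df.
by rewrite mulN1r /GRing.scale /= -exprVn expr2 mulNr.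
Qed.

(** One neighbourhood serves all orders, as in [Coo_at]. Working with germs keeps open sets out of
    the later statements. *)
Definition sm V (f : V -> R) (x : V) : Prop :=
  exists U, [/\ open U, U x & forall k, Cr k U f].

Definition smv V m n (f : V -> 'M[R]_(m, n)) (x : V) : Prop :=
  forall i j, sm (fun y => f y i j) x.

Lemma sm_eq V (f g : V -> R) x : (\forall y \near x, f y = g y) -> sm f x -> sm g x.
Proof.
move=> /nbhs_interior fg [U [oU Ux Cf]].
exists (U `&` [set y | f y = g y]°); split.
- by apply: openI => //; exact: open_interior.
- by split => //; exact: nbhs_singleton.
- move=> k; apply: (@Cr_eq _ _ _ f); last by apply: Cr_sub (Cf k) => y [].
    by apply: openI => //; exact: open_interior.
  by move=> y; rewrite inE => -[_ /interior_subset].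
Qed.

Lemma sm_near V (f : V -> R) x : sm f x -> \forall y \near x, sm f y.
Proof.
move=> [U [oU Ux Cf]]; have : nbhs x U by exact: open_nbhs_nbhs.
by apply: filterS => y Uy; exists U.
Qed.

Lemma sm_differentiable V (f : V -> R) x : sm f x -> differentiable f x.
Proof. by move=> [U [oU Ux /(_ 1%N) [+ _]]]; apply. Qed.

Lemma sm_derivable V (f : V -> R) x w : sm f x -> derivable f x w.
Proof. by move=> /sm_differentiable /diff_derivable. Qed.

Lemma sm_continuous V (f : V -> R) x : sm f x -> {for x, continuous f}.
Proof. by move=> /sm_differentiable /differentiable_continuous. Qed.

Lemma sm_derive V (f : V -> R) x w : sm f x -> sm ('D_w f) x.
Proof. by move=> [U [oU Ux Cf]]; exists U; split => // k; case: (Cf k.+1) => _; apply. Qed.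

Lemma sm_cst V (a : R) (x : V) : sm (fun=> a) x.
Proof. by exists setT; split => //; [exact: openT|move=> k; apply: Cr_cst; exact: openT]. Qed.

Lemma smD V (f g : V -> R) x : sm f x -> sm g x -> sm (fun y => f y + g y) x.
Proof.
move=> [U [oU Ux Cf]] [U' [oU' Ux' Cg]]; exists (U `&` U'); split=> [||k].
- exact: openI.
- by [].
- apply: CrD; first exact: openI.
    by apply: Cr_sub (Cf k) => ? [].
  by apply: Cr_sub (Cg k) => ? [].
Qed.

Lemma smM V (f g : V -> R) x : sm f x -> sm g x -> sm (fun y => f y * g y) x.
Proof.
move=> [U [oU Ux Cf]] [U' [oU' Ux' Cg]]; exists (U `&` U'); split=> [||k].
- exact: openI.
- by [].
- apply: CrM; first exact: openI.
    by apply: Cr_sub (Cf k) => ? [].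
  by apply: Cr_sub (Cg k) => ? [].
Qed.

Lemma smN V (f : V -> R) x : sm f x -> sm (fun y => - f y) x.
Proof.
move=> sf; apply: sm_eq (smM (sm_cst (-1) x) sf).
by apply: nearW => y; rewrite mulN1r.
Qed.

Lemma smB V (f g : V -> R) x : sm f x -> sm g x -> sm (fun y => f y - g y) x.
Proof. by move=> sf sg; apply: smD => //; exact: smN. Qed.

Lemma smV V (f : V -> R) x : f x != 0 -> sm f x -> sm (fun y => (f y)^-1) x.
Proof.
move=> f0 sf; have [U [oU Ux Cf]] := sf.
have : \forall y \near x, f y != 0.
  by have := sm_continuous sf; move/cvgr_neq0; apply.
move=> /nbhs_interior/nbhs_singleton nf0.
have oI : open (U `&` [set y | f y != 0]°) by apply: openI => //; exact: open_interior.
exists (U `&` [set y | f y != 0]°); split => // k.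
apply: Cr_inv => //; first by move=> y [_ /interior_subset].
by apply: Cr_sub (Cf k) => ? [].
Qed.

Lemma sm_sum V (I : Type) (s : seq I) (P : pred I) (F : I -> V -> R) x :
  (forall i, P i -> sm (F i) x) -> sm (fun y => \sum_(i <- s | P i) F i y) x.
Proof.
move=> sF; elim: s => [|i s IH].
  by apply: sm_eq (sm_cst 0 x); apply: nearW => y; rewrite big_nil.
have [Pi|Pi] := boolP (P i).
  by apply: sm_eq (smD (sF i Pi) IH); apply: nearW => y; rewrite big_cons Pi.
by apply: sm_eq IH; apply: nearW => y; rewrite big_cons (negbTE Pi).
Qed.

Lemma sm_prod V (I : Type) (s : seq I) (P : pred I) (F : I -> V -> R) x :
  (forall i, P i -> sm (F i) x) -> sm (fun y => \prod_(i <- s | P i) F i y) x.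
Proof.
move=> sF; elim: s => [|i s IH].
  by apply: sm_eq (sm_cst 1 x); apply: nearW => y; rewrite big_nil.
have [Pi|Pi] := boolP (P i).
  by apply: sm_eq (smM (sF i Pi) IH); apply: nearW => y; rewrite big_cons Pi.
by apply: sm_eq IH; apply: nearW => y; rewrite big_cons (negbTE Pi).
Qed.

Lemma smv_near V m n (f : V -> 'M[R]_(m, n)) x : smv f x ->
  \forall y \near x, smv f y.
Proof.
move=> sf; apply: filter_forall => i; apply: filter_forall => j.
exact: sm_near (sf i j).
Qed.

Lemma smv_differentiable V m n (f : V -> 'M[R]_(m, n)) x : smv f x ->
  differentiable f x.
Proof. by move=> sf; apply: differentiable_mx => i j; apply: sm_differentiable. Qed.

Lemma smv_derivable V m n (f : V -> 'M[R]_(m, n)) x w : smv f x -> derivable f x w.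
Proof. by move=> /smv_differentiable /diff_derivable. Qed.

Lemma smv_continuous V m n (f : V -> 'M[R]_(m, n)) x : smv f x ->
  {for x, continuous f}.
Proof. by move=> /smv_differentiable /differentiable_continuous. Qed.

Lemma smv_eq V m n (f g : V -> 'M[R]_(m, n)) x :
  (\forall y \near x, f y = g y) -> smv f x -> smv g x.
Proof.
by move=> fg sf i j; apply: sm_eq (sf i j); apply: filterS fg => y ->.
Qed.

Lemma derive_mxE V m n (f : V -> 'M[R]_(m, n)) x w i j : smv f x ->
  ('D_w f x) i j = 'D_w (fun y => f y i j) x.
Proof. by move=> sf; rewrite derive_mx ?mxE//; exact: smv_derivable. Qed.

Lemma smv_derive V m n (f : V -> 'M[R]_(m, n)) x w : smv f x -> smv ('D_w f) x.
Proof.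
move=> sf i j; apply: sm_eq (sm_derive w (sf i j)).
by apply: filterS (smv_near sf) => y sy; rewrite derive_mxE.
Qed.

Lemma smv_common V m n (f : V -> 'M[R]_(m, n)) x : smv f x ->
  exists U, [/\ open U, U x & forall i j k, Cr k U (fun y => f y i j)].
Proof.
move=> sf; have /choice[U HU] (ij : 'I_m * 'I_n) := sf ij.1 ij.2.
have /nbhs_interior/nbhs_singleton Ux : \forall y \near x, forall ij, U ij y.
  by apply: filter_forall => ij; have [oU Ux _] := HU ij; exact: open_nbhs_nbhs.
exists ([set y | forall ij, U ij y]°); split => [||i j k] //.
  exact: open_interior.
by have [_ _ C] := HU (i, j); apply: Cr_sub (C k) => y /interior_subset; apply.
Qed.

Lemma sm_comp V n (f : V -> 'rV[R]_n) (g : 'rV[R]_n -> R) x :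
  smv f x -> sm g (f x) -> sm (g \o f) x.
Proof.
move=> sf [U' [oU' U'x Cg]].
have [U [oU Ux /(_ 0) Cf]] := smv_common sf.
have cf y : U y -> {for y, continuous f}.
  move=> Uy; apply: continuous_mx => i j; rewrite (ord1 i).
  exact: (Cf j 0%N) Uy.
have oUf : open (U `&` f @^-1` U').
  rewrite openE => y [Uy U'y]; apply: filterI; first exact: open_nbhs_nbhs.
  by apply: cf => //; exact: open_nbhs_nbhs.
exists (U `&` f @^-1` U'); split => // k.
apply: (Cr_comp oUf oU') => //; first by move=> y [].
by move=> j; apply: Cr_sub (Cf j k) => ? [].
Qed.

Lemma smv_comp V n p q (f : V -> 'rV[R]_n) (g : 'rV[R]_n -> 'M[R]_(p, q)) x :
  smv f x -> smv g (f x) -> smv (g \o f) x.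
Proof. by move=> sf sg i j; apply: sm_comp (sg i j). Qed.

End Calculus.

(** * Closure properties of smooth germs and symmetry of second derivatives *)

Section Calculus2.
Context {R : realType}.
Implicit Types (V W : normedModType R).

(** The linear map may take values in any normed space, whereas [Cr_comp] requires row vectors. It
    serves to pass from functions on [R] to functions on ['rV[R]_1] in [sm_comp1]. *)
Lemma Cr_lincomp V W k (h : {linear V -> W}) (U : set W) (g : W -> R) :
  continuous h -> Cr k U g -> Cr k (h @^-1` U) (g \o h).
Proof.
move=> ch; have dh x : differentiable h x by apply: linear_differentiable.
elim: k g => [|k IH] g.
  by move=> cg x Ux; apply: continuous_comp; [exact: ch|exact: cg].
move=> [dg Dg]; split => [x Ux|w]; first by apply: differentiable_comp; [|exact: dg].
have -> : (fun x => 'D_w (g \o h) x) = (fun x => 'D_(h w) g x) \o h.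
  apply/funext => x /=; rewrite /derive.
  have -> : (fun r => r^-1 *: (((g \o h) \o shift x) (r *: w) - (g \o h) x)) =
      (fun r => r^-1 *: ((g \o shift (h x)) (r *: h w) - g (h x))).
    by apply/funext => r /=; rewrite (linearD h) (linearZZ h).
  by [].
exact: IH (Dg (h w)).
Qed.

Lemma sm_lincomp V W (h : {linear V -> W}) (g : W -> R) x :
  continuous h -> sm g (h x) -> sm (g \o h) x.
Proof.
move=> ch [U [oU Ux Cg]]; exists (h @^-1` U); split => // [|k].
  by apply: open_comp => // y _; exact: ch.
exact: Cr_lincomp.
Qed.

Lemma sm_linear V (h : {linear V -> R}) x : continuous h -> sm h x.
Proof.
move=> ch; exists setT; split => //; [exact: openT|case => [|k]].
  by move=> y _; exact: ch.
split => [y _|w]; first exact: linear_differentiable.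
have -> : (fun x => 'D_w h x) = (fun=> h w).
  apply/funext => y; rewrite deriveE ?diff_lin//; exact: linear_differentiable.
exact/Cr_cst/openT.
Qed.

Lemma sm_coord m n i j (M : 'M[R]_(m, n)) : sm (fun N : 'M[R]_(m, n) => N i j) M.
Proof.
have @f : {linear 'M[R]_(m, n) -> R}.
  by exists (fun N : 'M[R]_(_, _) => N i j); do 2![eexists]; do ?[constructor];
     rewrite ?mxE// => ? *; rewrite ?mxE//; move=> ?; rewrite !mxE.
exact/(@sm_linear _ f)/coord_continuous.
Qed.

Lemma sm_id (x : R) : sm id x.
Proof. by apply: (@sm_linear _ idfun) => y. Qed.

Lemma smv_id m n (M : 'M[R]_(m, n)) : smv id M.
Proof. by move=> i j; exact: sm_coord. Qed.

Lemma smv_cst V m n (M : 'M[R]_(m, n)) (x : V) : smv (fun=> M) x.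
Proof. by move=> i j; exact: sm_cst. Qed.

Lemma smvD V m n (f g : V -> 'M[R]_(m, n)) x :
  smv f x -> smv g x -> smv (fun y => f y + g y) x.
Proof.
move=> sf sg i j; under eq_fun do rewrite mxE; exact: smD.
Qed.

Lemma smvN V m n (f : V -> 'M[R]_(m, n)) x : smv f x -> smv (fun y => - f y) x.
Proof. by move=> sf i j; under eq_fun do rewrite mxE; exact: smN. Qed.

Lemma smvB V m n (f g : V -> 'M[R]_(m, n)) x :
  smv f x -> smv g x -> smv (fun y => f y - g y) x.
Proof. by move=> sf sg; apply: smvD => //; exact: smvN. Qed.

Lemma smvZ V m n (r : V -> R) (f : V -> 'M[R]_(m, n)) x :
  sm r x -> smv f x -> smv (fun y => r y *: f y) x.
Proof. by move=> sr sf i j; under eq_fun do rewrite mxE; exact: smM. Qed.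

Lemma smv_sum V m n (I : Type) (s : seq I) (P : pred I) (F : I -> V -> 'M[R]_(m, n)) x :
  (forall i, P i -> smv (F i) x) -> smv (fun y => \sum_(i <- s | P i) F i y) x.
Proof.
move=> sF i j; under eq_fun do rewrite summxE.
by apply: sm_sum => k Pk; apply: sF.
Qed.

Lemma smv_mul V m n p (f : V -> 'M[R]_(m, n)) (g : V -> 'M[R]_(n, p)) x :
  smv f x -> smv g x -> smv (fun y => f y *m g y) x.
Proof.
move=> sf sg i j; under eq_fun do rewrite mxE.
by apply: sm_sum => k _; apply: smM.
Qed.

Lemma sm_det V n (f : V -> 'M[R]_n) x : smv f x -> sm (fun y => \det (f y)) x.
Proof.
move=> sf; apply: sm_sum => s _; apply: smM; first exact: sm_cst.
by apply: sm_prod => i _; apply: sf.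
Qed.

(** Near [x] the inverse is the adjugate divided by the determinant, and both are polynomial in the
    entries. *)
Lemma smv_invmx V n (f : V -> 'M[R]_n) x : f x \in unitmx -> smv f x ->
  smv (fun y => invmx (f y)) x.
Proof.
move=> ux sf.
have dx : \det (f x) != 0 by rewrite -unitfE -unitmxE.
have su : \forall y \near x, \det (f y) != 0.
  by have := sm_continuous (sm_det sf); move/cvgr_neq0; apply.
apply: (@smv_eq _ _ _ _ (fun y => (\det (f y))^-1 *: \adj (f y))).
  apply: filterS su => y dy; rewrite /invmx unitmxE unitfE dy //.
apply: smvZ; first exact/smV/sm_det.
move=> i j; under eq_fun do rewrite mxE.
apply: smM; first exact: sm_cst.
apply: sm_det => k l; under eq_fun do rewrite !mxE; exact: sf.
Qed.

Lemma smv_row_mx V m n p (f : V -> 'M[R]_(m, n)) (g : V -> 'M[R]_(m, p)) x :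
  smv f x -> smv g x -> smv (fun y => row_mx (f y) (g y)) x.
Proof.
move=> sf sg i j; under eq_fun do rewrite mxE.
by case: (fintype.split j) => k; [exact: sf|exact: sg].
Qed.

Lemma smv_col_mx V m n p (f : V -> 'M[R]_(n, m)) (g : V -> 'M[R]_(p, m)) x :
  smv f x -> smv g x -> smv (fun y => col_mx (f y) (g y)) x.
Proof.
move=> sf sg i j; under eq_fun do rewrite mxE.
by case: (fintype.split i) => k; [exact: sf|exact: sg].
Qed.

Lemma smv_lsubmx V m n p (f : V -> 'M[R]_(m, n + p)) x :
  smv f x -> smv (fun y => lsubmx (f y)) x.
Proof. by move=> sf i j; under eq_fun do rewrite mxE; exact: sf. Qed.

Lemma smv_rsubmx V m n p (f : V -> 'M[R]_(m, n + p)) x :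
  smv f x -> smv (fun y => rsubmx (f y)) x.
Proof. by move=> sf i j; under eq_fun do rewrite mxE; exact: sf. Qed.

Lemma smv_tr V m n (f : V -> 'M[R]_(m, n)) x :
  smv f x -> smv (fun y => (f y)^T) x.
Proof. by move=> sf i j; under eq_fun do rewrite mxE; exact: sf. Qed.

Lemma smv_mxrow V m n (p_ : 'I_n -> nat) (f : forall i, V -> 'M[R]_(m, p_ i)) x :
  (forall i, smv (f i) x) -> smv (fun y => \mxrow_i f i y) x.
Proof. by move=> sf i j; under eq_fun do rewrite mxE; exact: sf. Qed.

Lemma smv_submxrow V m n (p_ : 'I_n -> nat) (f : V -> 'M[R]_(m, \sum_i p_ i)) x j :
  smv f x -> smv (fun y => submxrow (f y) j) x.
Proof. by move=> sf i k; under eq_fun do rewrite mxE; exact: sf. Qed.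

Lemma smv_const_mx V m n (f : V -> R) x : sm f x ->
  smv (fun y => const_mx (f y) : 'M[R]_(m, n)) x.
Proof. by move=> sf i j; under eq_fun do rewrite mxE. Qed.

Lemma sm_pair V n (f g : V -> 'rV[R]_n) x : smv f x -> smv g x ->
  sm (fun y => pair (f y) (g y)) x.
Proof. by move=> sf sg; apply: sm_sum => j _; apply: smM. Qed.

Lemma sm_comp1 V (f : V -> R) (g : R -> R) x : sm f x -> sm g (f x) -> sm (g \o f) x.
Proof.
move=> sf sg.
have @h : {linear 'rV[R]_1 -> R}.
  by exists (fun N : 'rV[R]_1 => N 0 0); do 2![eexists]; do ?[constructor];
     rewrite ?mxE// => ? *; rewrite ?mxE//; move=> ?; rewrite !mxE.
have -> : g \o f = (g \o h) \o (fun y => const_mx (f y)).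
  by apply/funext => y /=; rewrite mxE.
apply: sm_comp; first exact: smv_const_mx.
apply: sm_lincomp; first exact: coord_continuous.
by rewrite /= mxE.
Qed.

Lemma Ck_Cr m n k (U : set 'rV[R]_m) (f : 'rV[R]_m -> 'rV[R]_n) : open U ->
  Ck k U f <-> forall j, Cr k U (fun y => f y 0 j).
Proof.
move=> oU; elim: k f => [|k IH] f /=.
  split => [cf j x Ux|cf x Ux].
    apply: (@continuous_comp _ _ _ f (fun N : 'rV_n => N 0 j)); first exact: cf.
    exact: coord_continuous.
  by apply: continuous_mx => i j; rewrite (ord1 i); exact: cf.
split => [[df Df] j|Cf].
  split => [x Ux|w].
    apply: (@differentiable_comp _ _ _ _ f (fun N : 'rV_n => N 0 j)); first exact: df.
    exact: differentiable_coord.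
  have /IH/(_ j) := Df w; apply: Cr_eq => // x; rewrite inE => Ux.
  by rewrite derive_mx ?mxE//; apply: diff_derivable; exact: df.
have df x : U x -> differentiable f x.
  by move=> Ux; apply: differentiable_mx => i j; rewrite (ord1 i); apply: (Cf j).1.
split => // w; apply/IH => j; have [_ /(_ w)] := Cf j.
apply: Cr_eq => // x; rewrite inE => Ux.
by rewrite derive_mx ?mxE//; apply: diff_derivable; exact: df.
Qed.

Lemma Coo_atP m n (f : 'rV[R]_m -> 'rV[R]_n) x : Coo_at f x <-> smv f x.
Proof.
split => [[U [oU Ux Cf]] i j|/smv_common[U [oU Ux Cf]]].
  by rewrite (ord1 i); exists U; split => // k; move/Ck_Cr : (Cf k); apply.
by exists U; split => // k; apply/Ck_Cr.
Qed.

Lemma Coo_smv m n (U : set 'rV[R]_m) (f : 'rV[R]_m -> 'rV[R]_n) x :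
  open U -> U x -> Coo U f -> smv f x.
Proof. by move=> oU Ux Cf; apply/Coo_atP; exists U. Qed.

Lemma smv_comp1 V m n (r : V -> R) (f : R -> 'M[R]_(m, n)) x :
  sm r x -> smv f (r x) -> smv (f \o r) x.
Proof. by move=> sr sf i j; apply: (@sm_comp1 _ r (fun s => f s i j)). Qed.

Lemma is_derive_line V W (f : V -> W) y u r : derivable f (y + r *: u) u ->
  is_derive r 1 (fun s => f (y + s *: u)) ('D_u f (y + r *: u)).
Proof.
move=> df.
have E : (fun h : R => h^-1 *: (((fun s => f (y + s *: u)) \o shift r) (h *: 1) -
      f (y + r *: u))) =
    (fun h : R => h^-1 *: ((f \o shift (y + r *: u)) (h *: u) - f (y + r *: u))).
  apply/funext => h /=; rewrite -[h *: 1]/(h * 1) mulr1.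
  by rewrite scalerDl addrCA.
by apply: DeriveDef; rewrite /derivable /derive E.
Qed.

Let second_difference V (f : V -> R) x u v s :=
  f (x + s *: u + s *: v) - f (x + s *: u) - (f (x + s *: v) - f x).

(** Two uses of the mean value theorem: along [u] for [phi], then along [v] for [psi]. They turn the
    second difference into [s ^+ 2] times a mixed derivative at a point [x + a *: u + b *: v] with
    [a] and [b] between 0 and [s], and this derivative is continuous. *)
Lemma second_difference_limit V (f : V -> R) x u v e : sm f x -> 0 < e ->
  exists2 r, 0 < r & forall s, 0 < s < r ->
   `|'D_v ('D_u f) x - (s ^+ 2)^-1 * second_difference f x u v s| <= e.
Proof.
move=> sf e0.
have /nbhs_ballP[r /= r0 br] : \forall y \near x, sm f y /\ `|'D_v ('D_u f) x - 'D_v ('D_u f) y| <= e.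
  apply: filterI; first exact: sm_near.
  have := sm_continuous (sm_derive v (sm_derive u sf)).
  by move/cvgrPdist_le; apply.
(* The summand 1 keeps the denominator positive when both directions vanish. *)
have k0 : 0 < `|u| + `|v| + 1 by rewrite ltr_pwDr// addr_ge0.
exists (r / (`|u| + `|v| + 1)); first by rewrite divr_gt0.
move=> s /andP[s0 sr].
have B a b : 0 <= a <= s -> 0 <= b <= s -> sm f (x + a *: u + b *: v) /\
   `|'D_v ('D_u f) x - 'D_v ('D_u f) (x + a *: u + b *: v)| <= e.
  move=> /andP[a0 as_] /andP[b0 bs]; apply: br; rewrite -ball_normE /=.
  rewrite -addrA opprD addNKr normrN.
  apply: le_lt_trans (ler_normD _ _) _; rewrite !normrZ !ger0_norm//.
  rewrite ltr_pdivlMr// in sr; apply: le_lt_trans sr.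
  rewrite !mulrDr mulr1 -[leLHS]addr0; apply: lerD; last exact: ltW.
  by apply: lerD; apply: ler_wpM2r.
have s00 : (0 : R) <= 0 <= s by rewrite lexx ltW.
have ss : 0 <= s <= s by rewrite lexx ltW.
pose phi a := f (x + s *: v + a *: u) - f (x + a *: u).
have dphi a : 0 <= a <= s -> is_derive a 1 phi
    ('D_u f (x + s *: v + a *: u) - 'D_u f (x + a *: u)).
  move=> a0s; apply: is_deriveB; apply: is_derive_line.
    by rewrite addrAC; apply: sm_derivable; have [] := B a s a0s ss.
  by apply: sm_derivable; have [] := B a 0 a0s s00; rewrite scale0r addr0.
have [||a] := MVT s0 (f := phi) (df := fun a => 'D_u f (x + s *: v + a *: u) - 'D_u f (x + a *: u)).
  move=> a; rewrite in_itv => /andP[a0 as_]; apply: dphi.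
  by rewrite !ltW.
  apply: derivable_within_continuous => a; rewrite in_itv => as_.
  by apply: (@ex_derive _ _ _ _ _ _ _ (dphi a as_)).
rewrite in_itv => /andP[/ltW a0 /ltW as_]; rewrite subr0 => E.
have a0s : 0 <= a <= s by rewrite a0.
pose psi b := 'D_u f (x + a *: u + b *: v).
have dpsi b : 0 <= b <= s -> is_derive b 1 psi ('D_v ('D_u f) (x + a *: u + b *: v)).
  move=> b0s; apply: is_derive_line; apply: sm_derivable; apply: sm_derive.
  by have [] := B a b a0s b0s.
have [||b] := MVT s0 (f := psi) (df := fun b => 'D_v ('D_u f) (x + a *: u + b *: v)).
  move=> b; rewrite in_itv => /andP[b0 bs]; apply: dpsi.
  by rewrite !ltW.
  apply: derivable_within_continuous => b; rewrite in_itv => bs.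
  by apply: (@ex_derive _ _ _ _ _ _ _ (dpsi b bs)).
rewrite in_itv => /andP[/ltW b0 /ltW bs]; rewrite subr0 => E2.
have -> : second_difference f x u v s = s ^+ 2 * 'D_v ('D_u f) (x + a *: u + b *: v).
  rewrite /second_difference [x + s *: u + _]addrAC.
  rewrite (_ : _ - _ = phi s - phi 0); last first.
    by rewrite /phi scale0r !addr0 !opprB !addrA; lra.
  have E3 : 'D_u f (x + s *: v + a *: u) - 'D_u f (x + a *: u) =
      'D_v ('D_u f) (x + a *: u + b *: v) * s.
    by rewrite -E2 /psi scale0r addr0 addrAC.
  by rewrite E E3 expr2; ring.
rewrite mulKf ?expf_neq0 ?gt_eqF//.
by have [] := B a b a0s; rewrite ?b0.
Qed.

(** The second difference is symmetric in [u] and [v], and divided by [s ^+ 2] it approximates both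
    mixed derivatives. *)
Lemma derive_comm V (f : V -> R) x u v : sm f x ->
  'D_v ('D_u f) x = 'D_u ('D_v f) x.
Proof.
move=> sf; apply/eqP; rewrite -subr_eq0 -normr_le0; apply/ler_addgt0Pl => e e0.
rewrite addr0.
have e20 : 0 < e / 2 by rewrite divr_gt0.
have [r r0 Hr] := second_difference_limit u v sf e20.
have [r' r'0 Hr'] := second_difference_limit v u sf e20.
pose s := Num.min r r' / 2.
have m0 : 0 < Num.min r r' by rewrite lt_min r0.
have sm_ : s < Num.min r r' by rewrite /s ltr_pdivrMr// ltr_pMr// ltr1n.
have s0 : 0 < s by rewrite divr_gt0.
have := Hr s; rewrite s0 (lt_le_trans sm_)/= ?ge_min ?lexx// => /(_ isT) A.
have := Hr' s; rewrite s0 (lt_le_trans sm_)/= ?ge_min ?lexx ?orbT// => /(_ isT) A'.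
have E : second_difference f x u v s = second_difference f x v u s.
  by rewrite /second_difference [x + s *: u + _]addrAC; lra.
rewrite (splitr e); apply: le_trans (lerD A A').
rewrite E [X in _ <= _ + X]distrC.
by apply: le_trans (ler_normD _ _); rewrite addrA subrK.
Qed.

End Calculus2.

(** * Smooth cut-off functions *)

Section Bump.
Context {R : realType}.

(** The classical function exp(-1/x) extended by zero, with a polynomial factor in 1/x so that the
    family is closed under differentiation. *)
Definition flat (p : {poly R}) (x : R) : R :=
  if 0 < x then p.[x^-1] * expR (- x^-1) else 0.

(** With y = 1/x, so that dy/dx = - y^2, the derivative of p(y) exp(-y) is y^2 (p(y) - p'(y))
    exp(-y). *)
Definition flat_deriv (p : {poly R}) : {poly R} := 'X^2 * (p - p^`()).

(** The term of degree [i + 2] in the exponential series bounds y^(i+2) by (i+2)! exp(y). With y =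
    1/x, each monomial y^i exp(-y) is therefore at most (i+2)! x^2. A quadratic bound is what
    differentiability at 0 calls for. *)
Lemma flat_bound (p : {poly R}) : exists2 C, 0 <= C & forall x, 0 < x <= 1 ->
  `|flat p x| <= C * x ^+ 2.
Proof.
exists (\sum_(i < size p) `|p`_i| * (i.+2)`!%:R).
  by apply: sumr_ge0 => i _; rewrite mulr_ge0.
move=> x /andP[x0 x1]; rewrite /flat x0 horner_coef mulr_suml mulr_suml.
apply: le_trans (ler_norm_sum _ _ _) _; apply: ler_sum => i _.
rewrite !normrM -!mulrA ler_wpM2l// expRN.
have y0 : 0 <= x^-1 by rewrite invr_ge0 ltW.
rewrite [X in X * _]ger0_norm ?exprn_ge0// [X in _ * X]ger0_norm ?invr_ge0 ?expR_ge0//.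
rewrite ler_pdivrMr ?expR_gt0//.
have := expR_ge1Dxn i.+1 y0; set e := expR _ => He.
have F0 : (0 : R) < (i.+2)`!%:R by rewrite ltr0n fact_gt0.
have {}He : x^-1 ^+ i.+2 <= (i.+2)`!%:R * e.
  rewrite mulrC -ler_pdivrMr//; apply: le_trans He; by rewrite lerDr.
rewrite mulrAC (mulrC _ (x ^+ 2)) -ler_pdivrMl ?exprn_gt0//.
by apply: le_trans He; rewrite -exprVn -exprD.
Qed.

Lemma is_derive_flat (p : {poly R}) (x : R) : is_derive x 1 (flat p) (flat (flat_deriv p) x).
Proof.
have [x0|x0|->] := ltgtP x 0.
- have n : \forall y \near x, 0 = flat p y.
    near=> y; rewrite /flat ifF//; apply/negbTE; rewrite -leNgt ltW//.
    by near: y; exact: lt_nbhsl.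
  apply: near_eq_is_derive n _.
  by rewrite /flat (lt_gtF x0); exact: is_derive_cst.
- have n : \forall y \near x, p.[y^-1] * expR (- y^-1) = flat p y.
    near=> y; rewrite /flat ifT//; near: y; exact: lt_nbhsr.
  apply: near_eq_is_derive n _.
  rewrite /flat x0.
  have xn : x != 0 by rewrite gt_eqF.
  have dV : is_derive x 1 (fun y : R => y^-1) (- x ^- 2).
    have := @is_deriveV _ id x 1 1 xn (is_derive_id _ _).
    by rewrite /GRing.scale /= mulr1.
  have dp : is_derive x 1 (fun y : R => p.[y^-1]) (p^`().[x^-1] * - x ^- 2).
    have dh : is_derive (x^-1) 1 (horner p) (p^`()).[x^-1] by exact: is_derive_poly.
    have := @is_derive1_comp _ (horner p) (fun y : R => y^-1) x _ _ dh dV.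
    exact.
  have de : is_derive x 1 (fun y : R => expR (- y^-1)) (expR (- x^-1) * x ^- 2).
    have dN : is_derive x 1 (fun y : R => - y^-1) (x ^- 2).
      by have := is_deriveN dV; rewrite opprK.
    exact: (@is_derive1_comp _ expR (fun y : R => - y^-1) x _ _ (is_derive_expR _) dN).
  have D := is_deriveM dp de.
  apply: (@is_derive_eq _ _ _ ((fun y : R => p.[y^-1]) * (fun y : R => expR (- y^-1))) _ _ _ _ D).
  rewrite /GRing.scale /= hornerM hornerXn hornerD hornerN exprVn; ring.
(* At 0 the difference quotient is zero on the left and at most [C * h] in absolute value on the
   right. *)
- have [C C0 HC] := flat_bound p.
  have f0 : flat p 0 = 0 by rewrite /flat ltxx.
  have L : h^-1 *: (flat p (h *: 1 + 0) - flat p 0) @[h --> 0^'] --> (0 : R).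
    apply/cvgrPdist_le => /= e e0; near=> h.
    rewrite f0 subr0 addr0 sub0r normrN /GRing.scale /= mulr1 normrM.
    have [h0|h0] := leP h 0.
      by rewrite /flat ltNge h0 /= normr0 mulr0 ltW.
    have h1 : 0 < h <= 1.
      rewrite h0 /=; near: h; apply: nbhs_dnbhs.
      by apply: filterS (@lt_nbhsl _ 0 1 ltr01) => y /ltW.
    apply: le_trans (ler_wpM2l _ (HC _ h1)) _ => //.
    rewrite gtr0_norm ?invr_gt0//.
    have -> : h^-1 * (C * h ^+ 2) = C * h by field; rewrite gt_eqF.
    have : h <= e / (C + 1).
      near: h; apply: nbhs_dnbhs.
      have ec : 0 < e / (C + 1) by rewrite divr_gt0// ltr_wpDl.
      by apply: filterS (@lt_nbhsl _ 0 _ ec) => y /ltW.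
    rewrite ler_pdivlMr ?ltr_wpDl// mulrDr mulr1 mulrC.
    by apply: le_trans; rewrite lerDl ltW.
  have -> : flat (flat_deriv p) 0 = 0 by rewrite /flat ltxx.
  apply: DeriveDef; first by apply/cvg_ex; exists 0.
  exact/cvg_lim.
Unshelve. all: by end_near. Qed.

Lemma sm_flat p x : sm (flat p) x.
Proof.
exists setT; split => //; first exact: openT.
have df q y : differentiable (flat q) y.
  by apply/derivable1_diffP; exact: (@ex_derive _ _ _ _ _ _ _ (is_derive_flat q y)).
move=> k; elim: k p => [|k IH] p /=.
  by move=> y _; exact/differentiable_continuous.
split => // w; apply: Cr_eq (CrM openT (Cr_cst k w openT) (IH (flat_deriv p))).
  exact: openT.
move=> y _; rewrite deriveE// -[w in RHS]mulr1 -[w * 1]/(w *: 1) linearZ /=.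
by rewrite -deriveE// (@derive_val _ _ _ _ _ _ _ (is_derive_flat p y)).
Qed.

Definition bump : R -> R := flat 1.

Lemma sm_bump x : sm bump x. Proof. exact: sm_flat. Qed.

Lemma bump_ge0 x : 0 <= bump x.
Proof. by rewrite /bump /flat hornerC mul1r; case: ifP => // _; exact: expR_ge0. Qed.

Lemma bump_gt0 x : (0 < bump x) = (0 < x).
Proof.
rewrite /bump /flat hornerC mul1r; by case: ifP => x0; rewrite ?expR_gt0 ?ltxx.
Qed.

End Bump.

Section TimeBump.
Context {R : realType}.

Lemma near_dist_lt (t0 t r : R) : `|t - t0| < r -> \forall y \near t, `|y - t0| < r.
Proof.
move=> sr; have c1 : {for t, continuous (fun y : R => `|y - t0|)}.
  by apply: continuous_comp; [apply: cvgB; [exact: cvg_id|exact: cvg_cst]|exact: norm_continuous].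
by have := c1; move/cvgr_lt; apply.
Qed.

Lemma near_dist_gt (t0 t r : R) : r < `|t - t0| -> \forall y \near t, r < `|y - t0|.
Proof.
move=> sr; have c1 : {for t, continuous (fun y : R => `|y - t0|)}.
  by apply: continuous_comp; [apply: cvgB; [exact: cvg_id|exact: cvg_cst]|exact: norm_continuous].
by have := c1; move/cvgr_gt; apply.
Qed.

(** Positive exactly at distance less than [r] from [t0]. The square of the distance is used because
    it is smooth. *)
Definition time_bump (t0 r s : R) : R := bump (r ^+ 2 - (s - t0) ^+ 2).

Lemma time_bump_sm t0 r s : sm (time_bump t0 r) s.
Proof.
apply: (@sm_comp1 _ _ (fun s => r ^+ 2 - (s - t0) ^+ 2) bump); last exact: sm_bump.
apply: smB; first exact: sm_cst.
by rewrite /=; under eq_fun do rewrite expr2; apply: smM; apply: smB; (exact: sm_id || exact: sm_cst).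
Qed.

Lemma time_bump_ge0 t0 r s : 0 <= time_bump t0 r s.
Proof. exact: bump_ge0. Qed.

Lemma time_bump_gt0 t0 r s : 0 < r -> (0 < time_bump t0 r s) = (`|s - t0| < r).
Proof.
move=> r0; rewrite bump_gt0 subr_gt0 -(real_normK (num_real (s - t0))).
by rewrite ltr_sqr ?nnegrE// ltW.
Qed.

Lemma time_bump_out t0 r s : 0 < r -> r <= `|s - t0| -> time_bump t0 r s = 0.
Proof.
move=> r0 rs; apply/eqP; rewrite eq_le time_bump_ge0 andbT leNgt.
by rewrite time_bump_gt0// -leNgt.
Qed.

End TimeBump.

(** * Parametric integrals over an interval *)

Section TwoVariables.
Context {R : realType}.

(** A family [g e t] is read as a function of a row vector, which is the coordinate of [(e, t)] in
    the chart of [prod2 (line R) (line R)]. The derivatives in [e] and in [t] are then those along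
    [pt2 1 0] and [pt2 0 1]. *)
Definition pt2 (e t : R) : 'rV[R]_(1 + 1) := row_mx (const_mx e) (const_mx t).

Lemma pt2_lineL e t : pt2 e t = pt2 0 t + e *: pt2 1 0.
Proof.
by apply/rowP => j; rewrite !mxE; case: (fintype.split j) => k; rewrite !mxE ?mulr1 ?mulr0 ?add0r ?addr0.
Qed.

Lemma pt2_lineR e t : pt2 e t = pt2 e 0 + t *: pt2 0 1.
Proof.
by apply/rowP => j; rewrite !mxE; case: (fintype.split j) => k; rewrite !mxE ?mulr1 ?mulr0 ?add0r ?addr0.
Qed.

Lemma pt2E (y : 'rV[R]_(1 + 1)) : pt2 (lsubmx y 0 0) (rsubmx y 0 0) = y.
Proof.
rewrite -[RHS]hsubmxK; congr row_mx; apply/rowP => j; by rewrite !mxE (ord1 j).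
Qed.

Lemma lsubmx_pt2 e t : lsubmx (pt2 e t) 0 0 = e.
Proof. by rewrite row_mxKl mxE. Qed.

Lemma rsubmx_pt2 e t : rsubmx (pt2 e t) 0 0 = t.
Proof. by rewrite row_mxKr mxE. Qed.

Lemma continuous_pt2 (z : R * R) : {for z, continuous (fun z => pt2 z.1 z.2)}.
Proof.
apply: (@continuous_mx _ (R * R)%type) => i j.
have -> : (fun z : R * R => pt2 z.1 z.2 i j) =
    if fintype.split j is inl _ then fst else snd.
  by apply/funext => y; rewrite mxE; case: (fintype.split j) => k; rewrite mxE.
by case: (fintype.split j) => _; [exact: cvg_fst|exact: cvg_snd].
Qed.

Lemma near_pt2 e t (P : 'rV[R]_(1 + 1) -> Prop) : (\forall y \near pt2 e t, P y) ->
  \forall z \near (e, t), P (pt2 z.1 z.2).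
Proof. exact: (@continuous_pt2 (e, t)). Qed.

Lemma smv_pt2R e t : smv (fun s => pt2 e s) t.
Proof. by apply: smv_row_mx; apply: smv_const_mx; [exact: sm_cst|exact: sm_id]. Qed.

Lemma smv_pt2L e t : smv (fun s => pt2 s t) e.
Proof. by apply: smv_row_mx; apply: smv_const_mx; [exact: sm_id|exact: sm_cst]. Qed.

Lemma is_derive_pt2L (W : normedModType R) (F : 'rV[R]_(1 + 1) -> W) (e t : R) :
  derivable F (pt2 e t) (pt2 1 0) ->
  is_derive e 1 (fun s => F (pt2 s t)) ('D_(pt2 1 0) F (pt2 e t)).
Proof.
move=> dF; have -> : (fun s => F (pt2 s t)) = (fun s => F (pt2 0 t + s *: pt2 1 0)).
  by apply/funext => s; rewrite -pt2_lineL.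
by rewrite [pt2 e t]pt2_lineL in dF *; exact: is_derive_line.
Qed.

Lemma is_derive_pt2R (W : normedModType R) (F : 'rV[R]_(1 + 1) -> W) (e t : R) :
  derivable F (pt2 e t) (pt2 0 1) ->
  is_derive t 1 (fun s => F (pt2 e s)) ('D_(pt2 0 1) F (pt2 e t)).
Proof.
move=> dF; have -> : (fun s => F (pt2 e s)) = (fun s => F (pt2 e 0 + s *: pt2 0 1)).
  by apply/funext => s; rewrite -pt2_lineR.
by rewrite [pt2 e t]pt2_lineR in dF *; exact: is_derive_line.
Qed.

End TwoVariables.

Section Integrals.
Context {R : realType}.
Notation mu := (@lebesgue_measure R).
Implicit Types (a b : R).

Lemma continuous_itv_integrable a b (f : R -> R) :
  (forall t, a <= t <= b -> {for t, continuous f}) ->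
  mu.-integrable `[a, b] (EFin \o f).
Proof.
move=> cf; apply: continuous_compact_integrable; first exact: segment_compact.
apply: continuous_in_subspaceT => t; rewrite inE /= in_itv /=; exact: cf.
Qed.

Lemma FTC a b (f : R -> R) : a < b -> (forall t, a <= t <= b -> sm f t) ->
  \int[mu]_(t in `[a, b]) 'D_1 f t = f b - f a.
Proof.
move=> ab sf; have aa : a <= a <= b by rewrite lexx ltW.
have bb : a <= b <= b by rewrite lexx ltW.
rewrite /Rintegral (@continuous_FTC2 _ _ f)//.
- apply: continuous_in_subspaceT => t; rewrite inE /= in_itv /= => tab.
  by apply: sm_continuous; apply: sm_derive; exact: sf.
- split.
  + move=> t; rewrite in_itv /= => /andP[? ?]; apply: sm_derivable; apply: sf.
    by rewrite !ltW.
  + apply: cvg_at_right_filter; exact: (sm_continuous (sf a aa)).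
  + apply: cvg_at_left_filter; exact: (sm_continuous (sf b bb)).
- by move=> t _; rewrite derive1E.
Qed.

(** Smoothness is given only at the points with [e = 0]. Compactness of the interval yields one
    range of [e] on which [F] is smooth and its derivative bounded for all [t], as differentiation
    under the integral requires. *)
Lemma leibniz_integral a b (F : 'rV[R]_(1 + 1) -> R) :
  (forall t, a <= t <= b -> sm F (pt2 0 t)) ->
  is_derive (0 : R) (1 : R) (fun e => \int[mu]_(t in `[a, b]) F (pt2 e t))
    (\int[mu]_(t in `[a, b]) 'D_(pt2 1 0) F (pt2 0 t)).
Proof.
move=> sF.
have cD : {within `[a, b], continuous (fun t => 'D_(pt2 1 0) F (pt2 0 t))}.
  apply: continuous_in_subspaceT => t; rewrite inE /= in_itv /= => tab.
  apply: sm_continuous; apply: (@sm_comp _ _ _ (pt2 0) ('D_(pt2 1 0) F)).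
    exact: smv_pt2R.
  by apply: sm_derive; exact: sF.
have [M M0 HM] : exists2 M, 0 <= M & forall t, a <= t <= b ->
    `|'D_(pt2 1 0) F (pt2 0 t)| < M.
  have := continuous_compact cD (@segment_compact _ a b).
  move=> /compact_bounded/pinfty_ex_gt0[M M0 HM].
  exists (M + 1); first by rewrite addr_ge0 // ltW.
  move=> t tab; rewrite (le_lt_trans (HM _ _)) ?ltrDl//.
  by exists t => //=; rewrite in_itv.
(* Tube argument: the conditions are open around each point [(0, t)], and finitely many
   neighbourhoods cover the interval. *)
have : \forall e \near (0 : R), `[a, b] `<=` [set t | sm F (pt2 e t) /\
    `|'D_(pt2 1 0) F (pt2 e t)| < M].
  have /compact_near_coveringP cK := @segment_compact _ a b.
  pose P (e t : R) := sm F (pt2 e t) /\ `|'D_(pt2 1 0) F (pt2 e t)| < M.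
  suff H t : `[a, b]%classic t -> \forall t' \near t & e \near (0 : R), P e t'.
    exact: (cK R (nbhs (0 : R)) P _ H).
  rewrite /= in_itv /= => tab.
  have : \forall y \near pt2 0 t, sm F y /\ `|'D_(pt2 1 0) F y| < M.
    apply: filterI; first exact: (sm_near (sF t tab)).
    have c := sm_continuous (sm_derive (pt2 1 0) (sF t tab)).
    by have /cvgr_norm_lt := c; apply; exact: HM.
  move=> /near_pt2 [[A B] /= [nA nB] AB]; exists (B, A) => //=.
  by move=> [s e] /= [Bs Ae]; exact: (AB (e, s)).
move=> /nbhs_ballP[r /= r0 Hr].
have {}Hr e t : e \in `](- r), r[ -> a <= t <= b ->
    sm F (pt2 e t) /\ `|'D_(pt2 1 0) F (pt2 e t)| < M.
  rewrite in_itv /= => /andP[e1 e2] tab; apply: Hr; last by rewrite /= in_itv.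
  by rewrite /ball /= sub0r normrN ltr_norml e1.
have I0 : (0 : R) \in `](- r), r[ by rewrite in_itv /= oppr_lt0 r0.
have mI : measurable (`[a, b]%classic : set (measurableTypeR R)) by exact: measurable_itv.
have cint f : (forall t, a <= t <= b -> {for t, continuous f}) ->
   mu.-integrable `[a, b] (EFin \o f) by exact: continuous_itv_integrable.
have intf e : `](- r), r[%classic e -> mu.-integrable `[a, b] (EFin \o (fun t => F (pt2 e t))).
  move=> /= er; apply: cint => t tab; apply: sm_continuous.
  by apply: (@sm_comp _ _ _ (pt2 e) F); [exact: smv_pt2R|have [] := Hr e t er tab].
have der e t : `](- r), r[%classic e -> `[a, b]%classic t ->
    is_derive e 1 (fun s => F (pt2 s t)) ('D_(pt2 1 0) F (pt2 e t)).
  rewrite /= => er; rewrite in_itv /= => tab; apply: is_derive_pt2L.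
  by apply: sm_derivable; have [] := Hr e t er tab.
have derf1 e t : `](- r), r[%classic e -> `[a, b]%classic t ->
    derivable (fun s => F (pt2 s t)) e 1.
  by move=> er tab; have [] := der e t er tab.
have G_ub e t : `](- r), r[%classic e -> `[a, b]%classic t ->
    `|partial1of2 (fun e t => F (pt2 e t)) e t| <= M.
  move=> er tab; rewrite partial1of2E (@derive_val _ _ _ _ _ _ _ (der e t er tab)).
  by move: tab; rewrite /= in_itv /= => tab; have [_ /ltW] := Hr e t er tab.
have intM : mu.-integrable `[a, b] (EFin \o (fun=> M)).
  by apply: cint => t _; exact: cvg_cst.
apply: DeriveDef.
  exact: (derivable_under_integral mI I0 intf derf1 (fun=> M0) intM G_ub).
rewrite -derive1E (differentiation_under_integral mI I0 intf derf1 (fun=> M0) intM G_ub).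
apply: eq_Rintegral => t; rewrite inE => tab; rewrite partial1of2E.
by rewrite (@derive_val _ _ _ _ _ _ _ (der 0 t I0 tab)).
Qed.

(** By continuity [f] exceeds [f t0 / 2] on an interval of positive length around [t0]. *)
Lemma Rintegral_gt0 a b (f : R -> R) t0 :
  (forall t, a <= t <= b -> {for t, continuous f}) ->
  (forall t, a <= t <= b -> 0 <= f t) -> a < t0 < b -> 0 < f t0 ->
  0 < \int[mu]_(t in `[a, b]) f t.
Proof.
move=> cf f0 /andP[at0 t0b] ft0.
have [r /= r0 Hr] : \forall t \near t0, a < t < b /\ f t0 / 2 < f t.
  apply: filterI; first by near=> t; apply/andP; split; near: t; [exact: lt_nbhsr|exact: lt_nbhsl].
  have t0ab : a <= t0 <= b by rewrite !ltW.
  have := cf t0 t0ab; move/cvgr_gt; apply.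
  by rewrite ltr_pdivrMr// ltr_pMr// ltr1n.
pose J : set R := `[t0 - r / 2, t0 + r / 2]%classic.
have HJ t : J t -> a < t < b /\ f t0 / 2 < f t.
  rewrite /J /= in_itv /= => /andP[t1 t2]; apply: Hr; rewrite /= ltr_norml.
  by apply/andP; split; lra.
have Jab : J `<=` `[a, b].
  by move=> t /HJ [/andP[? ?] _]; rewrite /= in_itv /= !ltW.
have mJ : measurable (J : set (measurableTypeR R)) by exact: measurable_itv.
have mab : measurable (`[a, b]%classic : set (measurableTypeR R)) by exact: measurable_itv.
have iab := continuous_itv_integrable cf.
have iJ : mu.-integrable J (EFin \o f) by apply: integrableS iab.
apply: (@lt_le_trans _ _ (\int[mu]_(t in J) (f t0 / 2))).
  rewrite Rintegral_cst//; apply: mulr_gt0; first by rewrite divr_gt0.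
  have E := @lebesgue_measure_itv R `[t0 - r / 2, t0 + r / 2].
  have E' : fine (mu J) = r.
    rewrite /J E /= lte_fin ifT /=; last by lra.
    lra.
  have : 0 < fine (mu J) by rewrite E'.
  exact.
apply: (@le_trans _ _ (\int[mu]_(t in J) f t)).
  apply: le_Rintegral => //.
    by apply: continuous_itv_integrable => t _; exact: cvg_cst.
  by move=> t /HJ [_ /ltW].
rewrite /Rintegral fine_le//; try exact: integrable_fin_num.
apply: ge0_subset_integral => //; first by move/integrableP : iab => [].
Unshelve. all: by end_near. Qed.

(** At an endpoint the derivatives, which exist, equal one-sided limits and so depend only on values
    in the interval. This is how the velocity of a curve is compared with that of a variation
    agreeing with it on the interval alone. *)
Lemma derive_eq_itv a b (f g : R -> R) t : a < b -> a <= t <= b ->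
  derivable f t 1 -> derivable g t 1 ->
  (forall s, a <= s <= b -> f s = g s) -> 'D_1 f t = 'D_1 g t.
Proof.
move=> ab /andP[at_ tb] df dg fg.
apply/eqP; rewrite -subr_eq0 -deriveB//; apply/eqP.
have dh : derivable (f - g) t 1 by exact: derivableB.
have ht : (f - g) t = 0 by rewrite /GRing.add /= /GRing.opp /= fg ?subrr ?at_.
have h0 s : a <= s <= b -> (f - g) s = 0.
  by move=> /fg fgs; rewrite /GRing.add /= /GRing.opp /= fgs subrr.
have [tb'|bt] := ltP t b.
  rewrite /derive cvg_at_rightE//; apply/cvg_lim => //; apply: cvg_near_cst.
  near=> h; rewrite ht subr0 /= -[h *: 1]/(h * 1) mulr1 h0 ?scaler0//.
  have h_gt0 : 0 < h by near: h; exact: nbhs_right_gt.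
  have : h < b - t by near: h; apply: nbhs_right_lt; rewrite subr_gt0.
  by move=> ?; apply/andP; split; lra.
rewrite /derive cvg_at_leftE//; apply/cvg_lim => //; apply: cvg_near_cst.
have ta : a < t by exact: lt_le_trans bt.
near=> h; rewrite ht subr0 /= -[h *: 1]/(h * 1) mulr1 h0 ?scaler0//.
have h_lt0 : h < 0 by near: h; exact: nbhs_left_lt.
have : a - t < h by near: h; apply: nbhs_left_gt; rewrite subr_lt0.
by move=> ?; apply/andP; split; lra.
Unshelve. all: by end_near. Qed.

Lemma derive_mx_eq_itv a b m n (f g : R -> 'M[R]_(m, n)) t : a < b -> a <= t <= b ->
  smv f t -> smv g t ->
  (forall s, a <= s <= b -> f s = g s) -> 'D_1 f t = 'D_1 g t.
Proof.
move=> ab tab sf sg fg; apply/matrixP => i j; rewrite !derive_mxE//.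
by apply: (derive_eq_itv ab tab) => [||s /fg->//]; apply: sm_derivable.
Qed.

End Integrals.

(** * Subspaces given by matrices *)

Section LinearAlgebra.
Context {R : realType}.

Lemma pairE n (a w : 'rV[R]_n) : pair a w = (a *m w^T) 0 0.
Proof. by rewrite mxE; apply: eq_bigr => j _; rewrite mxE. Qed.

Lemma pairC n (a w : 'rV[R]_n) : pair a w = pair w a.
Proof. by apply: eq_bigr => j _; rewrite mulrC. Qed.

Lemma pairDl n (a b w : 'rV[R]_n) : pair (a + b) w = pair a w + pair b w.
Proof. by rewrite !pairE mulmxDl mxE. Qed.

Lemma pairNl n (a w : 'rV[R]_n) : pair (- a) w = - pair a w.
Proof. by rewrite !pairE mulNmx mxE. Qed.

Lemma pairBl n (a b w : 'rV[R]_n) : pair (a - b) w = pair a w - pair b w.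
Proof. by rewrite pairDl pairNl. Qed.

Lemma pairZl n c (a w : 'rV[R]_n) : pair (c *: a) w = c * pair a w.
Proof. by rewrite !pairE -scalemxAl mxE. Qed.

Lemma pair0l n (w : 'rV[R]_n) : pair 0 w = 0.
Proof. by rewrite pairE mul0mx mxE. Qed.

Lemma pair_suml n (I : Type) (s : seq I) (P : pred I) (F : I -> 'rV[R]_n) w :
  pair (\sum_(i <- s | P i) F i) w = \sum_(i <- s | P i) pair (F i) w.
Proof. by rewrite pairE mulmx_suml summxE; apply: eq_bigr => i _; rewrite pairE. Qed.

Lemma pairDr n (a b w : 'rV[R]_n) : pair w (a + b) = pair w a + pair w b.
Proof. by rewrite ![pair w _]pairC pairDl. Qed.

Lemma pairNr n (a w : 'rV[R]_n) : pair w (- a) = - pair w a.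
Proof. by rewrite ![pair w _]pairC pairNl. Qed.

Lemma pairBr n (a b w : 'rV[R]_n) : pair w (a - b) = pair w a - pair w b.
Proof. by rewrite pairDr pairNr. Qed.

Lemma pairZr n c (a w : 'rV[R]_n) : pair w (c *: a) = c * pair w a.
Proof. by rewrite ![pair w _]pairC pairZl. Qed.

Lemma pair0r n (w : 'rV[R]_n) : pair w 0 = 0.
Proof. by rewrite pairC pair0l. Qed.

Lemma pair_mulr n m (a : 'rV[R]_m) (A : 'M[R]_(n, m)) w :
  pair a (w *m A) = pair (a *m A^T) w.
Proof. by rewrite !pairE trmx_mul mulmxA. Qed.

Lemma pair_row_mx m n (a b : 'rV[R]_m) (a' b' : 'rV[R]_n) :
  pair (row_mx a a') (row_mx b b') = pair a b + pair a' b'.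
Proof. by rewrite !pairE tr_row_mx mul_row_col mxE. Qed.

Lemma pair_delta n (a : 'rV[R]_n) j : pair a (delta_mx 0 j) = a 0 j.
Proof.
rewrite /pair (bigD1 j)//= big1 ?addr0 => [|i /negbTE ij]; rewrite !mxE ?ij ?mulr0//.
by rewrite !eqxx mulr1.
Qed.

Lemma pair_eq0 n (a : 'rV[R]_n) : (forall w, pair a w = 0) -> a = 0.
Proof. by move=> H; apply/rowP => j; rewrite -pair_delta H mxE. Qed.

Lemma transpE m n (f : 'rV[R]_m -> 'rV[R]_n) a : transp f a = a *m (lin1_mx f)^T.
Proof.
by apply/rowP => j; rewrite !mxE; apply: eq_bigr => l _; rewrite !mxE.
Qed.

(** [U] and [Z] are frozen at [x] and cut out a square block [P y] of size [r], equal to the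
    identity at [x] and thus invertible nearby. The generalized inverse is [Z *m invmx (P y) *m U],
    and constancy of the rank makes it one at every nearby point. *)
Lemma smooth_ginv (V : normedModType R) m n (M : V -> 'M[R]_(m, n)) x :
  smv M x -> (\forall y \near x, \rank (M y) = \rank (M x)) ->
  exists2 W : V -> 'M[R]_(n, m), smv W x &
    \forall y \near x, M y *m W y *m M y = M y.
Proof.
move=> sM rM; set r := \rank (M x).
pose U : 'M[R]_(r, m) := pid_mx r *m invmx (col_ebase (M x)).
pose Z : 'M[R]_(n, r) := invmx (row_ebase (M x)) *m pid_mx r.
pose P y := U *m M y *m Z.
have rm : (r <= m)%N by exact: rank_leq_row.
have rn : (r <= n)%N by exact: rank_leq_col.
have Px : P x = 1%:M.
  rewrite /P -[in U *m _](mulmx_ebase (M x)) /U /Z !mulmxA.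
  rewrite mulmxKV ?col_ebase_unit// -[_ *m pid_mx _ *m row_ebase _ *m _]mulmxA.
  rewrite mulmxV ?row_ebase_unit// mulmx1.
  by rewrite pid_mx_id// pid_mx_id// pid_mx_1.
have sP : smv P x.
  by apply: smv_mul; [apply: smv_mul => //; exact: smv_cst|exact: smv_cst].
have uP : P x \in unitmx by rewrite Px unitmx1.
exists (fun y => Z *m invmx (P y) *m U).
  apply: smv_mul; last exact: smv_cst.
  by apply: smv_mul; [exact: smv_cst|exact: smv_invmx].
have nP : \forall y \near x, P y \in unitmx.
  have : \forall y \near x, \det (P y) != 0.
    have := sm_continuous (sm_det sP); move/cvgr_neq0; apply.
    by rewrite Px det1 oner_eq0.
  by apply: filterS => y; rewrite unitmxE unitfE.
near=> y.
have Py : P y \in unitmx by near: y.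
have ry : \rank (M y) = r by near: y.
have sub : (U *m M y <= M y)%MS by exact: submxMl.
have rUM : (r <= \rank (U *m M y))%N.
  have := mxrankM_maxl (U *m M y) Z; rewrite -/(P y); apply: leq_trans.
  by rewrite mxrank_unit.
(* The rows of [U *m M y] lie in the row space of [M y] and have the same rank [r], so they span
   it. *)
have /submxP[N EN] : (M y <= U *m M y)%MS.
  have le : (\rank (U *m M y) <= r)%N by have := mxrankM_maxr U (M y); rewrite ry.
  by have := mxrank_leqif_sup sub; rewrite ry => -[_ <-]; rewrite eqn_leq le rUM.
rewrite {1}EN -[N *m _ *m _]mulmxA.
have -> : U *m M y *m (Z *m invmx (P y) *m U) = U.
  by rewrite (mulmxA _ (Z *m _) U) (mulmxA _ Z) -[U *m M y *m Z]/(P y) mulmxV// mul1mx.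
by rewrite -mulmxA -EN.
Unshelve. all: by end_near. Qed.

Section Intersection.
Variables (k l d : nat) (A : 'M[R]_(k, d)) (B : 'M[R]_(l, d)).
Variable W : 'M[R]_(d, k + l).
Hypothesis MWM : col_mx A B *m W *m col_mx A B = col_mx A B.
Let M := col_mx A B.

(* [z *m (1%:M - M *m W)] runs through the left kernel of [M], that is, through
   the pairs [(a, b)] with [a *m A = - b *m B]. *)
Definition intersection_section (z : 'rV[R]_(k + l)) : 'rV[R]_d :=
  lsubmx (z *m (1%:M - M *m W)) *m A.

Lemma intersection_section_kernel (z : 'rV[R]_(k + l)) : z *m (1%:M - M *m W) *m M = 0.
Proof. by rewrite -mulmxA mulmxBl mul1mx MWM subrr mulmx0. Qed.

Lemma intersection_section_sub z :
  (intersection_section z <= A)%MS /\ (intersection_section z <= B)%MS.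
Proof.
split; first exact: submxMl.
have := intersection_section_kernel z.
rewrite -[z *m _]hsubmxK mul_row_col => /eqP; rewrite addr_eq0 => /eqP E.
by rewrite /intersection_section E -mulNmx submxMl.
Qed.

(** If [w = a *m A = b *m B], then [row_mx a (- b)] is in the left kernel of [M], on which
    [1%:M - M *m W] acts as the identity. *)
Lemma intersection_section_surj (w : 'rV[R]_d) : (w <= A)%MS -> (w <= B)%MS ->
  exists z, intersection_section z = w.
Proof.
move=> /submxP[a wa] /submxP[b wb]; exists (row_mx a (- b)).
have E : row_mx a (- b) *m M = 0 by rewrite mul_row_col mulNmx -wa -wb subrr.
by rewrite /intersection_section mulmxBr mulmx1 mulmxA E mul0mx subr0 row_mxKl.
Qed.

(* When [mu] vanishes on the intersection, [col_mx (A *m mu^T) 0] is in the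
   column space of [M], and its preimage by [M] given by [W] agrees with [mu] on
   the rows of [A] and vanishes on those of [B]. *)
Definition split_force (mu : 'rV[R]_d) : 'rV[R]_d :=
  (W *m col_mx (A *m mu^T) 0)^T.

(** The hypothesis is the equation [(1%:M - M *m W) *m r = 0] read entry by entry, that is,
    [M *m (W *m r) = r]. The two blocks of this identity give the two conclusions. *)
Lemma split_forceP (mu : 'rV[R]_d) :
  (forall j, pair mu (intersection_section (delta_mx 0 j)) = 0) ->
  (forall w, (w <= A)%MS -> pair (mu - split_force mu) w = 0) /\
  (forall w, (w <= B)%MS -> pair (split_force mu) w = 0).
Proof.
move=> Hmu; set r : 'cV[R]_(k + l) := col_mx (A *m mu^T) 0.
have E : M *m W *m r = r.
  apply/eqP; rewrite -subr_eq0 -opprB oppr_eq0 -[X in X - _]mul1mx -mulmxBl.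
  apply/eqP/colP => j.
  have := Hmu j; rewrite pairC pairE /intersection_section -!mulmxA.
  move=> H.
  have -> : ((1%:M - M *m W) *m r) j 0 = ((delta_mx 0 j : 'rV_(k + l)) *m (1%:M - M *m W) *m r) 0 0.
    by rewrite -mulmxA -rowE [RHS]mxE.
  rewrite -[_ *m (1%:M - M *m W)]hsubmxK.
  by rewrite mul_row_col mulmx0 addr0 H mxE.
move: E; rewrite -mulmxA mul_col_mx => /eq_col_mx[EA EB].
split => w /submxP[a ->].
  rewrite pairC pairE /split_force -/r raddfB /= trmxK -mulmxA mulmxBr.
  by rewrite EA subrr mulmx0 mxE.
by rewrite pairC pairE /split_force trmxK -mulmxA -/r EB mulmx0 mxE.
Qed.

End Intersection.

End LinearAlgebra.

(** * Charts *)

(** Acting on row vectors from the right, so that successive changes of charts read from left to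
    right. Vectors go from [i] to [j] by [jac M i j x], covectors by the transpose of
    [jac M j i x]. *)
HB.lock Definition jac (R : realType) (M : charted R) (i j : idx M) (x : M) :
  'M[R]_(dim M) := lin1_mx (tchange i j x).
Arguments jac {R} M i j x : rename.

Section Atlas.
Context {R : realType}.

(* The local part of [smooth_manifold], which passes to bundles and products
   without considering their topology. *)
Record atlas (M : charted R) : Prop := Atlas {
  atlas_dom : forall x : M, dom M (chart_at M x) x;
  atlasK : forall i x, dom M i x -> chart_inv M i (chart M i x) = x;
  atlas_near : forall i j x, dom M i x -> dom M j x ->
    \forall y \near chart M i x, [/\ dom M i (chart_inv M i y),
      dom M j (chart_inv M i y) & chart M i (chart_inv M i y) = y];
  atlas_smv : forall i j x, dom M i x -> dom M j x ->
    smv (chart M j \o chart_inv M i) (chart M i x)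
}.

Lemma smooth_manifold_atlas (M : charted R) : smooth_manifold M -> atlas M.
Proof.
move=> sM; split; [exact: chart_atP|exact: chartK| |] => i j x xi xj.
  have oU := @chart_open _ _ sM i j.
  have : \forall y \near chart M i x, (chart M i @` (dom M i `&` dom M j)) y.
    by apply: open_nbhs_nbhs; split => //; exists x.
  by apply: filterS => _ [z [zi zj] <-]; rewrite chartK.
apply: Coo_smv (@chart_open _ _ sM i j) _ (@transition_smooth _ _ sM i j).
by exists x.
Qed.

Lemma transp_tchange (M : charted R) (i j : idx M) (x : M) a :
  transp (tchange i j x) a = a *m (jac M i j x)^T.
Proof. by rewrite jac.unlock transpE. Qed.

Lemma tchangeE (M : charted R) (i j : idx M) (x : M) w :
  tchange i j x w = w *m jac M i j x.
Proof. by rewrite jac.unlock /tchange mul_rV_lin1. Qed.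

Section OneAtlas.
Variables (M : charted R) (aM : atlas M).
Implicit Types (i j k : idx M) (x : M).

Lemma tchange_derive i j x w : dom M i x -> dom M j x ->
  w *m jac M i j x = 'D_w (chart M j \o chart_inv M i) (chart M i x).
Proof.
move=> xi xj; rewrite -tchangeE /tchange deriveE//.
exact/smv_differentiable/atlas_smv.
Qed.

(** Chain rule: near [chart M i x] the transition from [i] to [k] factors through chart [j]. *)
Lemma jacK i j k x : dom M i x -> dom M j x -> dom M k x ->
  jac M i j x *m jac M j k x = jac M i k x.
Proof.
move=> xi xj xk; apply/row_matrixP => l; rewrite !rowE mulmxA.
move: (delta_mx 0 l) => w; rewrite [RHS](tchange_derive w xi xk).
rewrite -(_ : 'D_w ((chart M k \o chart_inv M j) \o (chart M j \o chart_inv M i))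
   (chart M i x) = 'D_w (chart M k \o chart_inv M i) (chart M i x)); last first.
  apply: near_eq_derive; apply: filterS (atlas_near aM xi xj) => y [_ yj _] /=.
  by rewrite (atlasK aM yj).
have E : (chart M j \o chart_inv M i) (chart M i x) = chart M j x.
  by rewrite /= (atlasK aM xi).
rewrite derive_comp.
- by rewrite E -(tchange_derive w xi xj) -(tchange_derive _ xj xk).
- exact/smv_differentiable/atlas_smv.
- rewrite E; exact/smv_differentiable/atlas_smv.
Qed.

Lemma jac1 i x : dom M i x -> jac M i i x = 1%:M.
Proof.
move=> xi; apply/row_matrixP => l; rewrite !rowE (tchange_derive _ xi xi) mulmx1.
rewrite -[RHS](derive_id (chart M i x)).
by apply: near_eq_derive; apply: filterS (atlas_near aM xi xi) => y [_ _ yE]; exact: yE.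
Qed.

Lemma jac_mulV i j x : dom M i x -> dom M j x -> jac M i j x *m jac M j i x = 1%:M.
Proof. by move=> xi xj; rewrite jacK// jac1. Qed.

(** The pairing is intrinsic. This identity is what removes charts from the action and from the
    equations. *)
Lemma pair_jac i j x a w : dom M i x -> dom M j x ->
  pair (a *m (jac M i j x)^T) (w *m jac M j i x) = pair a w.
Proof.
by move=> xi xj; rewrite pair_mulr -mulmxA -trmx_mul jac_mulV// trmx1 mulmx1.
Qed.

Lemma jac_smv i j x : dom M i x -> dom M j x ->
  smv (fun y => jac M i j (chart_inv M i y)) (chart M i x).
Proof.
move=> xi xj a b.
apply: (@sm_eq _ _ (fun y => ('D_(delta_mx 0 a) (chart M j \o chart_inv M i) y) 0 b)).
  apply: filterS (atlas_near aM xi xj) => y [yi yj yE].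
  have /rowP/(_ b) := tchange_derive (delta_mx 0 a) yi yj.
  by rewrite yE -rowE mxE => ->.
by apply: smv_derive; apply: atlas_smv.
Qed.

Lemma jac_smv3 i j k x : dom M i x -> dom M j x -> dom M k x ->
  smv (fun y => jac M j k (chart_inv M i y)) (chart M i x).
Proof.
move=> xi xj xk; have E : (chart M j \o chart_inv M i) (chart M i x) = chart M j x.
  by rewrite /= (atlasK aM xi).
apply: (@smv_eq _ _ _ _ ((fun y => jac M j k (chart_inv M j y)) \o (chart M j \o chart_inv M i))).
  by apply: filterS (atlas_near aM xi xj) => y [_ yj _] /=; rewrite (atlasK aM yj).
by apply: smv_comp; [exact: atlas_smv|rewrite E; exact: jac_smv].
Qed.

(** The chart [k] is fixed, unlike in [smooth_at], where it is the preferred chart at the image of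
    the point considered. This allows the notion to persist at nearby points without a change of
    chart. *)
Definition smooth_in (V : normedModType R) (f : V -> M) (k : idx M) (x : V) : Prop :=
  (\forall y \near x, dom M k (f y)) /\ smv (chart M k \o f) x.

Lemma smooth_in_dom (V : normedModType R) (f : V -> M) k (x : V) :
  smooth_in f k x -> dom M k (f x).
Proof. by move=> [/nbhs_singleton]. Qed.

Lemma smooth_in_near (V : normedModType R) (f : V -> M) k (x : V) :
  smooth_in f k x -> \forall y \near x, smooth_in f k y.
Proof.
by move=> [nf sf]; apply: filterS2 (smv_near sf) (near_join nf) => y; split.
Qed.

Lemma smooth_in_eq (V : normedModType R) (f g : V -> M) k (x : V) :
  (\forall y \near x, f y = g y) -> smooth_in f k x -> smooth_in g k x.
Proof.
move=> fg [nf sf]; split.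
  by apply: filterS2 fg nf => y ->.
by apply: smv_eq sf; apply: filterS fg => y /= ->.
Qed.

Lemma smooth_in_chart (V : normedModType R) (f : V -> M) i j (x : V) :
  smooth_in f i x -> dom M j (f x) -> smooth_in f j x.
Proof.
move=> [nf sf] xj; have xi := nbhs_singleton nf.
have cf := smv_continuous sf.
have nj : \forall y \near x, dom M j (f y).
  have /cf := atlas_near aM xi xj.
  by apply: filterS2 nf => y yi /= [_ + _]; rewrite (atlasK aM yi).
split => //; apply: (@smv_eq _ _ _ _ ((chart M j \o chart_inv M i) \o (chart M i \o f))).
  by apply: filterS nf => y yi /=; rewrite (atlasK aM yi).
by apply: smv_comp => //; exact: atlas_smv.
Qed.

Lemma smooth_in_inv (V : normedModType R) (h : V -> 'rV[R]_(dim M)) k (x : V) (p : M) :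
  dom M k p -> h x = chart M k p -> smv h x ->
  smooth_in (fun y => chart_inv M k (h y)) k x /\
  (\forall y \near x, chart M k (chart_inv M k (h y)) = h y).
Proof.
move=> pk hx sh; have := atlas_near aM pk pk; rewrite -hx => n.
have {}n : \forall y \near x, [/\ dom M k (chart_inv M k (h y)),
    dom M k (chart_inv M k (h y)) & chart M k (chart_inv M k (h y)) = h y].
  exact: smv_continuous sh _ n.
split; last by apply: filterS n => y [].
split; first by apply: filterS n => y [].
by apply: smv_eq sh; apply: filterS n => y [].
Qed.

End OneAtlas.

Lemma smooth_at_curve (M : charted R) (c : R -> M) (t : R) :
  smooth_at (M := line R) c t <-> smooth_in c (chart_at M (c t)) t.
Proof.
have cC : {for t, continuous (fun s : R => const_mx s : 'rV[R]_1)}.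
  by apply: smv_continuous; apply: smv_const_mx; exact: sm_id.
have cR : {for (const_mx t : 'rV[R]_1), continuous (fun y : 'rV[R]_1 => y 0 0)}.
  exact: coord_continuous.
split => -[H1 H2]; split.
- have {}H1 : \forall s \near t, dom M (chart_at M (c t)) (c ((const_mx s : 'rV[R]_1) 0 0)).
    exact: cC _ H1.
  by apply: filterS H1 => s; rewrite mxE.
- have /Coo_atP H3 := H2.
  have E : (chart M (chart_at M (c t)) \o c \o chart_inv (line R) (chart_at (line R) t)) \o
      (fun s : R => const_mx s : 'rV[R]_1) = chart M (chart_at M (c t)) \o c.
    by apply/funext => s /=; rewrite mxE.
  by rewrite -E; apply: smv_comp => //; apply: smv_const_mx; exact: sm_id.
- have H3 : \forall y \near t, dom M (chart_at M (c t)) (c y) by [].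
  have := cR (fun r => dom M (chart_at M (c t)) (c r)); rewrite /= mxE.
  by move/(_ H3).
- apply/Coo_atP => i j.
  apply: (@sm_comp1 _ _ (fun y : 'rV[R]_1 => y 0 0) (fun s => chart M (chart_at M (c t)) (c s) i j)).
    exact: sm_coord.
  by rewrite mxE; exact: H2.
Qed.

(** Matches [chart_inv] of [prod2 (line R) (line R)], so that [smooth_at_family] holds by
    unfolding. *)
Definition uncurry2 T (g : R -> R -> T) (y : 'rV[R]_(1 + 1)) : T :=
  g (lsubmx y 0 0) (rsubmx y 0 0).

Lemma uncurry2E T (g : R -> R -> T) e t : uncurry2 g (pt2 e t) = g e t.
Proof. by rewrite /uncurry2 lsubmx_pt2 rsubmx_pt2. Qed.

Lemma smooth_at_family (M : charted R) (g : R -> R -> M) (e t : R) :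
  smooth_at (M := prod2 (line R) (line R)) (fun y => g y.1 y.2) (e, t) <->
  smooth_in (uncurry2 g) (chart_at M (g e t)) (pt2 e t).
Proof. by split => -[H1 H2]; split => //; apply/Coo_atP. Qed.

End Atlas.

(** * Atlases of the tangent and Pontryagin bundles *)

Section Bundles.
Context {R : realType}.
Variables (M : charted R) (aM : atlas M).

Lemma tangent_chartE i (z : tangent M) :
  chart (tangent M) i z = row_mx (chart M i z.1) (z.2 *m jac M (chart_at M z.1) i z.1).
Proof. by rewrite /= tchangeE. Qed.

Lemma tangent_invE i y : chart_inv (tangent M) i y =
  (chart_inv M i (lsubmx y), rsubmx y *m
    jac M i (chart_at M (chart_inv M i (lsubmx y))) (chart_inv M i (lsubmx y))).
Proof. by rewrite /= tchangeE. Qed.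

Lemma pontryagin_chartE i (z : pontryagin M) :
  chart (pontryagin M) i z =
  row_mx (row_mx (chart M i z.1.1) (z.1.2 *m jac M (chart_at M z.1.1) i z.1.1))
         (z.2 *m (jac M i (chart_at M z.1.1) z.1.1)^T).
Proof. by rewrite /= tchangeE transp_tchange. Qed.

Lemma pontryagin_invE i y : chart_inv (pontryagin M) i y =
  (chart_inv M i (lsubmx (lsubmx y)),
   rsubmx (lsubmx y) *m jac M i (chart_at M (chart_inv M i (lsubmx (lsubmx y))))
     (chart_inv M i (lsubmx (lsubmx y))),
   rsubmx y *m (jac M (chart_at M (chart_inv M i (lsubmx (lsubmx y)))) i
     (chart_inv M i (lsubmx (lsubmx y))))^T).
Proof. by rewrite /= tchangeE transp_tchange. Qed.

Lemma lsubmx_smv m n p (y : 'M[R]_(m, n + p)) : smv (@lsubmx R m n p) y.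
Proof. exact: smv_lsubmx (smv_id _). Qed.

Lemma rsubmx_smv m n p (y : 'M[R]_(m, n + p)) : smv (@rsubmx R m n p) y.
Proof. exact: smv_rsubmx (smv_id _). Qed.

Lemma atlas_near_comp (V : normedModType R) i j x (h : V -> 'rV[R]_(dim M)) y0 :
  dom M i x -> dom M j x -> smv h y0 -> h y0 = chart M i x ->
  \forall y \near y0, [/\ dom M i (chart_inv M i (h y)),
      dom M j (chart_inv M i (h y)) & chart M i (chart_inv M i (h y)) = h y].
Proof.
move=> xi xj sh hy; have := atlas_near aM xi xj; rewrite -hy.
exact: smv_continuous sh _.
Qed.

(** Fibre components refer to the preferred chart of the moving base point, but in a transition map
    this chart cancels by [jacK], leaving the smooth factor [jac M i j]. The same cancellation works
    for [atlas_pontryagin]. *)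
Lemma atlas_tangent : atlas (tangent M).
Proof.
split.
- by move=> z; exact: (atlas_dom aM).
- move=> i [x v] xi; rewrite tangent_chartE tangent_invE /= row_mxKl row_mxKr (atlasK aM xi).
  by rewrite -mulmxA (jac_mulV aM) ?mulmx1//; exact: (atlas_dom aM).
- move=> i j [x v] xi xj; rewrite tangent_chartE /=.
  set y0 := row_mx _ _.
  have /= := @atlas_near_comp _ i j x _ y0 xi xj (lsubmx_smv _).
  rewrite row_mxKl => /(_ erefl); apply: filterS => y [yi yj yE].
  split => //; rewrite !tchangeE yE.
  rewrite -mulmxA (jac_mulV aM) ?mulmx1 ?hsubmxK//; exact: (atlas_dom aM).
- move=> i j [x v] xi xj; rewrite tangent_chartE /=.
  set y0 := row_mx _ _.
  apply: (@smv_eq _ _ _ _ (fun y => row_mx ((chart M j \o chart_inv M i) (lsubmx y))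
      (rsubmx y *m jac M i j (chart_inv M i (lsubmx y))))).
    have /= := @atlas_near_comp _ i j x _ y0 xi xj (lsubmx_smv _).
    rewrite row_mxKl => /(_ erefl); apply: filterS => y [yi yj yE].
    rewrite /= !tchangeE.
    by rewrite -mulmxA (jacK aM)//; exact: (atlas_dom aM).
  apply: smv_row_mx.
    apply: (@smv_comp _ _ _ _ _ _ (chart M j \o chart_inv M i)); first exact: lsubmx_smv.
    by rewrite row_mxKl; exact: atlas_smv.
  apply: smv_mul; first exact: rsubmx_smv.
  apply: (@smv_comp _ _ _ _ _ _ (fun y => jac M i j (chart_inv M i y))).
    exact: lsubmx_smv.
  by rewrite row_mxKl; exact: jac_smv.
Qed.

Let lls := fun y : 'rV[R]_(dim M + dim M + dim M) => lsubmx (lsubmx y).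

Lemma lls_smv y : smv lls y.
Proof. exact/smv_lsubmx/lsubmx_smv. Qed.

Lemma atlas_pontryagin : atlas (pontryagin M).
Proof.
have D x := atlas_dom aM x.
split.
- by move=> z; exact: (atlas_dom aM).
- move=> i [[x v] p] xi; rewrite pontryagin_chartE pontryagin_invE /= !row_mxKl !row_mxKr.
  rewrite (atlasK aM xi) -!mulmxA -trmx_mul !(jac_mulV aM) ?trmx1 ?mulmx1//.
- move=> i j [[x v] p] xi xj; rewrite pontryagin_chartE /=.
  set y0 := row_mx _ _.
  have /= := @atlas_near_comp _ i j x _ y0 xi xj (lls_smv _).
  rewrite /lls !row_mxKl => /(_ erefl); apply: filterS => y [yi yj yE].
  split => //; rewrite !tchangeE !transp_tchange yE.
  by rewrite -!mulmxA -trmx_mul !(jac_mulV aM) ?trmx1 ?mulmx1 ?hsubmxK.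
- move=> i j [[x v] p] xi xj; rewrite pontryagin_chartE /=.
  set y0 := row_mx _ _.
  have y0E : lls y0 = chart M i x by rewrite /lls !row_mxKl.
  apply: (@smv_eq _ _ _ _ (fun y => row_mx
      (row_mx ((chart M j \o chart_inv M i) (lls y))
         (rsubmx (lsubmx y) *m jac M i j (chart_inv M i (lls y))))
      (rsubmx y *m (jac M j i (chart_inv M i (lls y)))^T))).
    have := @atlas_near_comp _ i j x _ y0 xi xj (lls_smv _) y0E.
    apply: filterS => y [yi yj yE].
    rewrite /= !tchangeE !transp_tchange -/(lls y).
    by rewrite -!mulmxA -trmx_mul !(jacK aM).
  apply: smv_row_mx; first apply: smv_row_mx.
  + apply: (@smv_comp _ _ _ _ _ _ (chart M j \o chart_inv M i)); first exact: lls_smv.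
    by rewrite y0E; exact: atlas_smv.
  + apply: smv_mul; first by apply: smv_rsubmx; exact: lsubmx_smv.
    apply: (@smv_comp _ _ _ _ _ _ (fun y => jac M i j (chart_inv M i y))).
      exact: lls_smv.
    by rewrite y0E; exact: jac_smv.
  + apply: smv_mul; first exact: rsubmx_smv.
    apply: smv_tr; apply: (@smv_comp _ _ _ _ _ _ (fun y => jac M j i (chart_inv M i y))).
      exact: lls_smv.
    by rewrite y0E; exact: jac_smv3.
Qed.

End Bundles.

(** * Finite products of manifolds *)

Section Products.
Context {R : realType} (n : nat) (M : 'I_n -> charted R).
Hypothesis aM : forall i, atlas (M i).

Lemma prodn_near i j (x : prodn M) : dom (prodn M) i x -> dom (prodn M) j x ->
  \forall y \near chart (prodn M) i x, forall l,
    [/\ dom (M l) (i l) (chart_inv (M l) (i l) (submxrow y l)),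
        dom (M l) (j l) (chart_inv (M l) (i l) (submxrow y l))
      & chart (M l) (i l) (chart_inv (M l) (i l) (submxrow y l)) = submxrow y l].
Proof.
move=> xi xj.
suff H : forall l, \forall y \near chart (prodn M) i x,
    [/\ dom (M l) (i l) (chart_inv (M l) (i l) (submxrow y l)),
        dom (M l) (j l) (chart_inv (M l) (i l) (submxrow y l))
      & chart (M l) (i l) (chart_inv (M l) (i l) (submxrow y l)) = submxrow y l].
  exact: filter_forall H.
move=> l.
apply: (atlas_near_comp (aM l) (xi l) (xj l) (h := fun y => submxrow y l)).
  exact: smv_submxrow (smv_id _).
by rewrite /= mxrowK.
Qed.

Lemma atlas_prodn : atlas (prodn M).
Proof.
split.
- by move=> x l; exact: (atlas_dom (aM l)).
- move=> i x xi; apply: functional_extensionality_dep => l /=.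
  by rewrite mxrowK; exact: (atlasK (aM l)).
- move=> i j x xi xj; apply: filterS (prodn_near xi xj) => y Hy.
  split; [by move=> l; case: (Hy l)|by move=> l; case: (Hy l)|].
  by rewrite /= -[RHS]submxrowK; apply: eq_mxrow => l; case: (Hy l).
- move=> i j x xi xj; apply: smv_mxrow => l.
  apply: (@smv_comp _ _ _ _ _ _ (chart (M l) (j l) \o chart_inv (M l) (i l))).
    exact: smv_submxrow (smv_id _).
  by rewrite /= mxrowK; exact: (atlas_smv (aM l) (xi l) (xj l)).
Qed.

Lemma submxrow_smv m (p_ : 'I_n -> nat) (y : 'M[R]_(m, \sum_i p_ i)) j :
  smv (fun y => submxrow y j) y.
Proof. exact: smv_submxrow (smv_id _). Qed.

Lemma derive_submxrow (V : normedModType R) m (p_ : 'I_n -> nat)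
    (f : V -> 'M[R]_(m, \sum_i p_ i)) x w l : smv f x ->
  submxrow ('D_w f x) l = 'D_w (fun y => submxrow (f y) l) x.
Proof.
move=> sf; apply/matrixP => a b; rewrite [RHS]derive_mxE; last exact: smv_submxrow.
by rewrite mxE derive_mxE//; congr ('D_w _ x); apply/funext => y; rewrite mxE.
Qed.

(** Each block of a transition map of the product depends only on the same block of the coordinates,
    so the Jacobian is block diagonal. *)
Lemma submxrow_jac i j (x : prodn M) (w : 'rV[R]_(dim (prodn M))) l :
  dom (prodn M) i x -> dom (prodn M) j x ->
  submxrow (w *m jac (prodn M) i j x) l = submxrow w l *m jac (M l) (i l) (j l) (x l).
Proof.
move=> xi xj; rewrite (tchange_derive atlas_prodn w xi xj).
rewrite (tchange_derive (aM l) _ (xi l) (xj l)).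
rewrite derive_submxrow; last first.
  exact (atlas_smv atlas_prodn xi xj).
have -> : (fun y => submxrow ((chart (prodn M) j \o chart_inv (prodn M) i) y) l) =
    (chart (M l) (j l) \o chart_inv (M l) (i l)) \o (fun y => submxrow y l).
  by apply/funext => y /=; rewrite mxrowK.
have E : submxrow (chart (prodn M) i x) l = chart (M l) (i l) (x l) by rewrite /= mxrowK.
rewrite derive_comp.
- rewrite E -derive_submxrow; last exact: smv_id.
  by rewrite derive_id.
- exact/smv_differentiable/submxrow_smv.
- rewrite E; exact/smv_differentiable/(atlas_smv (aM l) (xi l) (xj l)).
Qed.

Lemma jac_mxdiag i j (x : prodn M) :
  dom (prodn M) i x -> dom (prodn M) j x ->
  jac (prodn M) i j x = \mxdiag_l jac (M l) (i l) (j l) (x l).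
Proof.
move=> xi xj; apply/row_matrixP => k; rewrite !rowE.
rewrite -[LHS]submxrowK -[delta_mx 0 k in RHS]submxrowK mul_mxrow_mxdiag.
by apply: eq_mxrow => l; rewrite submxrow_jac.
Qed.

Lemma submxrow_jacT i j (x : prodn M) (w : 'rV[R]_(dim (prodn M))) l :
  dom (prodn M) i x -> dom (prodn M) j x ->
  submxrow (w *m (jac (prodn M) i j x)^T) l = submxrow w l *m (jac (M l) (i l) (j l) (x l))^T.
Proof.
move=> xi xj; rewrite jac_mxdiag// tr_mxdiag -{1}[w]submxrowK mul_mxrow_mxdiag.
by rewrite mxrowK.
Qed.

Lemma pair_submxrow (p_ : 'I_n -> nat) (a w : 'rV[R]_(\sum_i p_ i)) :
  pair a w = \sum_i pair (submxrow a i) (submxrow w i).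
Proof.
rewrite pairE -{1}[a]submxrowK -{1}[w]submxrowK tr_mxrow mul_mxrow_mxcol summxE.
by apply: eq_bigr => i _; rewrite pairE.
Qed.

End Products.

(** * First variation of the action *)

Opaque derive.

Section MatrixDerivatives.
Context {R : realType} (V : normedModType R).

Lemma derive_lsubmx m n p (f : V -> 'M[R]_(m, n + p)) x w : smv f x ->
  'D_w (fun y => lsubmx (f y)) x = lsubmx ('D_w f x).
Proof.
move=> sf; apply/matrixP => a b; rewrite derive_mxE; last exact: smv_lsubmx.
by rewrite [RHS]mxE derive_mxE//; congr ('D_w _ x); apply/funext => y; rewrite mxE.
Qed.

Lemma derive_rsubmx m n p (f : V -> 'M[R]_(m, n + p)) x w : smv f x ->
  'D_w (fun y => rsubmx (f y)) x = rsubmx ('D_w f x).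
Proof.
move=> sf; apply/matrixP => a b; rewrite derive_mxE; last exact: smv_rsubmx.
by rewrite [RHS]mxE derive_mxE//; congr ('D_w _ x); apply/funext => y; rewrite mxE.
Qed.

Lemma derive_pair n (f g : V -> 'rV[R]_n) x w : smv f x -> smv g x ->
  'D_w (fun y => pair (f y) (g y)) x = pair ('D_w f x) (g x) + pair (f x) ('D_w g x).
Proof.
move=> sf sg.
have -> : (fun y => pair (f y) (g y)) = \sum_(j < n) ((fun y => f y 0 j) * (fun y => g y 0 j)).
  by apply/funext => y; rewrite fct_sumE.
rewrite derive_sum; last first.
  by move=> j; apply: derivableM; apply: sm_derivable.
rewrite /pair -big_split; apply: eq_bigr => j _ /=.
rewrite deriveM; [|exact: sm_derivable|exact: sm_derivable].
rewrite (derive_mxE w 0 j sf) (derive_mxE w 0 j sg) addrC.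
by congr (_ + _); exact: mulrC.
Qed.

Lemma derive_mx_comm m n (f : V -> 'M[R]_(m, n)) x u v : smv f x ->
  'D_v ('D_u f) x = 'D_u ('D_v f) x.
Proof.
move=> sf.
have E a b u' v' : 'D_v' ('D_u' f) x a b = 'D_v' ('D_u' (fun y => f y a b)) x.
  rewrite (derive_mxE v' a b (smv_derive u' sf)).
  apply: near_eq_derive; apply: filterS (smv_near sf) => y sfy.
  exact: derive_mxE sfy.
apply/matrixP => a b.
exact: etrans (E a b u v) (etrans (derive_comm u v (sf a b)) (esym (E a b v u))).
Qed.

Lemma first_variation_algebra d (a b c e f h i j k l : 'rV[R]_d) :
  pair a c + pair b e + (pair f (h - i) + pair j (l - e)) -
  (pair k c + pair j l) = pair (a - k) c + pair (b - j) e + pair f (h - i).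
Proof. rewrite !pairBl !pairBr; ring. Qed.

(** Integration by parts before integrating. [G] holds the components (q, v, p) of a family, [u] is
    the direction of variation and [v] that of time. Subtracting the time derivative of <p, dq>
    cancels the mixed second derivatives, which are equal by [derive_mx_comm]. *)
Lemma pontryagin_first_variation d (G : V -> 'rV[R]_(d + d + d))
    (l : 'rV[R]_(d + d) -> R) dl y u v :
  smv G y -> sm l (lsubmx (G y)) -> (forall w, 'D_w l (lsubmx (G y)) = pair dl w) ->
  'D_u (fun x => l (lsubmx (G x)) +
    pair (rsubmx (G x)) (lsubmx (lsubmx ('D_v G x)) - rsubmx (lsubmx (G x)))) y -
  'D_v (fun x => pair (rsubmx (G x)) (lsubmx (lsubmx ('D_u G x)))) y =
  pair (lsubmx dl - rsubmx ('D_v G y)) (lsubmx (lsubmx ('D_u G y))) +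
  pair (rsubmx dl - rsubmx (G y)) (rsubmx (lsubmx ('D_u G y))) +
  pair (rsubmx ('D_u G y)) (lsubmx (lsubmx ('D_v G y)) - rsubmx (lsubmx (G y))).
Proof.
move=> sG sl dlE.
have sGl : smv (fun x => lsubmx (G x)) y by exact: smv_lsubmx.
have sGr : smv (fun x => rsubmx (G x)) y by exact: smv_rsubmx.
have sGlr : smv (fun x => rsubmx (lsubmx (G x))) y by exact: smv_rsubmx.
have sD w : smv ('D_w G) y by exact: smv_derive.
have sDl w : smv (fun x => lsubmx ('D_w G x)) y by exact: smv_lsubmx.
have sDll w : smv (fun x => lsubmx (lsubmx ('D_w G x))) y by exact: smv_lsubmx.
have sV : smv (fun x => lsubmx (lsubmx ('D_v G x)) - rsubmx (lsubmx (G x))) y.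
  exact: smvB.
have E1 : 'D_u (fun x => l (lsubmx (G x))) y = pair dl (lsubmx ('D_u G y)).
  rewrite -dlE -(derive_lsubmx u sG).
  apply: (@derive_comp _ _ _ _ (fun x => lsubmx (G x)) l).
    exact: smv_differentiable.
  exact: sm_differentiable.
have E2 w w' : 'D_w (fun x => lsubmx (lsubmx ('D_w' G x))) y =
    lsubmx (lsubmx ('D_w ('D_w' G) y)).
  by rewrite (derive_lsubmx w (sDl w')) (derive_lsubmx w (sD w')).
have E3 : 'D_u (fun x => lsubmx (lsubmx ('D_v G x)) - rsubmx (lsubmx (G x))) y =
    lsubmx (lsubmx ('D_u ('D_v G) y)) - rsubmx (lsubmx ('D_u G y)).
  rewrite -E2 -(derive_lsubmx u sG) -(derive_rsubmx u sGl).
  by apply: (@deriveB _ _ _ (fun x => lsubmx (lsubmx ('D_v G x))) (fun x => rsubmx (lsubmx (G x))));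
    exact: smv_derivable.
have E4 := derive_pair u sGr sV.
have E5 := derive_pair v sGr (sDll u).
rewrite E3 (derive_rsubmx u sG) in E4; rewrite E2 (derive_rsubmx v sG) in E5.
have E6 : 'D_u (fun x => l (lsubmx (G x)) +
    pair (rsubmx (G x)) (lsubmx (lsubmx ('D_v G x)) - rsubmx (lsubmx (G x)))) y =
  'D_u (fun x => l (lsubmx (G x))) y + 'D_u (fun x =>
    pair (rsubmx (G x)) (lsubmx (lsubmx ('D_v G x)) - rsubmx (lsubmx (G x)))) y.
  apply: (@deriveD _ _ _ (fun x => l (lsubmx (G x))) (fun x =>
    pair (rsubmx (G x)) (lsubmx (lsubmx ('D_v G x)) - rsubmx (lsubmx (G x))))).
    by apply: sm_derivable; exact: (@sm_comp _ _ _ (fun x => lsubmx (G x)) l).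
  by apply: sm_derivable; exact: sm_pair.
rewrite E6 E1 E4 E5 (derive_mx_comm u v sG).
rewrite -[X in pair X (lsubmx ('D_u G y))]hsubmxK -[X in pair (row_mx _ _) X]hsubmxK pair_row_mx.
exact: first_variation_algebra.
Qed.

End MatrixDerivatives.

(** * The action of a family of curves, read in a chart *)

Section Lagrangian.
Context {R : realType} (Q : charted R).
Hypothesis aQ : atlas Q.
Variables (L : tangent Q -> R).
Hypothesis sL : smooth_lagrangian L.
Notation d := (dim Q).
Notation PQ := (pontryagin Q).
Implicit Types (k : idx Q) (z : R -> PQ) (g : R -> R -> PQ).

Definition local_lagrangian k : 'rV[R]_(d + d) -> R := L \o chart_inv (tangent Q) k.

Definition gradient k (y : 'rV[R]_(d + d)) : 'rV[R]_(d + d) :=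
  \row_j 'D_(delta_mx 0 j) (local_lagrangian k) y.

Lemma local_lagrangian_sm k (z : tangent Q) : dom Q k z.1 ->
  sm (local_lagrangian k) (chart (tangent Q) k z).
Proof.
move=> zk; have aT := atlas_tangent aQ.
pose p := chart_at (tangent Q) z.
have zp : dom (tangent Q) p z by exact: (atlas_dom aT).
have sp : sm (local_lagrangian p) (chart (tangent Q) p z).
  have [_ /Coo_atP/(_ 0 0)] := sL z; rewrite /= /pcoord.
  by congr sm; apply/funext => y /=; rewrite mxE.
apply: (@sm_eq _ _ (local_lagrangian p \o (chart (tangent Q) p \o chart_inv (tangent Q) k))).
  apply: filterS (atlas_near aT (i := k) (j := p) (x := z) zk zp) => y [_ yp _].
  by rewrite /local_lagrangian /comp (atlasK aT yp).
apply: sm_comp; first exact: (atlas_smv aT (i := k) (j := p) (x := z) zk zp).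
by rewrite /comp (atlasK aT (i := k) (x := z) zk).
Qed.

Lemma derive_local_lagrangian k (z : tangent Q) u : dom Q k z.1 ->
  'D_u (local_lagrangian k) (chart (tangent Q) k z) =
  pair (gradient k (chart (tangent Q) k z)) u.
Proof.
move=> zk; rewrite derive_sum_delta; last exact/sm_differentiable/local_lagrangian_sm.
by rewrite /pair; apply: eq_bigr => j _; rewrite mxE mulrC.
Qed.

Lemma lsubmx_chart k (z : PQ) :
  lsubmx (chart PQ k z) = chart (tangent Q) k (tpart z).
Proof. by rewrite row_mxKl. Qed.

Lemma lsubmx2_chart k (z : PQ) : lsubmx (lsubmx (chart PQ k z)) = chart Q k (base z).
Proof. by rewrite !row_mxKl. Qed.

Lemma vel_chart k (z : PQ) : rsubmx (lsubmx (chart PQ k z)) =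
  z.1.2 *m jac Q (chart_at Q (base z)) k (base z).
Proof. by rewrite pontryagin_chartE row_mxKl row_mxKr. Qed.

Lemma mom_chart k (z : PQ) : rsubmx (chart PQ k z) =
  z.2 *m (jac Q k (chart_at Q (base z)) (base z))^T.
Proof. by rewrite pontryagin_chartE row_mxKr. Qed.

Lemma smooth_in_base (V : normedModType R) (z : V -> PQ) k x :
  smooth_in z k x -> smooth_in (base \o z) k x.
Proof.
move=> [nz sz]; split => //.
apply: (@smv_eq _ _ _ _ (fun y => lsubmx (lsubmx (chart PQ k (z y))))).
  by apply: nearW => y; rewrite lsubmx2_chart.
by apply/smv_lsubmx/smv_lsubmx.
Qed.

Lemma velocity_chart (c : R -> Q) k t : smooth_in c k t ->
  velocity c t *m jac Q (chart_at Q (c t)) k (c t) = 'D_1 (chart Q k \o c) t.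
Proof.
move=> ck; have ctk := smooth_in_dom ck.
have ctp := atlas_dom aQ (c t).
have cp := smooth_in_chart aQ ck ctp.
rewrite (tchange_derive aQ _ ctp ctk).
set p := chart_at Q (c t).
rewrite (_ : 'D_1 (chart Q k \o c) t =
  'D_1 ((chart Q k \o chart_inv Q p) \o (chart Q p \o c)) t); last first.
  apply: near_eq_derive; have [np _] := cp; apply: filterS np => s cs /=.
  by rewrite (atlasK aQ cs).
rewrite derive_comp//; first by apply: smv_differentiable; case: cp.
exact/smv_differentiable/(atlas_smv aQ ctp ctk).
Qed.

Definition integrand z t : R :=
  L (tpart (z t)) + pair (z t).2 (velocity (base \o z) t - (z t).1.2).

(** The integrand is defined with the preferred chart at each time, which may jump. In a fixed chart
    it becomes a smooth expression in the components of the curve, thanks to [pair_jac]. *)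
Lemma integrandE k z t : smooth_in z k t ->
  integrand z t = local_lagrangian k (lsubmx (chart PQ k (z t))) +
   pair (rsubmx (chart PQ k (z t)))
    (lsubmx (lsubmx ('D_1 (chart PQ k \o z) t)) - rsubmx (lsubmx (chart PQ k (z t)))).
Proof.
move=> zk; have zt : dom Q k (base (z t)) := smooth_in_dom zk.
have zp := atlas_dom aQ (base (z t)).
rewrite /integrand vel_chart mom_chart lsubmx_chart /local_lagrangian.
have -> : (L \o chart_inv (tangent Q) k) (chart (tangent Q) k (tpart (z t))) = L (tpart (z t)).
  by rewrite /comp (atlasK (atlas_tangent aQ)).
congr (_ + _).
have [_ sz] := zk.
rewrite -derive_lsubmx ?smv_lsubmx// -?derive_lsubmx//; last exact: smv_lsubmx.
have -> : (fun y => lsubmx (lsubmx ((chart PQ k \o z) y))) = chart Q k \o (base \o z).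
  by apply/funext => y /=; rewrite lsubmx2_chart.
rewrite -(velocity_chart (smooth_in_base zk)) -mulmxBl.
by rewrite (pair_jac aQ).
Qed.

Section Family.
Variables (g : R -> R -> PQ) (k : idx Q).
Let G := chart PQ k \o uncurry2 g.

Definition uintegrand (y : 'rV[R]_(1 + 1)) : R :=
  integrand (g (lsubmx y 0 0)) (rsubmx y 0 0).

Definition local_integrand (y : 'rV[R]_(1 + 1)) : R :=
  local_lagrangian k (lsubmx (G y)) +
  pair (rsubmx (G y)) (lsubmx (lsubmx ('D_(pt2 0 1) G y)) - rsubmx (lsubmx (G y))).

Lemma smooth_in_slice e t : smooth_in (uncurry2 g) k (pt2 e t) -> smooth_in (g e) k t.
Proof.
move=> [ng sg]; split.
  have := smv_continuous (smv_pt2R e t) ng.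
  by apply: (@filterS _ (nbhs t)) => s /=; rewrite uncurry2E.
have -> : chart PQ k \o g e = G \o pt2 e.
  by apply/funext => s; rewrite /G /= uncurry2E.
by apply: smv_comp => //; exact: smv_pt2R.
Qed.

Lemma derive_slice e t : smooth_in (uncurry2 g) k (pt2 e t) ->
  'D_1 (chart PQ k \o g e) t = 'D_(pt2 0 1) G (pt2 e t).
Proof.
move=> [_ sg]; have D := is_derive_pt2R (smv_derivable sg).
have -> : chart PQ k \o g e = (fun s => G (pt2 e s)).
  by apply/funext => s; rewrite /G /comp uncurry2E.
exact: (@derive_val _ _ _ _ _ _ _ D).
Qed.

Lemma uintegrandE y : smooth_in (uncurry2 g) k y -> uintegrand y = local_integrand y.
Proof.
rewrite -(pt2E y); move: (lsubmx y 0 0) (rsubmx y 0 0) => e t gk.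
rewrite /uintegrand lsubmx_pt2 rsubmx_pt2 (integrandE (smooth_in_slice gk)).
by rewrite (derive_slice gk) /local_integrand /G /= uncurry2E.
Qed.

Lemma local_integrand_sm y : smooth_in (uncurry2 g) k y -> sm local_integrand y.
Proof.
move=> gk; have [_ sG] := gk; apply: smD.
  apply: (@sm_comp _ _ _ (fun y => lsubmx (G y))); first exact: smv_lsubmx.
  by rewrite /G /= lsubmx_chart; apply: local_lagrangian_sm; exact: (smooth_in_dom gk).
apply: sm_pair; first exact: smv_rsubmx.
apply: smvB; last by apply/smv_rsubmx/smv_lsubmx.
by apply/smv_lsubmx/smv_lsubmx/smv_derive.
Qed.

Lemma near_uintegrandE y : smooth_in (uncurry2 g) k y ->
  \forall y' \near y, local_integrand y' = uintegrand y'.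
Proof. by move=> /smooth_in_near; apply: filterS => y' /uintegrandE. Qed.

Lemma uintegrand_sm y : smooth_in (uncurry2 g) k y -> sm uintegrand y.
Proof. by move=> gk; apply: sm_eq (near_uintegrandE gk) (local_integrand_sm gk). Qed.

Definition boundary_term t : R := pair (g 0 t).2 (base_variation g t).

Lemma base_variation_chart t : smooth_in (uncurry2 g) k (pt2 0 t) ->
  base_variation g t *m jac Q (chart_at Q (base (g 0 t))) k (base (g 0 t)) =
  lsubmx (lsubmx ('D_(pt2 1 0) G (pt2 0 t))).
Proof.
move=> gk; have [ng sg] := gk.
have gk0 : smooth_in (fun e => base (g e t)) k 0.
  apply: (@smooth_in_base _ (fun e => g e t)); split.
    have := smv_continuous (smv_pt2L 0 t) ng.
    by apply: (@filterS _ (nbhs (0 : R))) => s /=; rewrite uncurry2E.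
  have -> : chart PQ k \o (fun e => g e t) = G \o (fun e => pt2 e t).
    by apply/funext => s; rewrite /G /= uncurry2E.
  by apply: smv_comp => //; exact: smv_pt2L.
rewrite /base_variation (velocity_chart gk0) -!derive_lsubmx//; last exact: smv_lsubmx.
have sg2 : smv (fun y => lsubmx (lsubmx (G y))) (pt2 0 t) by apply/smv_lsubmx/smv_lsubmx.
have D := is_derive_pt2L (smv_derivable sg2).
rewrite -(@derive_val _ _ _ _ _ _ _ D).
have -> // : chart Q k \o (fun e => base (g e t)) = (fun s => lsubmx (lsubmx (G (pt2 s t)))).
by apply/funext => s; rewrite /G /comp uncurry2E lsubmx2_chart.
Qed.

Let local_boundary y := pair (rsubmx (G y)) (lsubmx (lsubmx ('D_(pt2 1 0) G y))).

Lemma boundary_termE t : smooth_in (uncurry2 g) k (pt2 0 t) ->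
  boundary_term t = local_boundary (pt2 0 t).
Proof.
move=> gk; have zk : dom Q k (base (g 0 t)).
  by have := smooth_in_dom gk; rewrite uncurry2E.
rewrite /boundary_term /local_boundary -(base_variation_chart gk) /G /= uncurry2E mom_chart.
by rewrite (pair_jac aQ)//; exact: (atlas_dom aQ).
Qed.

Lemma near_boundary_termE t : smooth_in (uncurry2 g) k (pt2 0 t) ->
  \forall s \near t, local_boundary (pt2 0 s) = boundary_term s.
Proof.
move=> /smooth_in_near n; have := smv_continuous (smv_pt2R 0 t) n.
by apply: (@filterS _ (nbhs t)) => s /= /boundary_termE.
Qed.

Lemma local_boundary_sm t : smooth_in (uncurry2 g) k (pt2 0 t) ->
  sm local_boundary (pt2 0 t).
Proof.
move=> [_ sG]; apply: sm_pair; first exact: smv_rsubmx.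
by apply/smv_lsubmx/smv_lsubmx/smv_derive.
Qed.

Lemma boundary_term_sm t : smooth_in (uncurry2 g) k (pt2 0 t) -> sm boundary_term t.
Proof.
move=> gk; apply: sm_eq (near_boundary_termE gk) _.
by apply: (@sm_comp _ _ _ (pt2 0)); [exact: smv_pt2R|exact: local_boundary_sm].
Qed.

(** Neither term mentions a chart, so evaluating this quantity with [residualE] in two charts shows
    that the pointwise equations do not depend on the chart. *)
Definition residual t : R := 'D_(pt2 1 0) uintegrand (pt2 0 t) - 'D_1 boundary_term t.

(** [y] holds the components (q, v, p), [y'] their time derivatives, and [w] the components of a
    variation (dq, dv, dp). *)
Definition euler_lagrange_form (y y' w : 'rV[R]_(d + d + d)) : R :=
  pair (lsubmx (gradient k (lsubmx y)) - rsubmx y') (lsubmx (lsubmx w)) +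
  pair (rsubmx (gradient k (lsubmx y)) - rsubmx y) (rsubmx (lsubmx w)) +
  pair (rsubmx w) (lsubmx (lsubmx y') - rsubmx (lsubmx y)).

Definition euler_lagrange z t (w : 'rV[R]_(d + d + d)) : R :=
  euler_lagrange_form (chart PQ k (z t)) ('D_1 (chart PQ k \o z) t) w.

Lemma residualE t : smooth_in (uncurry2 g) k (pt2 0 t) ->
  residual t = euler_lagrange (g 0) t ('D_(pt2 1 0) G (pt2 0 t)).
Proof.
move=> gk; have [_ sG] := gk; set y := pt2 0 t.
have gty : chart PQ k (g 0 t) = G y by rewrite /G /= uncurry2E.
have zk : dom Q k (tpart (g 0 t)).1.
  by have := smooth_in_dom gk; rewrite uncurry2E.
rewrite /residual -(near_eq_derive _ (near_uintegrandE gk)).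
rewrite -(near_eq_derive _ (near_boundary_termE gk)).
rewrite (@derive_val _ _ _ _ _ _ _ (is_derive_pt2R (sm_derivable (local_boundary_sm gk)))).
rewrite /euler_lagrange (derive_slice gk) gty.
have sl : sm (local_lagrangian k) (lsubmx (G y)).
  by rewrite -gty lsubmx_chart; exact: local_lagrangian_sm.
have dl w : 'D_w (local_lagrangian k) (lsubmx (G y)) = pair (gradient k (lsubmx (G y))) w.
  by rewrite -gty lsubmx_chart; exact: derive_local_lagrangian.
exact: (pontryagin_first_variation (pt2 1 0) (pt2 0 1) sG sl dl).
Qed.

End Family.

End Lagrangian.

(** * The variational principle and its pointwise equations *)

Section Principle.
Context {R : realType} (Q : charted R).
Hypothesis aQ : atlas Q.
Variables (L : tangent Q -> R).
Hypothesis sL : smooth_lagrangian L.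
Notation d := (dim Q).
Notation PQ := (pontryagin Q).
Notation mu := (@lebesgue_measure R).
Implicit Types (k : idx Q) (z c : R -> PQ) (g : R -> R -> PQ).
Let aP := atlas_pontryagin aQ.

Lemma velocity_const (M : charted R) (c : R -> M) (t : R) :
  (\forall s \near t, c s = c t) -> velocity c t = 0.
Proof.
move=> nc; rewrite /velocity.
rewrite -(derive_cst (chart M (chart_at M (c t)) (c t)) t 1).
by apply: near_eq_derive; apply: filterS nc => s /= ->.
Qed.

Lemma velocity_cst (M : charted R) (c : R -> M) (t : R) :
  (forall s, c s = c t) -> velocity c t = 0.
Proof. by move=> H; apply: velocity_const; apply: (@filterE _ (nbhs t)). Qed.

Lemma actionE t1 t2 g e :
  pontryagin_action L t1 t2 (g e) = \int[mu]_(t in `[t1, t2]) uintegrand L g (pt2 e t).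
Proof.
by apply: eq_Rintegral => t _; rewrite /uintegrand lsubmx_pt2 rsubmx_pt2.
Qed.

Lemma residual_continuous g k t : smooth_in (uncurry2 g) k (pt2 0 t) ->
  {for t, continuous (residual L g)}.
Proof.
move=> gk.
have s1 : sm (fun s => 'D_(pt2 1 0) (uintegrand L g) (pt2 0 s)) t.
  apply: (@sm_comp _ _ _ (pt2 0) ('D_(pt2 1 0) (uintegrand L g))).
    exact: smv_pt2R.
  by apply: sm_derive; exact: (uintegrand_sm aQ sL gk).
have s2 : sm ('D_1 (boundary_term g)) t by apply: sm_derive; exact: (boundary_term_sm aQ gk).
exact: sm_continuous (smB s1 s2).
Qed.

(** The derivative of the action differs from the integral of the residual by the integral of the
    time derivative of <p, dq>, whose values at both endpoints are zero. *)
Lemma first_variation t1 t2 g : t1 < t2 ->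
  (forall t, t1 <= t <= t2 -> exists k, smooth_in (uncurry2 g) k (pt2 0 t)) ->
  base_variation g t1 = 0 -> base_variation g t2 = 0 ->
  is_derive (0 : R) (1 : R) (fun e => pontryagin_action L t1 t2 (g e))
    (\int[mu]_(t in `[t1, t2]) residual L g t).
Proof.
move=> t12 sg b1 b2.
have su t : t1 <= t <= t2 -> sm (uintegrand L g) (pt2 0 t).
  by move=> /sg[k gk]; exact: (uintegrand_sm aQ sL gk).
have sb t : t1 <= t <= t2 -> sm (boundary_term g) t.
  by move=> /sg[k gk]; exact: (boundary_term_sm aQ gk).
have D := leibniz_integral su.
have -> : (fun e => pontryagin_action L t1 t2 (g e)) =
   (fun e => \int[mu]_(t in `[t1, t2]) uintegrand L g (pt2 e t)).
  by apply/funext => e; rewrite actionE.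
apply: (is_derive_eq D).
have mI : measurable (`[t1, t2]%classic : set (measurableTypeR R)) by exact: measurable_itv.
have iu : mu.-integrable `[t1, t2] (EFin \o (fun t => 'D_(pt2 1 0) (uintegrand L g) (pt2 0 t))).
  apply: continuous_itv_integrable => t tI; apply: sm_continuous.
  apply: (@sm_comp _ _ _ (pt2 0) ('D_(pt2 1 0) (uintegrand L g))).
    exact: smv_pt2R.
  by apply: sm_derive; exact: su.
have ib : mu.-integrable `[t1, t2] (EFin \o (fun t => 'D_1 (boundary_term g) t)).
  apply: continuous_itv_integrable => t tI; apply: sm_continuous.
  by apply: sm_derive; exact: sb.
have -> : \int[mu]_(t in `[t1, t2]) residual L g t =
    \int[mu]_(t in `[t1, t2]) 'D_(pt2 1 0) (uintegrand L g) (pt2 0 t) -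
    \int[mu]_(t in `[t1, t2]) 'D_1 (boundary_term g) t by exact: RintegralB.
by rewrite (FTC t12 sb) /boundary_term b1 b2 !pair0r !subr0.
Qed.

Lemma euler_lagrange_eq k z z' t w : z t = z' t ->
  'D_1 (chart PQ k \o z) t = 'D_1 (chart PQ k \o z') t ->
  euler_lagrange L k z t w = euler_lagrange L k z' t w.
Proof. move=> zt Dz.
exact: (f_equal2 (fun y y' => euler_lagrange_form L k y y' w) (f_equal (chart PQ k) zt) Dz). Qed.

Definition forced_euler_lagrange k z t (F : 'rV[R]_d) w : R :=
  euler_lagrange L k z t w +
  pair (F *m (jac Q k (chart_at Q (base (z t))) (base (z t)))^T) (lsubmx (lsubmx w)).

(** [D], [u] and [F] are in the preferred chart at the base point, [w] in chart [k]. Only the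
    position block of [w] is constrained; the velocity and momentum blocks are free. *)
Definition pointwise_equations (D : {vspace 'rV[R]_d}) k z t (F : 'rV[R]_d) : Prop :=
  forall w u, u \in D ->
    lsubmx (lsubmx w) = u *m jac Q (chart_at Q (base (z t))) k (base (z t)) ->
    forced_euler_lagrange k z t F w = 0.

Lemma forced_euler_lagrangeE k z t F w u : dom Q k (base (z t)) ->
  lsubmx (lsubmx w) = u *m jac Q (chart_at Q (base (z t))) k (base (z t)) ->
  forced_euler_lagrange k z t F w = euler_lagrange L k z t w + pair F u.
Proof.
move=> zk wu; rewrite /forced_euler_lagrange wu (pair_jac aQ)//.
exact: (atlas_dom aQ).
Qed.

(** Straight-line variation in chart [k], which realizes any prescribed field of components [xi] as
    a first variation. *)
Definition chart_variation k z (xi : R -> 'rV[R]_(d + d + d)) (e s : R) : PQ :=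
  chart_inv PQ k (chart PQ k (z s) + e *: xi s).

Lemma chart_variation0 k z xi t : smooth_in z k t ->
  \forall s \near t, chart_variation k z xi 0 s = z s.
Proof.
move=> [nz _]; apply: filterS nz => s zs.
by rewrite /chart_variation scale0r addr0 (atlasK aP).
Qed.

Lemma chart_variation_smooth k z xi t : smooth_in z k t -> smv xi t ->
  smooth_in (uncurry2 (chart_variation k z xi)) k (pt2 0 t) /\
  'D_(pt2 1 0) (chart PQ k \o uncurry2 (chart_variation k z xi)) (pt2 0 t) = xi t.
Proof.
move=> [nz sz] sxi.
pose h (y : 'rV[R]_(1 + 1)) := chart PQ k (z (rsubmx y 0 0)) + lsubmx y 0 0 *: xi (rsubmx y 0 0).
have sr : sm (fun y : 'rV[R]_(1 + 1) => rsubmx y 0 0) (pt2 0 t).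
  exact: (smv_rsubmx (smv_id _)).
have sl : sm (fun y : 'rV[R]_(1 + 1) => lsubmx y 0 0) (pt2 0 t).
  exact: (smv_lsubmx (smv_id _)).
have hE : h (pt2 0 t) = chart PQ k (z t).
  by rewrite /h lsubmx_pt2 rsubmx_pt2 scale0r addr0.
have sh : smv h (pt2 0 t).
  apply: smvD.
    apply: (@smv_comp1 _ _ _ _ (fun y : 'rV[R]_(1 + 1) => rsubmx y 0 0) (chart PQ k \o z)) => //.
    by rewrite rsubmx_pt2.
  apply: smvZ => //; apply: (@smv_comp1 _ _ _ _ (fun y : 'rV[R]_(1 + 1) => rsubmx y 0 0) xi) => //.
  by rewrite rsubmx_pt2.
have [H1 H2] := smooth_in_inv aP (nbhs_singleton nz) hE sh.
split; first exact: H1.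
rewrite (near_eq_derive _ H2).
rewrite -(@derive_val _ _ _ _ _ _ _ (is_derive_pt2L (smv_derivable sh))).
have -> : (fun s => h (pt2 s t)) = (fun s => chart PQ k (z t) + s *: xi t).
  by apply/funext => s; rewrite /h lsubmx_pt2 rsubmx_pt2.
have H : derivable (id : 'rV[R]_(d+d+d) -> 'rV[R]_(d+d+d)) (chart PQ k (z t) + 0 *: xi t) (xi t).
  exact: derivable_id.
rewrite (@derive_val _ _ _ _ _ _ _ (is_derive_line H)).
by rewrite derive_id.
Qed.

(** The curve [z] has to agree with [g 0] only to first order at [t], as is the case at the
    endpoints of the interval. *)
Lemma residual_forced k z g t F : smooth_in (uncurry2 g) k (pt2 0 t) ->
  z t = g 0 t -> 'D_1 (chart PQ k \o z) t = 'D_1 (chart PQ k \o g 0) t ->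
  residual L g t + pair F (base_variation g t) =
  forced_euler_lagrange k z t F ('D_(pt2 1 0) (chart PQ k \o uncurry2 g) (pt2 0 t)).
Proof.
move=> gk zg Dz; rewrite (residualE aQ sL gk).
rewrite (@forced_euler_lagrangeE _ _ _ _ _ (base_variation g t)).
- by rewrite (euler_lagrange_eq _ zg Dz).
- by have := smooth_in_dom gk; rewrite uncurry2E zg.
- by rewrite zg (base_variation_chart aQ gk).
Qed.

Lemma jac_inj k (x : Q) (u u' : 'rV[R]_d) : dom Q k x ->
  u *m jac Q (chart_at Q x) k x = u' *m jac Q (chart_at Q x) k x -> u = u'.
Proof.
move=> xk /(congr1 (fun y => y *m jac Q k (chart_at Q x) x)).
have xp := atlas_dom aQ x.
by rewrite -!mulmxA (jac_mulV aQ)// !mulmx1.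
Qed.

(** A vector [w] in chart [k'] is realized by a straight-line variation there. The residual of this
    variation can also be computed in chart [k], where it vanishes by hypothesis. *)
Lemma pointwise_equations_chart D k k' z t F : smooth_in z k t ->
  dom Q k' (base (z t)) ->
  pointwise_equations D k z t F -> pointwise_equations D k' z t F.
Proof.
move=> zk zk' H w u uD wu.
have zk1 : smooth_in z k' t by exact: (smooth_in_chart aP zk).
have [gk' DG] := chart_variation_smooth zk1 (smv_cst w t).
pose g := chart_variation k' z (fun=> w).
have g0 : \forall s \near t, g 0 s = z s by exact: chart_variation0.
have g0t : z t = g 0 t by rewrite (nbhs_singleton g0).
have D0 j : 'D_1 (chart PQ j \o z) t = 'D_1 (chart PQ j \o g 0) t.
  by apply: near_eq_derive; apply: filterS g0 => s gs; rewrite /comp gs.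
have E := residual_forced F gk' g0t (D0 k').
rewrite DG in E; rewrite -E.
have gk : smooth_in (uncurry2 g) k (pt2 0 t).
  by apply: (smooth_in_chart aP gk'); rewrite uncurry2E -/(g 0 t) -g0t; exact: (smooth_in_dom zk).
rewrite (residual_forced F gk g0t (D0 k)).
apply: (H _ u uD).
have B0 := base_variation_chart aQ gk'; rewrite DG wu in B0.
have B : base_variation g t *m jac Q (chart_at Q (base (g 0 t))) k' (base (g 0 t)) =
  u *m jac Q (chart_at Q (base (z t))) k' (base (z t)) := B0.
rewrite -g0t in B; rewrite -(jac_inj zk' B).
by rewrite -(base_variation_chart aQ gk) -g0t.
Qed.

Lemma admissible_smooth_in (D : distribution Q) t1 t2 c g t :
  admissible_variation D t1 t2 c g -> t1 <= t <= t2 ->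
  smooth_in (uncurry2 g) (chart_at PQ (c t)) (pt2 0 t).
Proof. by move=> [sg g0 _ _] tI; rewrite -g0//; apply/smooth_at_family; exact: sg. Qed.

Lemma admissible_base_variation (D : distribution Q) t1 t2 c g :
  admissible_variation D t1 t2 c g ->
  base_variation g t1 = 0 /\ base_variation g t2 = 0.
Proof.
move=> [_ _ ge _]; have [e1 e2] := nbhs_singleton ge.
split; apply: velocity_const; apply: filterS ge => e [E1 E2].
  by rewrite E1 e1.
by rewrite E2 e2.
Qed.

(** The equations say that the force density is minus the residual at each time; integrating, the
    two contributions cancel. *)
Lemma forced_principle_of_equations (D : distribution Q) t1 t2 c (F : R -> 'rV[R]_d) :
  t1 < t2 -> smooth_curve t1 t2 c ->
  (forall t, t1 <= t <= t2 -> exists2 k, dom Q k (base (c t)) &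
     pointwise_equations (D (base (c t))) k c t (F t)) ->
  forced_lda_pontryagin L F D t1 t2 c.
Proof.
move=> t12 sc H g adm; have [sg g0 ge gD] := adm.
have [b1 b2] := admissible_base_variation adm.
have gk t : t1 <= t <= t2 -> exists k, smooth_in (uncurry2 g) k (pt2 0 t).
  by move=> tI; exists (chart_at PQ (c t)); exact: (admissible_smooth_in adm).
have D1 := first_variation t12 gk b1 b2.
have E t : t1 <= t <= t2 -> pair (F t) (base_variation g t) = - residual L g t.
  move=> tI; have [k ck Hk] := H t tI.
  have gkt : smooth_in (uncurry2 g) k (pt2 0 t).
    by have [k' gk'] := gk t tI; apply: (smooth_in_chart aP gk'); rewrite uncurry2E g0.
  have ckt : smooth_in c k t.
    by have /smooth_at_curve/smooth_in_chart := sc t tI; apply.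
  (* [g 0] coincides with [c] only on the interval, hence the comparison through
     [derive_mx_eq_itv]. *)
  have Dc : 'D_1 (chart PQ k \o c) t = 'D_1 (chart PQ k \o g 0) t.
    apply: (derive_mx_eq_itv t12 tI).
    - by case: ckt.
    - by have [] := smooth_in_slice gkt.
    - by move=> s sI; rewrite /= g0.
  have := residual_forced (F t) gkt (esym (g0 t tI)) Dc.
  rewrite (Hk _ (base_variation g t)); last 2 first.
  - exact: gD.
  - by rewrite -(base_variation_chart aQ gkt) g0.
  by move/eqP; rewrite addrC addr_eq0 => /eqP.
split; first by case: D1.
rewrite (@derive_val _ _ _ _ _ _ _ D1).
(* The force density is replaced by a multiple of the residual, which is continuous and so
   integrable. *)
have -> : \int[mu]_(t in `[t1, t2]) pair (F t) (base_variation g t) =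
    \int[mu]_(t in `[t1, t2]) (- 1 * residual L g t).
  by apply: eq_Rintegral => t; rewrite inE /= in_itv /= => tI; rewrite E// mulN1r.
rewrite RintegralZl; last 2 first.
- exact: measurable_itv.
- apply: continuous_itv_integrable => t tI; have [k gkt] := gk t tI.
  exact: residual_continuous gkt.
by rewrite mulN1r subrr.
Qed.

Lemma smv_gradient k (z : tangent Q) : dom Q k z.1 ->
  smv (gradient L k) (chart (tangent Q) k z).
Proof.
move=> zk i j; rewrite /gradient; under eq_fun do rewrite mxE.
by apply: sm_derive; exact: local_lagrangian_sm.
Qed.

Lemma euler_lagrange_sm k z xi t : smooth_in z k t -> smv xi t ->
  sm (fun s => euler_lagrange L k z s (xi s)) t.
Proof.
move=> zk sxi; have [_ sz] := zk.
have sDz : smv ('D_1 (chart PQ k \o z)) t by exact: smv_derive.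
have szl : smv (fun s => lsubmx (chart PQ k (z s))) t by exact: (smv_lsubmx sz).
have szr : smv (fun s => rsubmx (chart PQ k (z s))) t by exact: (smv_rsubmx sz).
have sg : smv (fun s => gradient L k (lsubmx (chart PQ k (z s)))) t.
  apply: (@smv_comp _ _ _ _ _ (fun s => lsubmx (chart PQ k (z s))) (gradient L k)) => //.
  by rewrite lsubmx_chart; apply: smv_gradient; exact: (smooth_in_dom zk).
have sxl : smv (fun s => lsubmx (xi s)) t by exact: smv_lsubmx.
have sDl : smv (fun s => lsubmx ('D_1 (chart PQ k \o z) s)) t by exact: smv_lsubmx.
apply: smD; first apply: smD.
- apply: sm_pair; last exact: smv_lsubmx.
  by apply: smvB; [exact: smv_lsubmx|exact: smv_rsubmx].
- apply: sm_pair; last exact: smv_rsubmx.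
  by apply: smvB => //; exact: smv_rsubmx.
- apply: sm_pair; first exact: smv_rsubmx.
  by apply: smvB; [exact: smv_lsubmx|exact: smv_rsubmx].
Qed.

Lemma forced_euler_lagrangeZ k z t F a w :
  forced_euler_lagrange k z t F (a *: w) = a * forced_euler_lagrange k z t F w.
Proof.
rewrite /forced_euler_lagrange /euler_lagrange /euler_lagrange_form.
have lZ m n p (x : 'M[R]_(m, n + p)) : lsubmx (a *: x) = a *: lsubmx x by rewrite linearZ.
have rZ m n p (x : 'M[R]_(m, n + p)) : rsubmx (a *: x) = a *: rsubmx x by rewrite linearZ.
rewrite !(lZ, rZ) !pairZr pairZl; ring.
Qed.

(** Lets a condition valid near an endpoint be tested at an interior time, around which a variation
    can be cut off without moving the endpoints. *)
Lemma itv_near_interior (a b t : R) (P : R -> Prop) : a < b -> a <= t <= b ->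
  (\forall s \near t, P s) -> exists2 s, a < s < b & P s.
Proof.
move=> ab /andP[at_ tb] [r /= r0 Hr].
have [tb'|bt] := ltP t b.
  have m0 : 0 < Num.min r (b - t) by rewrite lt_min r0 subr_gt0.
  have mr : Num.min r (b - t) <= r by rewrite ge_min lexx.
  have mb : Num.min r (b - t) <= b - t by rewrite ge_min lexx orbT.
  exists (t + Num.min r (b - t) / 2); first by apply/andP; split; lra.
  by apply: Hr; rewrite /= opprD addNKr normrN gtr0_norm; lra.
have m0 : 0 < Num.min r (b - a) by rewrite lt_min r0 subr_gt0.
have mr : Num.min r (b - a) <= r by rewrite ge_min lexx.
have mb : Num.min r (b - a) <= b - a by rewrite ge_min lexx orbT.
exists (t - Num.min r (b - a) / 2); first by apply/andP; split; lra.
by apply: Hr; rewrite /= opprB addrC subrK gtr0_norm; lra.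
Qed.

Section LocalizedVariation.
Variables (k : idx Q) (c : R -> PQ) (s1 rho : R) (eta : R -> 'rV[R]_(d + d + d)).
Hypothesis ck : forall s, `|s - s1| < rho -> smooth_in c k s /\ smv eta s.
Hypothesis eta0 : forall s, rho / 2 < `|s - s1| -> eta s = 0.

(** The chart is used for times within [rho] of [s1], but the variation is already trivial beyond
    [rho / 2]. The two branches agree on the overlap, so smoothness can be checked on two open sets
    of times. *)
Definition localized_variation (e s : R) : PQ :=
  if `|s - s1| < rho then chart_variation k c eta e s else c s.

Lemma localized_variation_out e s : rho / 2 < `|s - s1| ->
  localized_variation e s = c s.
Proof.
move=> ss; rewrite /localized_variation; case: ifP => // sr.
rewrite /chart_variation eta0// scaler0 addr0 (atlasK aP)//.
by have [/smooth_in_dom] := ck sr.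
Qed.

Lemma localized_variation0 s : localized_variation 0 s = c s.
Proof.
rewrite /localized_variation; case: ifP => // sr.
rewrite /chart_variation scale0r addr0 (atlasK aP)//.
by have [/smooth_in_dom] := ck sr.
Qed.

Lemma near_rsubmx s (P : R -> Prop) : (\forall y \near s, P y) ->
  \forall y \near pt2 0 s, P (rsubmx y 0 0).
Proof.
have c1 : {for pt2 0 s, continuous (fun y : 'rV[R]_(1 + 1) => rsubmx y 0 0)}.
  apply: sm_continuous; exact: (smv_rsubmx (smv_id _)).
by move=> nP; apply: c1; rewrite rsubmx_pt2.
Qed.

Lemma localized_variation_in s : `|s - s1| < rho ->
  smooth_in (uncurry2 localized_variation) k (pt2 0 s) /\
  'D_(pt2 1 0) (chart PQ k \o uncurry2 localized_variation) (pt2 0 s) = eta s.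
Proof.
move=> sr; have [cks es] := ck sr.
have [H1 H2] := chart_variation_smooth cks es.
have n := near_rsubmx (near_dist_lt sr).
have nE : \forall y \near pt2 0 s,
    uncurry2 (chart_variation k c eta) y = uncurry2 localized_variation y.
  by apply: filterS n => y yr; rewrite /uncurry2 /localized_variation yr.
split; first exact: smooth_in_eq nE H1.
rewrite -H2; apply: near_eq_derive; apply: filterS nE => y yE.
by rewrite /comp yE.
Qed.

(** Here the family does not depend on [e], so in any chart it is the straight-line variation with
    zero direction. *)
Lemma localized_variation_far s k' : rho / 2 < `|s - s1| -> smooth_in c k' s ->
  smooth_in (uncurry2 localized_variation) k' (pt2 0 s) /\
  'D_(pt2 1 0) (chart PQ k' \o uncurry2 localized_variation) (pt2 0 s) = 0.
Proof.
move=> sr ck'; have s0 := smv_cst (0 : 'rV[R]_(d + d + d)) s.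
have [H1 H2] := chart_variation_smooth ck' s0.
have n0 : \forall y \near s, rho / 2 < `|y - s1| /\ dom PQ k' (c y).
  by apply: filterI; [exact: near_dist_gt|case: ck'].
have n := near_rsubmx n0.
have nE : \forall y \near pt2 0 s,
    uncurry2 (chart_variation k' c (fun=> 0)) y = uncurry2 localized_variation y.
  apply: filterS n => y [yr yk]; rewrite /uncurry2 localized_variation_out//.
  by rewrite /chart_variation scaler0 addr0 (atlasK aP).
split; first exact: smooth_in_eq nE H1.
rewrite -H2; apply: near_eq_derive; apply: filterS nE => y yE.
by rewrite /comp yE.
Qed.

Lemma localized_base_variation_far s : rho / 2 < `|s - s1| ->
  base_variation localized_variation s = 0.
Proof.
move=> sr; apply: velocity_cst => e.
by rewrite !localized_variation_out.
Qed.

End LocalizedVariation.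

(** Fundamental lemma of the calculus of variations, by contradiction: if the expression [m] is
    nonzero at [t0], a variation in direction [xi], cut off near an interior time, makes the first
    variation plus the work of the force positive. *)
Lemma equations_of_forced_principle (D : distribution Q) t1 t2 c (F : R -> 'rV[R]_d)
    k (xi : R -> 'rV[R]_(d + d + d)) t0 :
  t1 < t2 -> smooth_curve t1 t2 c -> forced_lda_pontryagin L F D t1 t2 c ->
  t1 <= t0 <= t2 -> dom Q k (base (c t0)) -> smv xi t0 ->
  (\forall s \near t0, t1 <= s <= t2 -> exists2 u, u \in D (base (c s)) &
     lsubmx (lsubmx (xi s)) = u *m jac Q (chart_at Q (base (c s))) k (base (c s))) ->
  smv (fun s => F s *m (jac Q k (chart_at Q (base (c s))) (base (c s)))^T) t0 ->
  forced_euler_lagrange k c t0 (F t0) (xi t0) = 0.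
Proof.
move=> t12 sc fl t0I ct0 sxi xiD sF.
have cc t : t1 <= t <= t2 -> smooth_in c (chart_at PQ (c t)) t.
  by move=> tI; apply/smooth_at_curve; exact: sc.
have ck0 : smooth_in c k t0 by exact: (smooth_in_chart aP (cc _ t0I)).
pose m s := forced_euler_lagrange k c s (F s) (xi s).
have sm_m s : smooth_in c k s -> smv xi s ->
    smv (fun s => F s *m (jac Q k (chart_at Q (base (c s))) (base (c s)))^T) s -> sm m s.
  move=> cs xs Fs; apply: smD; first exact: euler_lagrange_sm.
  by apply: sm_pair => //; apply/smv_lsubmx/smv_lsubmx.
apply: contrapT => /eqP m0.
pose W s := [/\ smooth_in c k s, smv xi s, (t1 <= s <= t2 -> exists2 u, u \in D (base (c s)) &
     lsubmx (lsubmx (xi s)) = u *m jac Q (chart_at Q (base (c s))) k (base (c s))),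
   smv (fun s => F s *m (jac Q k (chart_at Q (base (c s))) (base (c s)))^T) s & m s != 0].
have nW : \forall s \near t0, W s.
  have n1 := smooth_in_near ck0.
  have n2 := smv_near sxi.
  have n3 := smv_near sF.
  have n4 : \forall s \near t0, m s != 0.
    by have := sm_continuous (sm_m _ ck0 sxi sF); move/cvgr_neq0; apply.
  near=> s; split; near: s; by [].
(* [m] stays nonzero near some interior time, which leaves room for a cut-off vanishing at both
   endpoints. *)
have [s1 s1I nW1] := itv_near_interior t12 t0I (near_join nW).
have [s1a s1b] := andP s1I.
have W1 : W s1 := nbhs_singleton nW1.
have [cks1 xis1 _ Fs1 ms1] := W1.
have nm : \forall s \near s1, 0 < m s1 * m s.
  have sc1 : sm (fun s => m s1 * m s) s1.
    by apply: smM; [exact: sm_cst|exact: sm_m].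
  have := sm_continuous sc1; move/cvgr_gt; apply.
  by rewrite -expr2 exprn_even_gt0.
have nI : \forall s \near s1, t1 < s < t2.
  near=> s; apply/andP; split; near: s; [exact: lt_nbhsr|exact: lt_nbhsl].
have [rho /= rho0 Hrho] : \forall s \near s1, [/\ W s, 0 < m s1 * m s & t1 < s < t2].
  near=> s; split; near: s; by [].
have HW s : `|s - s1| < rho -> [/\ W s, 0 < m s1 * m s & t1 < s < t2].
  by move=> sr; apply: Hrho; rewrite /= distrC.
pose phi := time_bump s1 (rho / 2).
have rho2 : 0 < rho / 2 by rewrite divr_gt0.
(* The factor [m s1] fixes the sign: the integrand becomes [phi s * (m s1 * m s)], nonnegative and
   positive at [s1]. *)
pose eta s := (phi s * m s1) *: xi s.
have eta_out s : rho / 2 < `|s - s1| -> eta s = 0.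
  by move=> /ltW sr; rewrite /eta /phi time_bump_out// mul0r scale0r.
have ceta s : `|s - s1| < rho -> smooth_in c k s /\ smv eta s.
  move=> /HW[[cs xs _ _ _] _ _]; split => //.
  by apply: smvZ => //; apply: smM; [exact: time_bump_sm|exact: sm_cst].
pose g := localized_variation k c s1 rho eta.
have gin s (sr : `|s - s1| < rho) := localized_variation_in ceta sr.
have gfar s k' sr (ck' : smooth_in c k' s) := localized_variation_far ceta eta_out sr ck'.
have gcase s : `|s - s1| < rho \/ rho / 2 < `|s - s1|.
  have [?|rs] := ltP `|s - s1| rho; [by left|right].
  by apply: lt_le_trans rs; rewrite ltr_pdivrMr// ltr_pMr// ltr1n.
have g0 s : g 0 s = c s by exact: localized_variation0.
have gsm t : t1 <= t <= t2 -> exists k, smooth_in (uncurry2 g) k (pt2 0 t).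
  move=> tI; have [sr|sr] := gcase t; first by exists k; have [] := gin t sr.
  by exists (chart_at PQ (c t)); have [] := gfar t _ sr (cc t tI).
have bin s : `|s - s1| < rho -> base_variation g s *m
    jac Q (chart_at Q (base (c s))) k (base (c s)) = lsubmx (lsubmx (eta s)).
  move=> sr; have [gk DG] := gin s sr.
  by have := base_variation_chart aQ gk; rewrite DG -/g g0.
have bfar s : rho / 2 < `|s - s1| -> base_variation g s = 0.
  exact: localized_base_variation_far.
have bend t : t1 <= t <= t2 -> ~~ (t1 < t < t2) -> rho / 2 < `|t - s1|.
  by move=> tI tn; have [sr|//] := gcase t; have [_ _ tI'] := HW t sr; rewrite tI' in tn.
have adm : admissible_variation D t1 t2 c g.
  split.
  - move=> t tI; apply/smooth_at_family; have [k' gk'] := gsm t tI.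
    apply: (smooth_in_chart aP gk'); rewrite uncurry2E; exact: (atlas_dom aQ).
  - by move=> t _; exact: g0.
  - apply: (@filterE _ (nbhs (0 : R))) => e; split; congr base;
      apply: (localized_variation_out ceta eta_out).
      by apply: bend; rewrite ?lexx ?ltW// ltxx.
    by apply: bend; rewrite ?lexx ?ltW// ltxx andbF.
  - move=> t tI; have [sr|sr] := gcase t; last by rewrite bfar// mem0v.
    have [[cs xs /(_ tI)[u uD uE] _ _] _ _] := HW t sr.
    have -> : base_variation g t = (phi t * m s1) *: u.
      apply: (jac_inj (smooth_in_dom cs)); rewrite bin// -scalemxAl -uE /eta.
      have lZ n p (a : R) (x : 'rV[R]_(n + p)) : lsubmx (a *: x) = a *: lsubmx x by rewrite linearZ.
      by rewrite !lZ.
    exact: memvZ.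
have [b1 b2] := admissible_base_variation adm.
have D1 := first_variation t12 gsm b1 b2.
have [_ E] := fl g adm.
rewrite (@derive_val _ _ _ _ _ _ _ D1) in E.
pose f s := residual L g s + pair (F s) (base_variation g s).
have fin s : `|s - s1| < rho -> f s = phi s * (m s1 * m s).
  move=> sr; have [gk DG] := gin s sr.
  have Ec : c = g 0 by apply/funext => y; rewrite g0.
  have gs : c s = g 0 s := esym (g0 s).
  have Dc : 'D_1 (chart PQ k \o c) s = 'D_1 (chart PQ k \o g 0) s :=
    f_equal (fun z => 'D_1 (chart PQ k \o z) s) Ec.
  have := residual_forced (F s) gk gs Dc; rewrite DG => Er; apply: (etrans Er).
  by rewrite /eta forced_euler_lagrangeZ mulrA.
have ffar s : t1 <= s <= t2 -> rho / 2 < `|s - s1| -> f s = 0.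
  move=> sI sr; have [gk DG] := gfar s _ sr (cc s sI).
  rewrite /f bfar// pair0r addr0 (residualE aQ sL gk) DG.
  rewrite /euler_lagrange /euler_lagrange_form.
  have l0 n p : lsubmx (0 : 'rV[R]_(n + p)) = 0 by apply/rowP => j; rewrite !mxE.
  have r0 n p : rsubmx (0 : 'rV[R]_(n + p)) = 0 by apply/rowP => j; rewrite !mxE.
  by rewrite !(l0, r0) !pair0r pair0l !addr0.
have cres t : t1 <= t <= t2 -> {for t, continuous (residual L g)}.
  by move=> /gsm[k' gk']; exact: residual_continuous gk'.
(* The components of [F] jump with the preferred chart, so continuity of the pairing is read in
   chart [k], in which the regularity of [F] is assumed. *)
have cF t : t1 <= t <= t2 -> {for t, continuous (fun s => pair (F s) (base_variation g s))}.
  move=> tI; apply: sm_continuous; have [sr|sr] := gcase t; last first.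
    apply: (@sm_eq _ _ (fun=> 0)); last exact: sm_cst.
    by apply: filterS (near_dist_gt sr) => s sr'; rewrite bfar// pair0r.
  apply: (@sm_eq _ _ (fun s => pair (F s *m (jac Q k (chart_at Q (base (c s))) (base (c s)))^T)
      (lsubmx (lsubmx (eta s))))).
    apply: filterS (near_dist_lt sr) => s sr'; rewrite -bin// (pair_jac aQ)//.
      by have [/smooth_in_dom] := ceta s sr'.
    exact: (atlas_dom aQ).
  have [[_ _ _ Ft _] _ _] := HW t sr; have [_ et] := ceta t sr.
  by apply: sm_pair => //; apply/smv_lsubmx/smv_lsubmx.
have cf t : t1 <= t <= t2 -> {for t, continuous f}.
  by move=> tI; apply: cvgD; [exact: cres|exact: cF].
have fpos : 0 < \int[mu]_(t in `[t1, t2]) f t.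
  apply: (@Rintegral_gt0 _ _ _ _ s1) => //.
    move=> t tI; have [sr|sr] := gcase t; last by rewrite ffar.
    by rewrite fin// mulr_ge0 ?time_bump_ge0//; have [_ /ltW] := HW t sr.
  have s1r : `|s1 - s1| < rho by rewrite subrr normr0.
  rewrite fin//; have [_ m1 _] := HW s1 s1r.
  by rewrite mulr_gt0// time_bump_gt0// subrr normr0.
have fint : \int[mu]_(t in `[t1, t2]) f t = 0.
  rewrite -E; apply: RintegralD.
  - exact: measurable_itv.
  - exact: continuous_itv_integrable.
  - exact: continuous_itv_integrable.
by rewrite fint ltxx in fpos.
Unshelve. all: by end_near. Qed.

End Principle.

(** * Gluing covector fields along a curve *)

Section Gluing.
Context {R : realType} (M : charted R).
Hypothesis aM : atlas M.
Hypothesis hM : forall x y : M, x <> y ->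
    exists A B : set M, [/\ open_in A, open_in B, A x, B y & A `&` B = set0].
Notation d := (dim M).
Implicit Types (k : idx M) (x z : M).

Lemma near_pt_chart k x (P : set M) : dom M k x -> near_pt x P ->
  \forall y \near chart M k x, P (chart_inv M k y).
Proof.
move=> xk nP; have xp := atlas_dom aM x.
have cT := smv_continuous (atlas_smv aM xk xp).
have E : (chart M (chart_at M x) \o chart_inv M k) (chart M k x) = chart M (chart_at M x) x.
  by rewrite /comp (atlasK aM xk).
have n : \forall y \near chart M k x,
    P (chart_inv M (chart_at M x) ((chart M (chart_at M x) \o chart_inv M k) y)).
  have nP' : \forall y \near (chart M (chart_at M x) \o chart_inv M k) (chart M k x),
      P (chart_inv M (chart_at M x) y) by rewrite E.
  exact: cT _ nP'.
apply: filterS2 (atlas_near aM xk xp) n => y [_ yp _].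
by rewrite /comp (atlasK aM yp).
Qed.

Lemma mx_ball_box n (y0 y : 'rV[R]_n) r : 0 < r ->
  (forall j, `|y0 0 j - y 0 j| < r) -> ball y0 r y.
Proof. by move=> r0 H; split => // i j; rewrite (ord1 i); exact: H. Qed.

(* The Hausdorff property is what makes the extension by zero smooth. *)
Lemma manifold_bump k (x0 : M) : dom M k x0 -> exists psi : M -> R,
  [/\ forall z, 0 <= psi z, 0 < psi x0, forall z, psi z != 0 -> dom M k z,
    forall k' x, dom M k' x -> sm (psi \o chart_inv M k') (chart M k' x) &
    forall k' x, dom M k' x -> ~ dom M k x ->
      \forall y \near chart M k' x, psi (chart_inv M k' y) = 0].
Proof.
move=> x0k; set y0 := chart M k x0.
have /nbhs_ballP[r /= r0 Hr] := atlas_near aM x0k x0k.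
pose sq (y : 'rV[R]_d) := \sum_j (y 0 j - y0 0 j) * (y 0 j - y0 0 j).
(* The Euclidean ball of radius [r / 2] lies in the compact cube [K] of half side [r / 2], itself
   inside the sup-norm ball of radius [r] on which the chart is invertible. *)
pose h (y : 'rV[R]_d) := bump ((r / 2) ^+ 2 - sq y).
have sh y : sm h y.
  apply: (@sm_comp1 _ _ (fun y => (r / 2) ^+ 2 - sq y) bump); last exact: sm_bump.
  apply: smB; first exact: sm_cst.
  by apply: sm_sum => j _; apply: smM; (apply: smB; [exact: sm_coord|exact: sm_cst]).
pose K : set 'rV[R]_d := [set y | forall j, `[y0 0 j - r / 2, y0 0 j + r / 2]%classic (y 0 j)].
have cK : compact K.
  apply: (@rV_compact _ _ (fun j => `[y0 0 j - r / 2, y0 0 j + r / 2]%classic)) => j.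
  exact: segment_compact.
have hK y : h y != 0 -> K y.
  move=> hy; have : 0 < h y by rewrite lt_neqAle eq_sym hy bump_ge0.
  rewrite bump_gt0 subr_gt0 => sy j; rewrite /= in_itv /=.
  have : (y 0 j - y0 0 j) ^+ 2 < (r / 2) ^+ 2.
    apply: le_lt_trans sy; rewrite /sq (bigD1 j)//= expr2 lerDl.
    by apply: sumr_ge0 => i _; rewrite -expr2 sqr_ge0.
  rewrite -(real_normK (num_real (y 0 j - y0 0 j))) ltr_sqr ?nnegrE ?divr_ge0 ?(ltW r0)//.
  by rewrite ltr_norml => /andP[? ?]; apply/andP; split; lra.
have KW y : K y -> dom M k (chart_inv M k y) /\ chart M k (chart_inv M k y) = y.
  move=> Ky; have [|yk _ yE] := Hr y; last by [].
  apply: mx_ball_box => // j; have := Ky j; rewrite /= in_itv /= => /andP[? ?].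
  by rewrite ltr_norml; apply/andP; split; lra.
pose psi z := if `[< dom M k z >] then h (chart M k z) else 0.
have psi0 z : psi z != 0 -> dom M k z.
  by rewrite /psi; case: asboolP => //; rewrite eqxx.
have psiK z : psi z != 0 -> K (chart M k z).
  by rewrite /psi; case: asboolP => [_ /hK//|]; rewrite eqxx.
(* A point outside the chart differs from every point of the image of [K]. Separating
   neighbourhoods, made uniform by compactness of [K], give a neighbourhood of [x] that misses this
   image, and [psi] is zero off the image. *)
have Z k' x : dom M k' x -> ~ dom M k x -> \forall y \near chart M k' x, psi (chart_inv M k' y) = 0.
  move=> xk' xk.
  have /compact_near_coveringP nK := cK.
  pose P (y κ : 'rV[R]_d) := chart_inv M k' y <> chart_inv M k κ.
  have H κ : K κ -> \forall κ' \near κ & y \near chart M k' x, P y κ'.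
    move=> Kκ; have [pk pE] := KW κ Kκ.
    have [|A [B [oA oB Ax Bp AB]]] := hM (x := x) (y := chart_inv M k κ).
      by move=> xE; rewrite xE in xk.
    have nA := near_pt_chart xk' (oA x Ax).
    have := near_pt_chart pk (oB _ Bp); rewrite pE => nB.
    exists ([set y | B (chart_inv M k y)], [set y | A (chart_inv M k' y)]) => //=.
    move=> [κ' y] [/= Bk Ay] E; have : (A `&` B) (chart_inv M k' y) by split => //; rewrite E.
    by rewrite AB.
  have nKP : \forall y \near chart M k' x, K `<=` P y := nK _ (nbhs (chart M k' x)) P (nbhs_filter _) H.
  apply: filterS nKP => y Hy; apply/eqP; apply: contrapT => /negP py.
  have Kp := psiK _ py; apply: (Hy _ Kp).
  by rewrite (atlasK aM)//; exact: psi0.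
exists psi; split => //.
- by move=> z; rewrite /psi; case: asboolP => // _; exact: bump_ge0.
- rewrite /psi asboolT// /h bump_gt0 /sq big1 ?subr0 ?exprn_gt0 ?divr_gt0//.
  by move=> j _; rewrite subrr mulr0.
- move=> k' x xk'; have [xk|xk] := pselect (dom M k x).
    apply: (@sm_eq _ _ (h \o (chart M k \o chart_inv M k'))).
      apply: filterS (atlas_near aM xk' xk) => y [_ yk _].
      by rewrite /psi /comp asboolT.
    by apply: sm_comp; [exact: atlas_smv|exact: sh].
  apply: (@sm_eq _ _ (fun=> 0)); last exact: sm_cst.
  by apply: filterS (Z _ _ xk' xk) => y; rewrite /comp => ->.
Qed.

Lemma near_rsubmx_chart (t : R) k x (P : 'rV[R]_d -> Prop) :
  (\forall y \near chart M k x, P y) ->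
  \forall y \near (row_mx (const_mx t) (chart M k x) : 'rV[R]_(1 + d)), P (rsubmx y).
Proof.
set w := row_mx _ _.
have c1 : {for w, continuous (fun y : 'rV[R]_(1 + d) => rsubmx y)}.
  apply: smv_continuous; exact: (smv_rsubmx (smv_id _)).
by move=> nP; apply: c1; rewrite /w row_mxKr.
Qed.

Lemma near_lsubmx_row (t : R) (y0 : 'rV[R]_d) (P : R -> Prop) :
  (\forall s \near t, P s) ->
  \forall y \near (row_mx (const_mx t) y0 : 'rV[R]_(1 + d)), P (lsubmx y 0 0).
Proof.
set w := row_mx _ _.
have c1 : {for w, continuous (fun y : 'rV[R]_(1 + d) => lsubmx y 0 0)}.
  apply: sm_continuous; exact: (smv_lsubmx (smv_id _)).
by move=> nP; apply: c1; rewrite /w row_mxKl mxE.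
Qed.

(** Joint smoothness in time and position. The covector at a nearby point [z] is converted from the
    preferred chart at [z] to the one at [x], since its raw components may jump. *)
Definition smooth_covector_field (G : R -> M -> 'rV[R]_d) (t : R) (x : M) : Prop :=
  smv (fun y : 'rV[R]_(1 + d) =>
    let z := chart_inv M (chart_at M x) (rsubmx y) in
    G (lsubmx y 0 0) z *m (jac M (chart_at M x) (chart_at M z) z)^T)
  (row_mx (const_mx t) (chart M (chart_at M x) x)).

(** Off the chart [k] the factor [psi] vanishes nearby, and for times at distance at least [2 * r]
    the time factor does. In the remaining case every factor is smooth. *)
Lemma localized_field_sm k k' x t t0 r (b : R -> 'rV[R]_d) (psi : M -> R) (S : R -> R) :
  dom M k' x -> 0 < r -> (`|t - t0| < 2 * r -> smv b t) -> sm S t -> S t != 0 ->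
  sm (psi \o chart_inv M k') (chart M k' x) ->
  (~ dom M k x -> \forall y \near chart M k' x, psi (chart_inv M k' y) = 0) ->
  smv (fun y : 'rV[R]_(1 + d) =>
    (time_bump t0 r (lsubmx y 0 0) * psi (chart_inv M k' (rsubmx y)) / S (lsubmx y 0 0)) *:
    (b (lsubmx y 0 0) *m (jac M k' k (chart_inv M k' (rsubmx y)))^T))
    (row_mx (const_mx t) (chart M k' x)).
Proof.
move=> xk' r0 sb sS S0 spsi psi0; set w0 := row_mx _ _.
have sl : sm (fun y : 'rV[R]_(1 + d) => lsubmx y 0 0) w0 by exact: (smv_lsubmx (smv_id _)).
have lw : lsubmx w0 0 0 = t by rewrite row_mxKl mxE.
have sr : smv (fun y : 'rV[R]_(1 + d) => rsubmx y) w0 by exact: (smv_rsubmx (smv_id _)).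
have rw : rsubmx w0 = chart M k' x by rewrite row_mxKr.
have [xk|/psi0 n0] := pselect (dom M k x); last first.
  apply: (@smv_eq _ _ _ _ (fun=> 0)); last exact: smv_cst.
  by apply: filterS (near_rsubmx_chart t n0) => y y0; rewrite y0 mulr0 mul0r scale0r.
have [tr|tr] := ltP `|t - t0| (2 * r); last first.
  have rt : r < `|t - t0| by apply: lt_le_trans tr; rewrite mulrC ltr_pMr// ltr1n.
  apply: (@smv_eq _ _ _ _ (fun=> 0)); last exact: smv_cst.
  apply: filterS (near_lsubmx_row (chart M k' x) (near_dist_gt rt)) => y yr.
  by rewrite time_bump_out ?ltW// !mul0r scale0r.
apply: smvZ.
  apply: smM; first apply: smM.
  - by apply: (@sm_comp1 _ _ (fun y : 'rV[R]_(1 + d) => lsubmx y 0 0)) => //; exact: time_bump_sm.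
  - by apply: (@sm_comp _ _ _ (fun y : 'rV[R]_(1 + d) => rsubmx y) (psi \o chart_inv M k')) => //; rewrite rw.
  - apply: smV; first by rewrite lw.
    by apply: (@sm_comp1 _ _ (fun y : 'rV[R]_(1 + d) => lsubmx y 0 0)) => //; rewrite lw.
apply: smv_mul.
  move=> i j; apply: (@sm_comp1 _ _ (fun y : 'rV[R]_(1 + d) => lsubmx y 0 0) (fun s => b s i j)) => //.
  by rewrite lw; exact: sb.
apply: smv_tr.
apply: (@smv_comp _ _ _ _ _ _ (fun y => jac M k' k (chart_inv M k' y))) => //.
by rewrite rw; exact: jac_smv.
Qed.

(** Each local field is multiplied by a cut-off in time and a cut-off in position supported in its
    chart. Along the curve finitely many such weights suffice, by compactness of the interval. The
    pieces are indexed by their central times, hence the sums over sequences of reals in the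
    convexity hypothesis. *)
Lemma glue_covector_fields (q : R -> M) (t1 t2 : R) (P : R -> 'rV[R]_d -> Prop) :
  (forall t (s : seq R) (l : R -> R) (b : R -> 'rV[R]_d), (forall i, 0 <= l i) ->
    \sum_(i <- s) l i = 1 -> (forall i, i \in s -> l i != 0 -> P t (b i)) ->
    P t (\sum_(i <- s) l i *: b i)) ->
  (forall t0, t1 <= t0 <= t2 -> exists k beta,
    [/\ smooth_in q k t0, smv beta t0 & \forall s \near t0, t1 <= s <= t2 ->
      P s (beta s *m (jac M (chart_at M (q s)) k (q s))^T)]) ->
  exists2 G : R -> M -> 'rV[R]_d,
    forall t, t1 <= t <= t2 -> P t (G t (q t)) &
    forall t x, t1 <= t <= t2 -> smooth_covector_field G t x.
Proof.
move=> convP locP.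
have /choice[data Hdata] (t0 : R) : exists D : idx M * (R -> 'rV[R]_d) * (M -> R) * R,
    t1 <= t0 <= t2 -> [/\ 0 < D.2, forall s, `|s - t0| < 2 * D.2 ->
      [/\ smooth_in q D.1.1.1 s, smv D.1.1.2 s & t1 <= s <= t2 ->
        P s (D.1.1.2 s *m (jac M (chart_at M (q s)) D.1.1.1 (q s))^T)],
      forall z, 0 <= D.1.2 z, 0 < D.1.2 (q t0) &
      (forall z, D.1.2 z != 0 -> dom M D.1.1.1 z) /\
      (forall k' x, dom M k' x -> sm (D.1.2 \o chart_inv M k') (chart M k' x)) /\
      (forall k' x, dom M k' x -> ~ dom M D.1.1.1 x ->
        \forall y \near chart M k' x, D.1.2 (chart_inv M k' y) = 0)].
  have [tI|tI] := pselect (t1 <= t0 <= t2); last first.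
    (* Arbitrary data for times outside the interval. *)
    by exists (chart_at M (q t0), (fun=> 0), (fun=> 0), 0).
  have [k [beta [qk sb Pb]]] := locP t0 tI.
  have [psi [p1 p2 p0 p3 p4]] := manifold_bump (smooth_in_dom qk).
  have n1 := smooth_in_near qk; have n2 := smv_near sb.
  have [r /= r0 Hr] : \forall s \near t0, [/\ smooth_in q k s, smv beta s & t1 <= s <= t2 ->
      P s (beta s *m (jac M (chart_at M (q s)) k (q s))^T)].
    near=> s; split; near: s; by [].
  (* Halving the radius leaves a margin: the time cut-off vanishes well before the local data cease
     to be smooth. *)
  exists (k, beta, psi, r / 2) => _ /=; split => //; first by rewrite divr_gt0.
  by move=> s; rewrite mulrC divfK// distrC; exact: Hr.
pose K t0 := (data t0).1.1.1.
pose beta t0 := (data t0).1.1.2.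
pose psi t0 := (data t0).1.2.
pose rad t0 := (data t0).2.
pose chi t0 s z := time_bump t0 (rad t0) s * psi t0 z.
have chi_ge0 t0 s z : t1 <= t0 <= t2 -> 0 <= chi t0 s z.
  by move=> /Hdata[_ _ p0 _ _]; apply: mulr_ge0; [exact: time_bump_ge0|exact: p0].
have chi_q_sm t0 t : t1 <= t0 <= t2 -> sm (fun s => chi t0 s (q s)) t.
  move=> /Hdata[r0 Hr _ _ [_ [p1 _]]].
  have [tr|tr] := ltP `|t - t0| (2 * rad t0).
    apply: smM; first exact: time_bump_sm.
    have [[nq sq] _ _] := Hr t tr.
    apply: (@sm_eq _ _ ((psi t0 \o chart_inv M (K t0)) \o (chart M (K t0) \o q))).
      by apply: filterS nq => s qs; rewrite /comp (atlasK aM).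
    by apply: sm_comp => //; apply: p1; exact: nbhs_singleton nq.
  apply: (@sm_eq _ _ (fun=> 0)); last exact: sm_cst.
  have : rad t0 < `|t - t0|.
    by apply: lt_le_trans tr; rewrite mulrC ltr_pMr// ltr1n.
  move/near_dist_gt; apply: filterS => s sr.
  by rewrite /chi time_bump_out ?mul0r// ltW.
(* The weight centred at [t] is positive at time [t] along the curve, so positivity sets of the
   weights cover the compact interval. *)
have [D DI Dcov] : exists2 D : {fset R}, forall i, i \in D -> t1 <= i <= t2 &
    forall t, t1 <= t <= t2 -> exists2 i, i \in D & 0 < chi i t (q t).
  have cI : compact `[t1, t2] by exact: segment_compact.
  rewrite compact_cover in cI.
  have [|t tI|D DI Dcov] := cI R `[t1, t2]%classic (fun i => [set s | 0 < chi i s (q s)]°).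
  - by move=> i _; exact: open_interior.
  - exists t => //; move: tI; rewrite /= in_itv /= => tI.
    have := sm_continuous (chi_q_sm t t tI); move/cvgr_gt; apply.
    have [r0 _ _ p0 _] := Hdata t tI.
    by rewrite mulr_gt0// time_bump_gt0 ?subrr ?normr0.
  - exists D => [i /DI|t tI]; first by rewrite inE /= in_itv.
    have [|i iD /interior_subset] := Dcov t; first by rewrite /= in_itv.
    by exists i.
pose S s := \sum_(i <- enum_fset D) chi i s (q s).
have S_sm t : sm S t.
  rewrite /S; under eq_fun do rewrite big_seq.
  by apply: sm_sum => i iD; apply: chi_q_sm; exact: DI.
have S_gt0 t : t1 <= t <= t2 -> 0 < S t.
  move=> tI; have [i iD ci] := Dcov t tI.
  rewrite /S (big_rem i)//= ltr_pwDl// big_seq sumr_ge0// => j jD.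
  by apply: chi_ge0; apply: DI; exact: mem_rem jD.
(* The weights add up to 1 only along the curve, which is all that matters;
   dividing by [S s] rather than by their sum at [z] avoids zeros off the curve. *)
pose G s z := \sum_(i <- enum_fset D)
  (chi i s z / S s) *: (beta i s *m (jac M (chart_at M z) (K i) z)^T).
exists G.
- move=> t tI.
  (* The coefficients are set to zero off [D], since the convexity hypothesis asks for nonnegativity
     at all real indices. *)
  pose l i := if i \in enum_fset D then chi i t (q t) / S t else 0.
  pose b i := beta i t *m (jac M (chart_at M (q t)) (K i) (q t))^T.
  have -> : G t (q t) = \sum_(i <- enum_fset D) l i *: b i.
    by apply: eq_big_seq => i iD; rewrite /l iD.
  apply: convP.
  + move=> i; rewrite /l; case: ifP => // iD.
    by rewrite divr_ge0// ?chi_ge0// ?(ltW (S_gt0 t tI))//; exact: DI.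
  + rewrite (eq_big_seq (fun i => chi i t (q t) / S t)); last by move=> i iD; rewrite /l iD.
    by rewrite -mulr_suml divff// gt_eqF// S_gt0.
  + move=> i iD; rewrite /l iD => lt0.
    have iI : t1 <= i <= t2 by exact: DI.
    have [r0 Hr _ _ _] := Hdata i iI.
    have : `|t - i| < rad i.
      rewrite ltNge; apply/negP => /(time_bump_out r0) tb0.
      by move: lt0; rewrite /chi tb0 !mul0r eqxx.
    move=> tr; have [|_ _ PP] := Hr t; last exact: PP.
    by apply: lt_trans tr _; rewrite mulrC ltr_pMr// ltr1n.
- move=> t x tI; rewrite /smooth_covector_field.
  set k' := chart_at M x; have xk' : dom M k' x by exact: (atlas_dom aM).
  set w0 := row_mx _ _.
  have nk' := near_rsubmx_chart t (atlas_near aM xk' xk').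
  have sl : sm (fun y : 'rV[R]_(1 + d) => lsubmx y 0 0) w0 by exact: (smv_lsubmx (smv_id _)).
  have lw : lsubmx w0 0 0 = t by rewrite row_mxKl mxE.
  have sr : smv (fun y : 'rV[R]_(1 + d) => rsubmx y) w0 by exact: (smv_rsubmx (smv_id _)).
  have rw : rsubmx w0 = chart M k' x by rewrite row_mxKr.
  pose T i (y : 'rV[R]_(1 + d)) : 'rV[R]_d := (chi i (lsubmx y 0 0) (chart_inv M k' (rsubmx y)) / S (lsubmx y 0 0)) *:
    (beta i (lsubmx y 0 0) *m (jac M k' (K i) (chart_inv M k' (rsubmx y)))^T).
  have T_sm i : i \in enum_fset D -> smv (T i) w0.
    move=> iD; have iI : t1 <= i <= t2 by exact: DI.
    have [r0 Hr _ _ [_ [p1 p2]]] := Hdata i iI.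
    apply: localized_field_sm => //.
    - by move=> /Hr[].
    - by rewrite gt_eqF// S_gt0.
    - exact: p1.
    - exact: p2.
  apply: (@smv_eq _ _ _ _ (fun y => \sum_(i <- enum_fset D) T i y)); last first.
    under eq_fun do rewrite big_seq.
    by apply: smv_sum => i; exact: T_sm.
  apply: filterS nk' => y [yk' _ yE].
  rewrite /= mulmx_suml; apply: eq_big_seq => i iD.
  rewrite -scalemxAl -mulmxA -trmx_mul.
  have [chi0|chi0] := eqVneq (chi i (lsubmx y 0 0) (chart_inv M k' (rsubmx y))) 0.
    by rewrite /T chi0 mul0r !scale0r.
  have iI : t1 <= i <= t2 by exact: DI.
  have [_ _ _ _ [p0 _]] := Hdata i iI.
  (* A nonzero weight forces the point into the chart [K i], so the cocycle identity applies. *)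
  have yK : dom M (K i) (chart_inv M k' (rsubmx y)).
    by apply: p0; move: chi0; rewrite /chi mulf_eq0 negb_or => /andP[].
  rewrite (jacK aM) //; exact: (atlas_dom aM).
Unshelve. all: by end_near. Qed.

End Gluing.

(** * Dirac structures in coordinates *)

Section TangentMaps.
Context {R : realType}.

Lemma derive_row_mx (V : normedModType R) m n p (f : V -> 'M[R]_(m, n)) (g : V -> 'M[R]_(m, p)) x w :
  smv f x -> smv g x ->
  'D_w (fun y => row_mx (f y) (g y)) x = row_mx ('D_w f x) ('D_w g x).
Proof.
move=> sf sg; have s := smv_row_mx sf sg.
rewrite -[LHS]hsubmxK -(derive_lsubmx w s) -(derive_rsubmx w s).
by congr (row_mx ('D_w _ x) ('D_w _ x)); apply/funext => y; rewrite ?row_mxKl ?row_mxKr.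
Qed.

Lemma tmapE (M N : charted R) (f : M -> N) (x : M) (h : 'rV[R]_(dim M) -> 'rV[R]_(dim N)) w :
  (\forall y \near pcoord x,
     h y = chart N (chart_at N (f x)) (f (chart_inv M (chart_at M x) y))) ->
  smv h (pcoord x) -> tmap f x w = 'D_w h (pcoord x).
Proof.
move=> n sh; rewrite /tmap -deriveE; last exact/smv_differentiable/(smv_eq n sh).
by apply: near_eq_derive; apply: filterS n => y yE; exact: (esym yE).
Qed.

Lemma pair_transp m n (f : {linear 'rV[R]_m -> 'rV[R]_n}) a w :
  pair (transp f a) w = pair a (f w).
Proof. by rewrite transpE -pair_mulr mul_rV_lin1. Qed.

Lemma pair_pull (M N : charted R) (f : M -> N) (x : M) a w :
  pair (pull f x a) w = pair a (tmap f x w).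
Proof. exact: pair_transp. Qed.

End TangentMaps.

Section CotangentProj.
Context {R : realType} (Q : charted R).
Hypothesis aQ : atlas Q.
Notation d := (dim Q).
Notation PQ := (pontryagin Q).

Lemma tmap_cotangent_proj (z : cotangent Q) w :
  tmap (cotangent_proj Q) z w = lsubmx w.
Proof.
pose k := chart_at Q z.1.
have zk : dom Q k z.1 := atlas_dom aQ z.1.
rewrite (@tmapE _ (cotangent Q) Q (cotangent_proj Q) z (@lsubmx R 1 d d)).
- exact: etrans (derive_lsubmx w (smv_id _)) (congr1 _ (derive_id _ _)).
- apply: filterS (atlas_near_comp aQ zk zk (lsubmx_smv (pcoord z)) _) => [y [_ _ yE]|].
    exact: (esym yE).
  by rewrite row_mxKl.
- exact: lsubmx_smv.
Qed.

Lemma dist_liftE (D : distribution Q) (z : cotangent Q) w :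
  dist_lift D z w <-> lsubmx w \in D z.1.
Proof. by rewrite /dist_lift /= tmap_cotangent_proj. Qed.

Lemma pull_cotangent_proj (z : cotangent Q) F :
  pull (cotangent_proj Q) z F = row_mx F 0.
Proof.
apply/eqP; rewrite -subr_eq0; apply/eqP/pair_eq0 => w.
rewrite pairBl pair_pull tmap_cotangent_proj -[w in X in _ - X]hsubmxK pair_row_mx.
by rewrite pair0l addr0 subrr.
Qed.

(** Testing on vertical vectors [row_mx 0 u] gives the equality of the fibre component of [a] with
    dq; testing on [row_mx u 0] with [u] in the distribution gives the annihilator condition. *)
Lemma induced_diracE (D : distribution Q) (z : cotangent Q) v a :
  induced_dirac D z v a <-> [/\ lsubmx v \in D z.1, rsubmx a = lsubmx v &
    forall u, u \in D z.1 -> pair (lsubmx a + rsubmx v) u = 0].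
Proof.
have E w : pair a w - Omega z v w =
    pair (lsubmx a + rsubmx v) (lsubmx w) + pair (rsubmx a - lsubmx v) (rsubmx w).
  rewrite /Omega -[a in LHS]hsubmxK -[w in LHS]hsubmxK !pair_row_mx.
  rewrite pairDl pairBl pairNl; ring.
rewrite /induced_dirac dist_liftE; split=> [[vD H]|[vD av H]]; split=> //.
- apply/eqP; rewrite -subr_eq0; apply/eqP/pair_eq0 => u.
  have := E (row_mx 0 u); rewrite H; last by apply/dist_liftE; rewrite row_mxKl mem0v.
  by rewrite subrr row_mxKl row_mxKr pair0r add0r => <-.
- move=> u uD; have := E (row_mx u 0); rewrite H; last by apply/dist_liftE; rewrite row_mxKl.
  by rewrite subrr row_mxKl row_mxKr pair0r addr0 => <-.
- move=> w /dist_liftE wD; apply/eqP; rewrite -subr_eq0 E H// av subrr pair0l addr0//.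
Qed.

Lemma velocity_cpart (c : R -> PQ) t : smooth_in c (chart_at PQ (c t)) t ->
  velocity (@cpart R Q \o c) t =
  row_mx (velocity (base \o c) t) (rsubmx ('D_1 (chart PQ (chart_at PQ (c t)) \o c) t)).
Proof.
move=> [nc sc]; set k := chart_at PQ (c t); rewrite -/k in nc sc.
have -> : velocity (@cpart R Q \o c) t =
    'D_1 (fun s => row_mx (lsubmx (lsubmx ((chart PQ k \o c) s))) (rsubmx ((chart PQ k \o c) s))) t.
  by congr ('D_1 _ t); apply/funext => s; rewrite /= !row_mxKl row_mxKr.
rewrite derive_row_mx; last 2 first.
- exact/smv_lsubmx/smv_lsubmx.
- exact: smv_rsubmx.
congr row_mx; last exact: (derive_rsubmx _ sc).
by congr ('D_1 _ t); apply/funext => s; rewrite /= !row_mxKl.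
Qed.

Section Equations.
Variable L : tangent Q -> R.

Definition base_partial (z : tangent Q) : 'rV[R]_d :=
  lsubmx (gradient L (chart_at Q z.1) (pcoord z)).

Definition fibre_partial (z : tangent Q) : 'rV[R]_d :=
  rsubmx (gradient L (chart_at Q z.1) (pcoord z)).

Definition momentum_rate (c : R -> PQ) (t : R) : 'rV[R]_d :=
  rsubmx ('D_1 (chart PQ (chart_at PQ (c t)) \o c) t).

(** The forced implicit Lagrange-d'Alembert equations: p = dL/dv, q' = v, and dL/dq - p' + F
    annihilates [D]. The condition that q' lie in [D] is kept apart, because on the variational side
    it is a separate requirement. *)
Definition implicit_lagrange (D : {vspace 'rV[R]_d}) (c : R -> PQ) t F : Prop :=
  [/\ fibre_partial (tpart (c t)) = (c t).2, velocity (base \o c) t = (c t).1.2 &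
      forall u, u \in D -> pair (base_partial (tpart (c t)) - momentum_rate c t + F) u = 0].

Lemma dirac_differentialE z :
  dirac_differential L z = ((z.1, fibre_partial z), row_mx (- base_partial z) z.2).
Proof. by case: z. Qed.

(** The equality of base points in [in_dirac] is the equation p = dL/dv. The horizontal lift of [F]
    affects only the base component of the covector. *)
Lemma induced_dirac_force (D : distribution Q) (c : R -> PQ) t F :
  smooth_in c (chart_at PQ (c t)) t ->
  in_dirac (induced_dirac D) (cpart (c t)) (velocity (@cpart R Q \o c) t)
    (sub_force (dirac_differential L (tpart (c t))) F) <->
  implicit_lagrange (D (base (c t))) c t F /\ velocity (base \o c) t \in D (base (c t)).
Proof.
move=> sc; rewrite dirac_differentialE /in_dirac /sub_force /= pull_cotangent_proj.
rewrite induced_diracE velocity_cpart// !row_mxKl !row_mxKr.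
have -> : row_mx (- base_partial (tpart (c t))) (tpart (c t)).2 - row_mx F 0 =
    row_mx (- base_partial (tpart (c t)) - F) (c t).1.2.
  by rewrite opp_row_mx add_row_mx oppr0 addr0.
rewrite row_mxKl row_mxKr.
have E u : pair (- base_partial (tpart (c t)) - F + momentum_rate c t) u =
    - pair (base_partial (tpart (c t)) - momentum_rate c t + F) u.
  by rewrite -pairNl; congr pair; rewrite !opprD opprK addrAC.
split=> [[[fp]] [vD vq H]|[[fp vq H] vD]].
  split => //; split => //; first by move=> u /H; rewrite E => /eqP; rewrite oppr_eq0 => /eqP.
split; first by rewrite /cpart -fp.
by split => // u /H Hu; rewrite E Hu oppr0.
Qed.

Lemma pointwise_equationsE (D : {vspace 'rV[R]_d}) c t F :
  smooth_in c (chart_at PQ (c t)) t ->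
  pointwise_equations L D (chart_at PQ (c t)) c t F <-> implicit_lagrange D c t F.
Proof.
move=> sc; set k := chart_at PQ (c t); have [_ sc'] := sc.
have J : jac Q k k (base (c t)) = 1%:M by apply: (jac1 aQ); exact: (atlas_dom aQ).
have yE : chart PQ k (c t) = row_mx (row_mx (chart Q k (base (c t))) (c t).1.2) (c t).2.
  by rewrite pontryagin_chartE J trmx1 !mulmx1.
have pE : pcoord (tpart (c t)) = lsubmx (chart PQ k (c t)) by rewrite lsubmx_chart.
have vE : lsubmx (lsubmx ('D_1 (chart PQ k \o c) t)) = velocity (base \o c) t.
  rewrite -(derive_lsubmx _ sc') -derive_lsubmx; last exact: smv_lsubmx.
  by congr ('D_1 _ t); apply/funext => s; rewrite /= !row_mxKl.
have E w : forced_euler_lagrange L k c t F w =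
   pair (base_partial (tpart (c t)) - momentum_rate c t + F) (lsubmx (lsubmx w)) +
   pair (fibre_partial (tpart (c t)) - (c t).2) (rsubmx (lsubmx w)) +
   pair (rsubmx w) (velocity (base \o c) t - (c t).1.2).
  rewrite /forced_euler_lagrange /euler_lagrange /euler_lagrange_form.
  rewrite J trmx1 mulmx1 vE /base_partial /fibre_partial pE -/k.
  have -> : rsubmx (chart PQ k (c t)) = (c t).2 by rewrite yE row_mxKr.
  have -> : rsubmx (lsubmx (chart PQ k (c t))) = (c t).1.2 by rewrite yE row_mxKl row_mxKr.
  rewrite -/(momentum_rate c t) [in RHS]pairDl; ring.
split=> [H|[fp vq H] w u uD].
(* The three blocks of [w] vary independently, which separates the three equations. *)
- have H' a b u : u \in D -> pair (base_partial (tpart (c t)) - momentum_rate c t + F) u +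
      pair (fibre_partial (tpart (c t)) - (c t).2) a +
      pair b (velocity (base \o c) t - (c t).1.2) = 0.
    move=> uD; have := H (row_mx (row_mx u a) b) u uD.
    by rewrite E !row_mxKl !row_mxKr J mulmx1; apply.
  split.
  + apply/eqP; rewrite -subr_eq0; apply/eqP/pair_eq0 => a.
    by have := H' a 0 0 (mem0v _); rewrite pair0l pair0r addr0 add0r.
  + apply/eqP; rewrite -subr_eq0; apply/eqP/pair_eq0 => b.
    by have := H' 0 b 0 (mem0v _); rewrite !pair0r !add0r pairC.
  + by move=> u /(H' 0 0); rewrite pair0l pair0r !addr0.
- by rewrite E J mulmx1 => ->; rewrite H// fp vq !subrr pair0l pair0r !addr0.
Qed.

End Equations.

End CotangentProj.

(** * The interconnected Dirac structure on the cotangent bundle of a product *)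

Section Interconnection.
Context {R : realType} (n : nat) (Q : 'I_n -> charted R).
Hypothesis aQ : forall i, atlas (Q i).
Notation QQ := (prodn Q).
Let aQQ := atlas_prodn aQ.

(** Regroups (q, p) into the pairs (q_i, p_i). It is the tangent map of [cotangent_prod] in
    preferred charts, by [tmap_cotangent_prod]. *)
Definition interleave (y : 'rV[R]_(dim QQ + dim QQ)) : 'rV[R]_(\sum_i dim (cotangent (Q i))) :=
  \mxrow_i row_mx (submxrow (lsubmx y) i) (submxrow (rsubmx y) i).

Lemma pair_interleave a w : pair (interleave a) (interleave w) = pair a w.
Proof.
rewrite -[a in RHS]hsubmxK -[w in RHS]hsubmxK pair_row_mx !pair_submxrow -big_split /=.
by apply: eq_bigr => i _; rewrite !mxrowK pair_row_mx.
Qed.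

Lemma interleave_smv y : smv interleave y.
Proof.
apply: smv_mxrow => i; apply: smv_row_mx; apply: smv_submxrow.
  exact: lsubmx_smv.
exact: rsubmx_smv.
Qed.

Lemma derive_interleave w y : 'D_w interleave y = interleave w.
Proof.
rewrite -[LHS]submxrowK; apply: eq_mxrow => i.
rewrite derive_submxrow; last exact: interleave_smv.
under eq_fun do rewrite mxrowK.
rewrite derive_row_mx; last 2 first.
- by apply: smv_submxrow; exact: lsubmx_smv.
- by apply: smv_submxrow; exact: rsubmx_smv.
rewrite -derive_submxrow; last exact: lsubmx_smv.
rewrite -derive_submxrow; last exact: rsubmx_smv.
rewrite (derive_lsubmx w (smv_id y)) (derive_rsubmx w (smv_id y)).
by have -> : 'D_w id y = w by exact: derive_id.
Qed.

Lemma tmap_cotangent_prod z w : tmap (cotangent_prod Q) z w = interleave w.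
Proof.
pose k := chart_at QQ z.1.
have zk : dom QQ k z.1 := atlas_dom aQQ z.1.
rewrite (@tmapE _ (cotangent QQ) (prodn (fun i => cotangent (Q i))) _ z interleave).
- exact: derive_interleave.
- have hE : lsubmx (pcoord z) = chart QQ k z.1 by rewrite row_mxKl.
  apply: filterS (atlas_near_comp aQQ zk zk (lsubmx_smv (pcoord z)) hE) => y [yk _ yE].
  apply: eq_mxrow => i.
  set x := chart_inv QQ k (lsubmx y) in yk yE *.
  have yE' : submxrow (chart QQ k x) i = submxrow (lsubmx y) i by rewrite yE.
  rewrite /= mxrowK in yE'.
  change (row_mx (submxrow (lsubmx y) i) (submxrow (rsubmx y) i) =
    row_mx (chart (Q i) (k i) (x i)) (transp (tchange (k i) (chart_at (Q i) (x i)) (x i))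
      (submxrow (transp (tchange (chart_at QQ x) k x) (rsubmx y)) i))).
  rewrite transp_tchange.
  have -> : submxrow (transp (tchange (chart_at QQ x) k x) (rsubmx y)) i =
      submxrow (rsubmx y) i *m (jac (Q i) (chart_at (Q i) (x i)) (k i) (x i))^T.
    rewrite transp_tchange (submxrow_jacT aQ)//; exact: (atlas_dom aQQ).
  rewrite -mulmxA -trmx_mul (jac_mulV (aQ i)) ?trmx1 ?mulmx1; last 2 first.
    exact: yk.
    exact: (atlas_dom (aQ i)).
  by congr row_mx; exact: (esym yE').
- exact: interleave_smv.
Qed.

(** [linfun] applied to a bare function computes as that function only once it is known to be
    linear. *)
Lemma linfun_submxrow i (w : 'rV[R]_(dim QQ)) :
  linfun (fun w : 'rV[R]_(dim QQ) => submxrow w i) w = submxrow w i.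
Proof.
pose g (w : 'rV[R]_(dim QQ)) : 'rV[R]_(dim (Q i)) := submxrow w i.
have lg : linear g by move=> a u v; apply/rowP => j; rewrite !mxE.
pose f : {linear 'rV[R]_(dim QQ) -> 'rV[R]_(dim (Q i))} :=
  HB.pack g (GRing.isLinear.Build _ _ _ _ g lg).
exact: (lfunE f).
Qed.

Lemma mem_dist_sum (D : forall i, distribution (Q i)) (x : QQ) w :
  (w \in dist_sum D x) <-> forall i, submxrow w i \in D i (x i).
Proof.
rewrite /dist_sum memvE; split.
  move=> /subv_bigcapP H i.
  by move: (H i isT); rewrite -memvE -memv_preim linfun_submxrow.
by move=> H; apply/subv_bigcapP => i _; rewrite -memvE -memv_preim linfun_submxrow; exact: H.
Qed.

Lemma ann_dist_sum (D : forall i, distribution (Q i)) (x : QQ) a :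
  (forall u, u \in dist_sum D x -> pair a u = 0) <->
  forall i u, u \in D i (x i) -> pair (submxrow a i) u = 0.
Proof.
split=> [H i u uD|H u /mem_dist_sum uD]; last first.
  by rewrite pair_submxrow; apply: big1 => i _; exact: H (uD i).
(* The vector equal to [u] in block [i] and zero elsewhere; the cast adjusts the dependent block
   size. *)
pose w : 'rV[R]_(dim QQ) := \mxrow_j (if j =P i is ReflectT ji then
   castmx (erefl, congr1 (fun j => dim (Q j)) (esym ji)) u else 0).
have wi : submxrow w i = u.
  rewrite mxrowK; case: eqP => // ii.
  by rewrite (eq_irrelevance (congr1 _ _) erefl) castmx_id.
have wj j : j != i -> submxrow w j = 0 by move=> ji; rewrite mxrowK; case: eqP ji.
have := H w; rewrite pair_submxrow (bigD1 i)//= wi.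
have -> : \sum_(j | j != i) pair (submxrow a j) (submxrow w j) = 0.
  by apply: big1 => j ji; rewrite wj// pair0r.
rewrite addr0; apply; apply/mem_dist_sum => j; have [->|ji] := eqVneq j i; first by rewrite wi.
by rewrite wj// mem0v.
Qed.

(** The intermediate covector of the tensor product annihilates the lift of [S], which contains all
    vertical vectors. It is therefore horizontal, the lift of some [- F] with [F] annihilating
    [S]. *)
Lemma interconnected_diracE (D : forall i, distribution (Q i)) (S : distribution QQ)
    (z : cotangent QQ) v a :
  interconnected_dirac D S z v a <-> lsubmx v \in S z.1 /\
  exists2 F, ann [set` S z.1] F &
    induced_dirac (dist_sum D) z v (a - row_mx F 0).
Proof.
split.
  move=> [b [[b' [Hb' ab]]] [/(dist_liftE aQQ) vS bS]]; split => //.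
  have r0 : rsubmx b = 0.
    apply/pair_eq0 => w; have := bS (row_mx 0 w); rewrite -[- b]hsubmxK pair_row_mx pair0r add0r.
    have -> : rsubmx (- b) = - rsubmx b by rewrite linearN.
    rewrite pairNl => H; apply/eqP; rewrite -oppr_eq0; apply/eqP/H.
    by apply/(dist_liftE aQQ); rewrite row_mxKl mem0v.
  exists (- lsubmx b).
    move=> u uS; have := bS (row_mx u 0); rewrite -[- b]hsubmxK pair_row_mx pair0r addr0.
    have -> : lsubmx (- b) = - lsubmx b by rewrite linearN.
    by apply; apply/(dist_liftE aQQ); rewrite row_mxKl.
  have -> : a - row_mx (- lsubmx b) 0 = a + b.
    by rewrite opp_row_mx opprK oppr0 -r0 hsubmxK.
  rewrite ab; split.
    apply/(dist_liftE aQQ)/mem_dist_sum => i; have [/(dist_liftE (aQ i))] := Hb' i.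
    by rewrite tmap_cotangent_prod mxrowK row_mxKl.
  move=> w /(dist_liftE aQQ)/mem_dist_sum wD.
  rewrite pair_pull tmap_cotangent_prod pair_submxrow.
  rewrite (_ : Omega z v w = pair (interleave (row_mx (- rsubmx v) (lsubmx v))) (interleave w)); last first.
    by rewrite pair_interleave.
  rewrite pair_submxrow; apply: eq_bigr => i _; have [_ ->] := Hb' i; last first.
    by apply/(dist_liftE (aQ i)); rewrite mxrowK row_mxKl.
  rewrite /Omega tmap_cotangent_prod !mxrowK !row_mxKl !row_mxKr.
  by congr (pair (row_mx _ _) _); apply/rowP => j; rewrite !mxE.
move=> [vS [F FS /(induced_diracE aQQ)[vD av H]]].
exists (- row_mx F 0); split; last first.
  split; first exact/(dist_liftE aQQ).
  move=> w /(dist_liftE aQQ) wS; rewrite opprK -[w]hsubmxK pair_row_mx pair0l addr0.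
  exact: FS.
set a' := a - row_mx F 0 in av H *.
(* [interleave] preserves the pairing, so this is the covector whose pull-back is [a']. *)
exists (interleave a'); split; last first.
  apply/eqP; rewrite -subr_eq0; apply/eqP/pair_eq0 => w.
  by rewrite pairBl pair_pull tmap_cotangent_prod pair_interleave subrr.
move=> i; apply/(induced_diracE (aQ i)).
rewrite tmap_cotangent_prod !mxrowK !row_mxKl !row_mxKr.
have /mem_dist_sum vD' := vD.
split; [exact: vD'|by rewrite av|].
move=> u uD.
have := (ann_dist_sum _ _ _).1 H i u uD.
by congr (pair _ _ = 0); apply/rowP => j; rewrite !mxE.
Qed.

End Interconnection.

(** * Products *)

Section Splitting.
Context {R : realType} (n : nat) (Q : 'I_n -> charted R).
Hypothesis aQ : forall i, atlas (Q i).
Notation QQ := (prodn Q).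
Notation d := (dim QQ).
Notation PQQ := (pontryagin QQ).
Let aQQ := atlas_prodn aQ.

Definition tangent_slice i (y : 'rV[R]_(d + d)) : 'rV[R]_(dim (Q i) + dim (Q i)) :=
  row_mx (submxrow (lsubmx y) i) (submxrow (rsubmx y) i).

Definition pontryagin_slice i (y : 'rV[R]_(d + d + d)) :
    'rV[R]_(dim (Q i) + dim (Q i) + dim (Q i)) :=
  row_mx (tangent_slice i (lsubmx y)) (submxrow (rsubmx y) i).

Lemma tangent_slice_smv (V : normedModType R) (f : V -> 'rV[R]_(d + d)) x i : smv f x ->
  smv (fun y => tangent_slice i (f y)) x.
Proof.
move=> sf; apply: smv_row_mx; apply: smv_submxrow.
  exact: smv_lsubmx.
exact: smv_rsubmx.
Qed.

Lemma derive_tangent_slice (V : normedModType R) (f : V -> 'rV[R]_(d + d)) x i w : smv f x ->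
  'D_w (fun y => tangent_slice i (f y)) x = tangent_slice i ('D_w f x).
Proof.
move=> sf; rewrite derive_row_mx; last 2 first.
- by apply: smv_submxrow; exact: smv_lsubmx.
- by apply: smv_submxrow; exact: smv_rsubmx.
rewrite -derive_submxrow; last exact: smv_lsubmx.
rewrite -derive_submxrow; last exact: smv_rsubmx.
by rewrite (derive_lsubmx w sf) (derive_rsubmx w sf).
Qed.

Lemma tangent_slice_chart k (z : tangent QQ) i : dom QQ k z.1 ->
  tangent_slice i (chart (tangent QQ) k z) = chart (tangent (Q i)) (k i) (tangent_comp z i).
Proof.
move=> zk; rewrite !tangent_chartE /tangent_slice row_mxKl row_mxKr.
rewrite (submxrow_jac aQ)//; last exact: (atlas_dom aQQ).
by rewrite /= mxrowK.
Qed.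

Lemma tangent_comp_inv k y i : dom QQ k (chart_inv QQ k (lsubmx y)) ->
  tangent_comp (chart_inv (tangent QQ) k y) i = chart_inv (tangent (Q i)) (k i) (tangent_slice i y).
Proof.
move=> yk; rewrite !tangent_invE /tangent_comp /tangent_slice row_mxKl row_mxKr.
rewrite (submxrow_jac aQ)//; exact: (atlas_dom aQQ).
Qed.

Lemma pontryagin_slice_chart k (z : PQQ) i : dom QQ k (base z) ->
  pontryagin_slice i (chart PQQ k z) = chart (pontryagin (Q i)) (k i) (pontryagin_comp Q i z).
Proof.
move=> zk; rewrite /pontryagin_slice lsubmx_chart tangent_slice_chart//.
rewrite -[RHS]hsubmxK lsubmx_chart !mom_chart.
rewrite (submxrow_jacT aQ)//; exact: (atlas_dom aQQ).
Qed.

Lemma smooth_in_comp (V : normedModType R) (c : V -> PQQ) k x i : smooth_in c k x ->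
  smooth_in (pontryagin_comp Q i \o c) (k i) x.
Proof.
move=> [nc sc]; split; first by apply: filterS nc => y yk; exact: yk i.
apply: (@smv_eq _ _ _ _ (fun y => pontryagin_slice i ((chart PQQ k \o c) y))).
  by apply: filterS nc => y yk; rewrite pontryagin_slice_chart.
apply: smv_row_mx; first by apply: tangent_slice_smv; exact: smv_lsubmx.
by apply: smv_submxrow; exact: smv_rsubmx.
Qed.

Section LagrangianSum.
Variable L : forall i, tangent (Q i) -> R.
Arguments L : clear implicits.
Hypothesis sL : forall i, smooth_lagrangian (L i).
Arguments sL : clear implicits.
Notation LQ := (lagrangian_sum L).

Lemma near_local_lagrangian_sum k (z : tangent QQ) : dom QQ k z.1 ->
  \forall y \near chart (tangent QQ) k z,
    \sum_i local_lagrangian (L i) (k i) (tangent_slice i y) = local_lagrangian LQ k y.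
Proof.
move=> zk; have hE : lsubmx (chart (tangent QQ) k z) = chart QQ k z.1 by rewrite row_mxKl.
apply: filterS (atlas_near_comp aQQ zk zk (lsubmx_smv _) hE) => y [yk _ _].
by apply: eq_bigr => i _; exact: (esym (congr1 (L i) (tangent_comp_inv i yk))).
Qed.

Lemma local_lagrangian_slice_sm k (z : tangent QQ) i : dom QQ k z.1 ->
  sm (fun y => local_lagrangian (L i) (k i) (tangent_slice i y)) (chart (tangent QQ) k z).
Proof.
move=> zk; apply: (@sm_comp _ _ _ (tangent_slice i) (local_lagrangian (L i) (k i))).
  by apply: tangent_slice_smv; exact: smv_id.
rewrite (tangent_slice_chart i zk).
exact (@local_lagrangian_sm _ _ (aQ i) _ (sL i) (k i) (tangent_comp z i) (zk i)).
Qed.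

Lemma smooth_lagrangian_sum : smooth_lagrangian LQ.
Proof.
move=> z; have zk : dom QQ (chart_at QQ z.1) z.1 := atlas_dom aQQ z.1.
split; first exact: filterT.
apply/Coo_atP => i j.
rewrite (_ : (fun y => _) = local_lagrangian LQ (chart_at QQ z.1)); last first.
  by apply/funext => y; rewrite /= mxE.
apply: sm_eq (near_local_lagrangian_sum zk) _.
by apply: sm_sum => l _; exact: local_lagrangian_slice_sm.
Qed.

(** In a product chart each local Lagrangian depends on its own slice only, so its derivative sees
    only that slice of the direction. *)
Lemma gradient_sum k (z : tangent QQ) i : dom QQ k z.1 ->
  tangent_slice i (gradient LQ k (chart (tangent QQ) k z)) =
  gradient (L i) (k i) (chart (tangent (Q i)) (k i) (tangent_comp z i)).
Proof.
move=> zk; set Y := chart (tangent QQ) k z.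
pose g l := gradient (L l) (k l) (chart (tangent (Q l)) (k l) (tangent_comp z l)).
suff -> : gradient LQ k Y = row_mx (\mxrow_l lsubmx (g l)) (\mxrow_l rsubmx (g l)).
  by rewrite /tangent_slice row_mxKl row_mxKr !mxrowK hsubmxK.
apply/eqP; rewrite -subr_eq0; apply/eqP/pair_eq0 => w; rewrite pairBl.
rewrite -(derive_local_lagrangian aQQ smooth_lagrangian_sum _ zk).
rewrite -(near_eq_derive _ (near_local_lagrangian_sum zk)).
have -> : (fun y => \sum_l local_lagrangian (L l) (k l) (tangent_slice l y)) =
    \sum_l (fun y => local_lagrangian (L l) (k l) (tangent_slice l y)).
  by apply/funext => y; rewrite fct_sumE.
rewrite derive_sum; last by move=> l; apply: sm_derivable; exact: local_lagrangian_slice_sm.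
have -> : pair (row_mx (\mxrow_l lsubmx (g l)) (\mxrow_l rsubmx (g l))) w =
    \sum_l pair (g l) (tangent_slice l w).
  rewrite -[w in LHS]hsubmxK pair_row_mx !pair_submxrow -big_split.
  by apply: eq_bigr => l _; rewrite /= !mxrowK -pair_row_mx hsubmxK.
rewrite -sumrB big1// => l _.
rewrite (_ : 'D_w _ _ = 'D_w (local_lagrangian (L l) (k l) \o tangent_slice l) Y)//.
have sT := tangent_slice_smv (i := l) (smv_id Y).
have TY : tangent_slice l Y = chart (tangent (Q l)) (k l) (tangent_comp z l).
  exact: tangent_slice_chart.
have zl : dom (Q l) (k l) (tangent_comp z l).1 := zk l.
rewrite derive_comp; last 2 first.
- exact: smv_differentiable.
- by rewrite TY; apply: sm_differentiable; exact: (local_lagrangian_sm (aQ l) (sL l) zl).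
rewrite (derive_tangent_slice l w (smv_id Y)) TY.
rewrite (derive_local_lagrangian (aQ l) (sL l) _ zl).
have -> : 'D_w id Y = w by exact: derive_id.
by rewrite subrr.
Qed.

Lemma base_partial_sum (z : tangent QQ) i :
  submxrow (base_partial LQ z) i = base_partial (L i) (tangent_comp z i).
Proof.
have := gradient_sum i (atlas_dom aQQ z.1); move/(congr1 (@lsubmx _ _ _ _)).
by rewrite row_mxKl.
Qed.

Lemma fibre_partial_sum (z : tangent QQ) i :
  submxrow (fibre_partial LQ z) i = fibre_partial (L i) (tangent_comp z i).
Proof.
have := gradient_sum i (atlas_dom aQQ z.1); move/(congr1 (@rsubmx _ _ _ _)).
by rewrite row_mxKr.
Qed.

Section Curve.
Variables (c : R -> PQQ) (t : R).
Hypothesis sc : smooth_in c (chart_at PQQ (c t)) t.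
Notation ci i := (pontryagin_comp Q i \o c).

Lemma velocity_comp i : submxrow (velocity (base \o c) t) i = velocity (base \o ci i) t.
Proof.
have [_ sb] := smooth_in_base sc.
rewrite /velocity derive_submxrow//.
by congr ('D_1 _ t); apply/funext => s; rewrite /= mxrowK.
Qed.

Lemma momentum_rate_comp i : submxrow (momentum_rate c t) i = momentum_rate (ci i) t.
Proof.
have [nc sc'] := sc; set k := chart_at PQQ (c t) in nc sc' *.
have sr : smv (fun s => rsubmx ((chart PQQ k \o c) s)) t by exact: smv_rsubmx.
have [_ sci] := smooth_in_comp i sc.
rewrite /momentum_rate -(derive_rsubmx _ sc') (derive_submxrow _ _ sr).
rewrite -(derive_rsubmx _ sci).
apply: near_eq_derive; apply: filterS nc => s sk.
apply: (etrans _ (congr1 (@rsubmx _ _ _ _) (pontryagin_slice_chart i sk))).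
exact: (esym (row_mxKr _ _)).
Qed.

Lemma implicit_lagrange_split (D : forall i, distribution (Q i)) F :
  implicit_lagrange LQ (dist_sum D (base (c t))) c t F <->
  forall i, implicit_lagrange (L i) (D i (base (ci i t))) (ci i) t (submxrow F i).
Proof.
split=> [[fp vq H] i|H].
- split.
  + by rewrite -[RHS](congr1 (fun a => submxrow a i) fp) fibre_partial_sum.
  + by rewrite -velocity_comp vq.
  + move=> u uD; have := (ann_dist_sum _ _ _).1 H i u uD.
    by rewrite submxrowD submxrowB base_partial_sum momentum_rate_comp.
- split.
  + apply/mxrowP => i; rewrite fibre_partial_sum; by have [] := H i.
  + by apply/mxrowP => i; rewrite velocity_comp; have [] := H i.
  + apply/ann_dist_sum => i u uD; have [_ _ Hi] := H i.
    by rewrite submxrowD submxrowB base_partial_sum momentum_rate_comp; exact: Hi.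
Qed.

End Curve.

End LagrangianSum.

End Splitting.

(** * Frames of distributions along a curve *)

Section BlockDiagonal.
Context {R : realType} (n : nat) (m d : 'I_n -> nat).

(* [\mxdiag] only takes square blocks. *)
Definition block_diag (A : forall i, 'M[R]_(m i, d i)) : 'M[R]_(\sum_i m i, \sum_i d i) :=
  \mxcol_i (A i *m submxcol 1%:M i).

Lemma submxrow_mul_block_diag (A : forall i, 'M[R]_(m i, d i)) (v : 'rV[R]_(\sum_i m i)) i :
  submxrow (v *m block_diag A) i = submxrow v i *m A i.
Proof.
have -> : v *m block_diag A = \mxrow_j (submxrow v j *m A j); last by rewrite mxrowK.
rewrite /block_diag -{1}[v]submxrowK mul_mxrow_mxcol.
rewrite (eq_bigr (fun j => submxrow v j *m A j *m submxcol 1%:M j)); last first.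
  by move=> j _; rewrite mulmxA.
by rewrite -mul_mxrow_mxcol submxcolK mulmx1.
Qed.

Lemma row_free_block_diag (A : forall i, 'M[R]_(m i, d i)) :
  (forall i, row_free (A i)) -> row_free (block_diag A).
Proof.
move=> fA; apply: inj_row_free => v v0; rewrite -[v]submxrowK -[0]submxrowK.
apply: eq_mxrow => i; rewrite submxrow0; apply: (row_free_inj (fA i)).
by rewrite -submxrow_mul_block_diag v0 submxrow0 mul0mx.
Qed.

Lemma submx_block_diag (A : forall i, 'M[R]_(m i, d i)) (w : 'rV[R]_(\sum_i d i)) :
  (w <= block_diag A)%MS <-> forall i, (submxrow w i <= A i)%MS.
Proof.
split=> [/submxP[v ->] i|H]; first by rewrite submxrow_mul_block_diag submxMl.
apply/submxP; exists (\mxrow_i (submxrow w i *m pinvmx (A i))).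
by apply/mxrowP => i; rewrite submxrow_mul_block_diag mxrowK mulmxKpV.
Qed.

Lemma block_diag_smv (V : normedModType R) (A : forall i, V -> 'M[R]_(m i, d i)) x :
  (forall i, smv (A i) x) -> smv (fun y => block_diag (fun i => A i y)) x.
Proof.
move=> sA a b; under eq_fun do rewrite mxE.
by apply: smv_mul; [exact: sA|exact: smv_cst].
Qed.

End BlockDiagonal.

Section Frames.
Context {R : realType}.

Lemma basis_row_span d m (U : {vspace 'rV[R]_d}) (X : 'I_m -> 'rV[R]_d) :
  basis_of U [tuple X j | j < m] -> row_free (\matrix_j X j) /\
    forall u, (u <= \matrix_j X j)%MS = (u \in U).
Proof.
move=> bX; set A := \matrix_j X j; set T := [tuple X j | j < m].
have E (v : 'rV[R]_m) : v *m A = \sum_j v 0 j *: T`_j.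
  rewrite mulmx_sum_row; apply: eq_bigr => j _.
  by rewrite rowK -tnth_nth tnth_mktuple.
split.
  apply: inj_row_free => v; rewrite E => v0; apply/rowP => j; rewrite mxE.
  by have /freeP/(_ (fun j => v 0 j) v0) := basis_free bX.
move=> u; apply/idP/idP.
  move=> /submxP[v ->]; rewrite E; apply: memv_suml => j _; apply: memvZ.
  by rewrite -(span_basis bX); apply: memv_span; rewrite -tnth_nth mem_tnth.
rewrite -(span_basis bX) => /coord_span uE.
by apply/submxP; exists (\row_j coord T j u); rewrite E [LHS]uE; apply: eq_bigr => j _; rewrite mxE.
Qed.

(** In the applications [J] is the Jacobian to the chart in which [A] is written. Undoing it makes
    the row space of [A] that of a basis matrix of [U]. *)
Lemma dim_row_span d m (U : {vspace 'rV[R]_d}) (A : 'M[R]_(m, d)) (J : 'M[R]_d) :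
  J \in unitmx -> (forall u, (u *m J <= A)%MS = (u \in U)) -> \dim U = \rank A.
Proof.
move=> uJ AU; have fJ : row_free J by rewrite row_free_unit.
have bU := vbasisP U.
have [|fB BU] := @basis_row_span _ _ U (fun j => tnth (vbasis U) j).
  rewrite (_ : [tuple _ | _ < _] = vbasis U)//; apply/eq_from_tnth => j.
  by rewrite tnth_mktuple.
set B := \matrix_j tnth (vbasis U) j in fB BU.
rewrite -(mxrankMfree A (_ : row_free (invmx J))); last by rewrite row_free_unit unitmx_inv.
have AJ (u : 'rV[R]_d) : (u <= A *m invmx J)%MS = (u <= B)%MS.
  by rewrite BU -AU -(submxMfree u (A *m invmx J) fJ) mulmxKV.
have AB : (A *m invmx J == B)%MS.
  by apply/andP; split; apply/rV_subP => u; rewrite AJ.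
by rewrite (eqmx_rank AB); move: fB; rewrite /row_free => /eqP.
Qed.

Section Along.
Variables (M : charted R) (aM : atlas M).

Lemma jac_unit i j (x : M) : dom M i x -> dom M j x -> jac M i j x \in unitmx.
Proof. by move=> xi xj; have [] := mulmx1_unit (jac_mulV aM xi xj). Qed.

Lemma near_pt_along (q : R -> M) k t (P : set M) : smooth_in q k t -> near_pt (q t) P ->
  \forall s \near t, P (q s).
Proof.
move=> qk nP; have [np sp] := smooth_in_chart aM qk (atlas_dom aM (q t)).
have n : \forall s \near t, P (chart_inv M (chart_at M (q t)) (chart M (chart_at M (q t)) (q s))).
  exact: smv_continuous sp _ nP.
by apply: filterS2 np n => s sq; rewrite (atlasK aM sq).
Qed.

(** The rows of [A s] are a basis of the distribution at [q s], written in the fixed chart [k] so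
    that they can depend smoothly on time. *)
Definition frame_along (D : distribution M) k (q : R -> M) m (A : R -> 'M[R]_(m, dim M)) t : Prop :=
  smv A t /\ \forall s \near t, row_free (A s) /\
    forall u, (u *m jac M (chart_at M (q s)) k (q s) <= A s)%MS = (u \in D (q s)).

Lemma distribution_frame (D : distribution M) k q t : smooth_distribution D ->
  smooth_in q k t -> exists m (A : R -> 'M[R]_(m, dim M)), frame_along D k q A t.
Proof.
move=> sD qk; have [m [X [sX nX]]] := sD (q t).
set p := chart_at M (q t); have tp : dom M p (q t) := atlas_dom aM (q t).
have [np sp] := smooth_in_chart aM qk tp; have [nk _] := qk.
have tk : dom M k (q t) := smooth_in_dom qk.
pose h j (y : 'rV[R]_(dim M)) := rsubmx (chart (tangent M) p (chart_inv M p y, X j (chart_inv M p y))).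
have sh j : smv (h j) (chart M p (q t)).
  by have [_ /Coo_atP H] := sX j; exact: smv_rsubmx H.
exists m, (fun s => \matrix_j (X j (q s) *m jac M (chart_at M (q s)) k (q s))); split.
  apply: (@smv_eq _ _ _ _ (fun s => \matrix_j (h j (chart M p (q s)) *m
      jac M p k (chart_inv M p (chart M p (q s)))))).
    apply: filterS2 np nk => s sp' sk; apply/row_matrixP => j; rewrite !rowK /h.
    rewrite (atlasK aM sp') tangent_chartE row_mxKr -mulmxA (jacK aM)//.
    exact: (atlas_dom aM).
  move=> a b; under eq_fun do rewrite mxE.
  apply: smv_mul.
    exact: (@smv_comp _ _ _ _ _ (chart M p \o q) (h a)).
  apply: (@smv_comp _ _ _ _ _ (chart M p \o q) (fun y => jac M p k (chart_inv M p y))) => //.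
  exact: jac_smv.
apply: filterS2 nk (near_pt_along qk nX) => s sk bX.
have sq : dom M (chart_at M (q s)) (q s) := atlas_dom aM (q s).
have [fB BU] := basis_row_span bX.
have fJ : row_free (jac M (chart_at M (q s)) k (q s)) by rewrite row_free_unit jac_unit.
have -> : \matrix_j (X j (q s) *m jac M (chart_at M (q s)) k (q s)) =
    \matrix_j X j (q s) *m jac M (chart_at M (q s)) k (q s).
  by apply/row_matrixP => j; rewrite rowK row_mul rowK.
split; first by rewrite /row_free mxrankMfree.
by move=> u; rewrite submxMfree.
Qed.

(** Extends a vector at time [t] by keeping its coefficients in the frame constant. *)
Lemma frame_section (D : distribution M) k q m (A : R -> 'M[R]_(m, dim M)) t u :
  smooth_in q k t -> frame_along D k q A t -> u \in D (q t) ->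
  exists X : R -> 'rV[R]_(dim M), [/\ smv X t,
    X t = u *m jac M (chart_at M (q t)) k (q t) &
    \forall s \near t, exists2 u', u' \in D (q s) &
      X s = u' *m jac M (chart_at M (q s)) k (q s)].
Proof.
move=> [nk _] [sA nA] uD.
have [_ At] := nbhs_singleton nA.
have /submxP[z zE] : (u *m jac M (chart_at M (q t)) k (q t) <= A t)%MS by rewrite At.
exists (fun s => z *m A s); split => //.
  by apply: smv_mul => //; exact: smv_cst.
apply: filterS2 nk nA => s sk [_ As].
have sq : dom M (chart_at M (q s)) (q s) := atlas_dom aM (q s).
have E : z *m A s *m jac M k (chart_at M (q s)) (q s) *m jac M (chart_at M (q s)) k (q s) = z *m A s.
  by rewrite -mulmxA (jac_mulV aM)// mulmx1.
exists (z *m A s *m jac M k (chart_at M (q s)) (q s)) => //.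
by rewrite -As E submxMl.
Qed.

(** The rank of the stacked frames is the dimension of the sum of the two distributions, that is,
    [m + l] minus the dimension of the intersection, which clean intersection makes locally
    constant. Then [smooth_ginv] applies. *)
Lemma intersection_ginv (D E : distribution M) k q m l (A : R -> 'M[R]_(m, dim M))
    (B : R -> 'M[R]_(l, dim M)) t :
  smooth_in q k t -> intersect_cleanly D E ->
  frame_along D k q A t -> frame_along E k q B t ->
  exists2 W : R -> 'M[R]_(dim M, m + l), smv W t &
    \forall s \near t, col_mx (A s) (B s) *m W s *m col_mx (A s) (B s) = col_mx (A s) (B s).
Proof.
move=> qk cl [sA nA] [sB nB]; have [nk _] := qk.
have nC := near_pt_along qk (cl (q t)).
have rk s : dom M k (q s) -> row_free (A s) /\
    (forall u, (u *m jac M (chart_at M (q s)) k (q s) <= A s)%MS = (u \in D (q s))) ->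
    row_free (B s) /\
    (forall u, (u *m jac M (chart_at M (q s)) k (q s) <= B s)%MS = (u \in E (q s))) ->
    (\rank (col_mx (A s) (B s)) + \dim (dist_cap D E (q s)) = m + l)%N.
  move=> sk [fA AD] [fB BE].
  have uJ := jac_unit (atlas_dom aM (q s)) sk.
  have fJ : row_free (jac M (chart_at M (q s)) k (q s)) by rewrite row_free_unit.
  have dD : \dim (D (q s)) = m by rewrite (dim_row_span uJ AD); apply/eqP.
  have dE : \dim (E (q s)) = l by rewrite (dim_row_span uJ BE); apply/eqP.
  transitivity (\dim (D (q s)) + \dim (E (q s)))%N; last by rewrite dD dE.
  rewrite -dimv_sum_cap; congr (_ + _)%N; apply/esym/(dim_row_span uJ) => u.
  rewrite -addsmxE; apply/idP/idP.
    move=> /sub_addsmxP[[a b] /= uE].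
    have V : invmx (jac M (chart_at M (q s)) k (q s)) *m jac M (chart_at M (q s)) k (q s) = 1%:M.
      exact: mulVmx.
    have -> : u = a *m A s *m invmx (jac M (chart_at M (q s)) k (q s)) +
        b *m B s *m invmx (jac M (chart_at M (q s)) k (q s)).
      by rewrite -mulmxDl -uE mulmxK.
    apply: memv_add.
      by rewrite -AD mulmxKV// submxMl.
    by rewrite -BE mulmxKV// submxMl.
  move=> /memv_addP[a aD [b bE ->]]; rewrite mulmxDl.
  by apply: addmx_sub_adds; rewrite ?AD ?BE.
apply: smooth_ginv; first exact: smv_col_mx.
have rt := rk t (nbhs_singleton nk) (nbhs_singleton nA) (nbhs_singleton nB).
near=> s.
have rs : (\rank (col_mx (A s) (B s)) + \dim (dist_cap D E (q s)) = m + l)%N.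
  by apply: rk; near: s.
have cs : \dim (dist_cap D E (q s)) = \dim (dist_cap D E (q t)) by near: s.
by apply/eqP; rewrite -(eqn_add2r (\dim (dist_cap D E (q t)))) rt -{1}cs rs.
Unshelve. all: by end_near. Qed.

End Along.

Section Product.
Context (n : nat) (Q : 'I_n -> charted R).
Hypothesis aQ : forall i, atlas (Q i).
Notation QQ := (prodn Q).

Lemma smooth_in_prodn (V : normedModType R) (q : V -> QQ) k x i : smooth_in q k x ->
  smooth_in (fun y => q y i) (k i) x.
Proof.
move=> [nq sq]; split; first by apply: filterS nq => y yk; exact: yk i.
apply: (@smv_eq _ _ _ _ (fun y => submxrow ((chart QQ k \o q) y) i)).
  by apply: nearW => y; rewrite /= mxrowK.
exact: smv_submxrow.
Qed.

Lemma dist_sum_frame (D : forall i, distribution (Q i)) k (q : R -> QQ) t :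
  (forall i, smooth_distribution (D i)) -> smooth_in q k t ->
  exists m (A : R -> 'M[R]_(m, dim QQ)), frame_along (dist_sum D) k q A t.
Proof.
move=> sD qk; have [nk _] := qk.
(* The number of rows depends on [i], so the sizes and the frames are extracted together as
   dependent families. *)
have H i := cid (distribution_frame (aQ i) (@sD i) (smooth_in_prodn i qk)).
pose m i := projT1 (H i); pose A i := projT1 (cid (projT2 (H i))).
have HA i : frame_along (D i) (k i) (fun s => q s i) (A i) t := projT2 (cid (projT2 (H i))).
exists (\sum_i m i)%N, (fun s => block_diag (fun i => A i s)); split.
  by apply: block_diag_smv => i; have [] := HA i.
have nA : \forall s \near t, forall i, row_free (A i s) /\
    forall u, (u *m jac (Q i) (chart_at (Q i) (q s i)) (k i) (q s i) <= A i s)%MS = (u \in D i (q s i)).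
  have nAi i : \forall s \near t, row_free (A i s) /\
      forall u, (u *m jac (Q i) (chart_at (Q i) (q s i)) (k i) (q s i) <= A i s)%MS = (u \in D i (q s i)).
    by have [] := HA i.
  exact: filter_forall nAi.
apply: filterS2 nk nA => s sk As; split; first by apply: row_free_block_diag => i; have [] := As i.
move=> u; have sq : dom QQ (chart_at QQ (q s)) (q s) := atlas_dom (atlas_prodn aQ) (q s).
apply/idP/idP.
  move=> /submx_block_diag H'; apply/mem_dist_sum => i; have [_ <-] := As i.
  by have := H' i; rewrite (submxrow_jac aQ).
move=> /mem_dist_sum uD; apply/submx_block_diag => i.
by rewrite (submxrow_jac aQ)//; have [_ ->] := As i; exact: uD.
Qed.

End Product.

End Frames.

(** * Constraint forces *)

Section ConstraintForce.
Context {R : realType} (Q : charted R).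
Hypothesis aQ : atlas Q.
Variables (L : tangent Q -> R).
Hypothesis sL : smooth_lagrangian L.
Notation d := (dim Q).
Notation PQ := (pontryagin Q).

Lemma pointwise_equations_of_principle (D : distribution Q) t1 t2 c (F : R -> 'rV[R]_d) k t0 :
  t1 < t2 -> smooth_curve t1 t2 c -> forced_lda_pontryagin L F D t1 t2 c ->
  t1 <= t0 <= t2 -> dom Q k (base (c t0)) ->
  (forall u, u \in D (base (c t0)) -> exists X : R -> 'rV[R]_d, [/\ smv X t0,
     X t0 = u *m jac Q (chart_at Q (base (c t0))) k (base (c t0)) &
     \forall s \near t0, exists2 u', u' \in D (base (c s)) &
       X s = u' *m jac Q (chart_at Q (base (c s))) k (base (c s))]) ->
  smv (fun s => F s *m (jac Q k (chart_at Q (base (c s))) (base (c s)))^T) t0 ->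
  pointwise_equations L (D (base (c t0))) k c t0 (F t0).
Proof.
move=> t12 sc fl t0I ck HX sF w u uD wu; have [X [sX X0 nX]] := HX u uD.
pose xi s : 'rV[R]_(d + d + d) := row_mx (row_mx (X s) (rsubmx (lsubmx w))) (rsubmx w).
have <- : xi t0 = w by rewrite /xi X0 -wu !hsubmxK.
apply: (equations_of_forced_principle aQ sL t12 sc fl t0I ck _ _ sF).
  by apply: smv_row_mx; [apply: smv_row_mx => //; exact: smv_cst|exact: smv_cst].
by apply: filterS nX => s [u' u'D Xs] _; exists u' => //; rewrite /xi !row_mxKl.
Qed.

Section Frames.
Variables (D E : distribution Q) (k : idx Q) (m l : nat).
Variables (A : R -> 'M[R]_(m, d)) (B : R -> 'M[R]_(l, d)) (W : R -> 'M[R]_(d, m + l)).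
Variables (q : R -> Q) (t0 : R).
Hypothesis fA : frame_along D k q A t0.
Hypothesis fB : frame_along E k q B t0.
Hypothesis sW : smv W t0.
Hypothesis qk : smooth_in q k t0.
Hypothesis nW : \forall s \near t0,
  col_mx (A s) (B s) *m W s *m col_mx (A s) (B s) = col_mx (A s) (B s).

Lemma near_frames : \forall s \near t0, [/\ dom Q k (q s),
  col_mx (A s) (B s) *m W s *m col_mx (A s) (B s) = col_mx (A s) (B s),
  forall u, (u *m jac Q (chart_at Q (q s)) k (q s) <= A s)%MS = (u \in D (q s)) &
  forall u, (u *m jac Q (chart_at Q (q s)) k (q s) <= B s)%MS = (u \in E (q s))].
Proof.
have [nk _] := qk; have [_ nA] := fA; have [_ nB] := fB.
have nA' : \forall s \near t0, forall u,
    (u *m jac Q (chart_at Q (q s)) k (q s) <= A s)%MS = (u \in D (q s)).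
  by apply: filterS nA => s [].
have nB' : \forall s \near t0, forall u,
    (u *m jac Q (chart_at Q (q s)) k (q s) <= B s)%MS = (u \in E (q s)).
  by apply: filterS nB => s [].
near=> s; split; near: s; by [].
Unshelve. all: by end_near. Qed.

Lemma section_in_cap s z : dom Q k (q s) ->
  col_mx (A s) (B s) *m W s *m col_mx (A s) (B s) = col_mx (A s) (B s) ->
  (forall u, (u *m jac Q (chart_at Q (q s)) k (q s) <= A s)%MS = (u \in D (q s))) ->
  (forall u, (u *m jac Q (chart_at Q (q s)) k (q s) <= B s)%MS = (u \in E (q s))) ->
  exists2 u, u \in dist_cap D E (q s) &
    intersection_section (A s) (B s) (W s) z = u *m jac Q (chart_at Q (q s)) k (q s).
Proof.
move=> sk MWM AD BE; have sq := atlas_dom aQ (q s).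
have [zA zB] := intersection_section_sub MWM z.
set x := intersection_section _ _ _ z in zA zB *.
have xE : x *m jac Q k (chart_at Q (q s)) (q s) *m jac Q (chart_at Q (q s)) k (q s) = x.
  by rewrite -mulmxA (jac_mulV aQ)// mulmx1.
exists (x *m jac Q k (chart_at Q (q s)) (q s)) => //.
by rewrite memv_cap -AD -BE xE zA zB.
Qed.

(** The parameter [z] of the intersection is kept constant while the frames and [W] vary
    smoothly. *)
Lemma cap_section u : u \in dist_cap D E (q t0) ->
  exists X : R -> 'rV[R]_d, [/\ smv X t0,
    X t0 = u *m jac Q (chart_at Q (q t0)) k (q t0) &
    \forall s \near t0, exists2 u', u' \in dist_cap D E (q s) &
      X s = u' *m jac Q (chart_at Q (q s)) k (q s)].
Proof.
rewrite memv_cap => /andP[uD uE].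
have [_ MWM AD BE] := nbhs_singleton near_frames.
have [z zE] := @intersection_section_surj _ _ _ _ (A t0) (B t0) (W t0)
  (u *m jac Q (chart_at Q (q t0)) k (q t0)) (etrans (AD u) uD) (etrans (BE u) uE).
exists (fun s => intersection_section (A s) (B s) (W s) z); split => //.
  have [sA _] := fA; have [sB _] := fB.
  apply: smv_mul => //; apply: smv_lsubmx.
  apply: smv_mul; first exact: smv_cst.
  by apply: smvB; [exact: smv_cst|apply: smv_mul => //; exact: smv_col_mx].
by apply: filterS near_frames => s [sk MWM' AD' BE']; exact: section_in_cap.
Qed.

End Frames.

(** [mu] is dL/dq - p' in chart [k], and the force is minus its part annihilating [E]. The
    conclusion is conditional at each [s] because the equations hold only for times in the interval,
    whereas smoothness of [beta] concerns a full neighbourhood of [t0]. *)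
Lemma constraint_force (D E : distribution Q) k (c : R -> PQ) t0 m l
    (A : R -> 'M[R]_(m, d)) (B : R -> 'M[R]_(l, d)) (W : R -> 'M[R]_(d, m + l)) :
  smooth_in c k t0 -> frame_along D k (base \o c) A t0 ->
  frame_along E k (base \o c) B t0 -> smv W t0 ->
  (\forall s \near t0, col_mx (A s) (B s) *m W s *m col_mx (A s) (B s) = col_mx (A s) (B s)) ->
  exists2 beta : R -> 'rV[R]_d, smv beta t0 & \forall s \near t0,
    pointwise_equations L (dist_cap D E (base (c s))) k c s 0 ->
    ann [set` E (base (c s))] (beta s *m (jac Q (chart_at Q (base (c s))) k (base (c s)))^T) /\
    pointwise_equations L (D (base (c s))) k c s
      (beta s *m (jac Q (chart_at Q (base (c s))) k (base (c s)))^T).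
Proof.
move=> ck fA fB sW nW; have [_ sc] := ck.
have [sA _] := fA; have [sB _] := fB.
pose mu s := lsubmx (gradient L k (lsubmx (chart PQ k (c s)))) - rsubmx ('D_1 (chart PQ k \o c) s).
have smu : smv mu t0.
  apply: smvB; last by apply: smv_rsubmx; exact: smv_derive.
  apply: smv_lsubmx.
  apply: (@smv_comp _ _ _ _ _ (fun s => lsubmx (chart PQ k (c s))) (gradient L k)).
    exact: (smv_lsubmx sc).
  by rewrite lsubmx_chart; apply: (smv_gradient aQ sL); exact: (smooth_in_dom ck).
exists (fun s => - split_force (A s) (W s) (mu s)).
  apply: smvN; apply: smv_tr; apply: smv_mul => //.
  by apply: smv_col_mx; [apply: smv_mul => //; exact: smv_tr|exact: smv_cst].
have bk := smooth_in_base ck.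
apply: filterS (near_frames fA fB bk nW) => s [sk MWM AD BE] PW.
have sq := atlas_dom aQ (base (c s)).
set J := jac Q (chart_at Q (base (c s))) k (base (c s)) in PW *.
(* Separates the position block of [w], the only one that meets the force, from the other two
   blocks, whose contribution vanishes by the unforced equations with [u = 0]. *)
have EL w F : forced_euler_lagrange L k c s F w = pair (mu s) (lsubmx (lsubmx w)) +
    forced_euler_lagrange L k c s 0 (row_mx (row_mx 0 (rsubmx (lsubmx w))) (rsubmx w)) +
    pair (F *m (jac Q k (chart_at Q (base (c s))) (base (c s)))^T) (lsubmx (lsubmx w)).
  rewrite /forced_euler_lagrange /euler_lagrange /euler_lagrange_form -/(mu s).
  by rewrite !row_mxKl !row_mxKr !pair0r; ring.
have EL0 a b : forced_euler_lagrange L k c s 0 (row_mx (row_mx 0 a) b) = 0.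
  by apply: (PW _ 0 (mem0v _)); rewrite !row_mxKl mul0mx.
have [H1 H2] : (forall w, (w <= A s)%MS -> pair (mu s - split_force (A s) (W s) (mu s)) w = 0) /\
    (forall w, (w <= B s)%MS -> pair (split_force (A s) (W s) (mu s)) w = 0).
  apply: split_forceP => j.
  have [u uDE uE] := section_in_cap (delta_mx 0 j) sk MWM AD BE.
  have := PW (row_mx (row_mx (u *m J) 0) 0) u uDE.
  rewrite !row_mxKl => /(_ erefl); rewrite EL !row_mxKl !row_mxKr EL0 mul0mx pair0l !addr0.
  by rewrite uE.
split.
  move=> u uE; rewrite -pair_mulr pairNl H2 ?oppr0//.
  by rewrite BE.
move=> w u uD wu; rewrite EL EL0 addr0 wu.
rewrite -mulmxA -trmx_mul (jac_mulV aQ)// trmx1 mulmx1.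
by rewrite -pairDl H1// AD.
Qed.

End ConstraintForce.

(** * Force fields on the product and along the curve *)

Section Product.
Context {R : realType} (n : nat) (Q : 'I_n -> charted R).
Hypothesis aQ : forall i, atlas (Q i).
Notation QQ := (prodn Q).
Notation d := (dim QQ).
Let aQQ := atlas_prodn aQ.

Lemma prodn_hausdorff :
  (forall i (x y : Q i), x <> y -> exists A B : set (Q i),
     [/\ open_in A, open_in B, A x, B y & A `&` B = set0]) ->
  forall x y : QQ, x <> y -> exists A B : set QQ,
     [/\ open_in A, open_in B, A x, B y & A `&` B = set0].
Proof.
move=> H x y xy.
have [i xyi] : exists i, x i <> y i.
  apply: contrapT => nH; apply: xy; apply: functional_extensionality_dep => i.
  by apply: contrapT => xyi; apply: nH; exists i.
have [A [B [oA oB Ax By AB]]] := H i _ _ xyi.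
have op (C : set (Q i)) : open_in C -> open_in ([set z | C (z i)] : set QQ).
  move=> oC z Cz; have nC := oC _ Cz.
  have E : submxrow (pcoord z) i = pcoord (z i) by rewrite /pcoord /= mxrowK.
  have nC' : \forall y \near submxrow (pcoord z) i, C (chart_inv (Q i) (chart_at (Q i) (z i)) y).
    by rewrite E.
  have cS : {for (pcoord z : 'rV[R]_(\sum_i dim (Q i))), continuous (fun y => submxrow y i)}.
    by apply: smv_continuous; apply: smv_submxrow; exact: smv_id.
  exact: (cS (fun y => C (chart_inv (Q i) (chart_at (Q i) (z i)) y)) nC').
exists [set z | A (z i)], [set z | B (z i)]; split => //; [exact: op|exact: op|].
apply/seteqP; split => // z [Az Bz].
by have : (A `&` B) (z i) by []; rewrite AB.
Qed.

(** The constructed forces depend on a point of the tangent bundle only through its base point. *)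
Lemma product_force_fields (G : R -> QQ -> 'rV[R]_d) t1 t2 :
  (forall t x, t1 <= t <= t2 -> smooth_covector_field G t x) ->
  force_fields t1 t2 (fun i t (z : tangent QQ) => submxrow (G t z.1) i).
Proof.
move=> sG i t z tI; pose k := chart_at QQ z.1.
have zk : dom QQ k z.1 := atlas_dom aQQ z.1.
set w0 : 'rV[R]_(1 + (d + d)) := pcoord ((t, z) : prod2 (line R) (tangent QQ)).
have sx : smv (fun y : 'rV[R]_(1 + (d + d)) => lsubmx (rsubmx y)) w0.
  by apply: smv_lsubmx; apply: smv_rsubmx; exact: smv_id.
have x0 : lsubmx (rsubmx w0) = chart QQ k z.1 by rewrite row_mxKr row_mxKl.
have nx := atlas_near_comp aQQ zk zk sx x0.
pose h (y : 'rV[R]_(1 + (d + d))) : 'rV[R]_(1 + d) := row_mx (lsubmx y) (lsubmx (rsubmx y)).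
have sh : smv h w0.
  by apply: smv_row_mx => //; apply: smv_lsubmx; exact: smv_id.
have h0 : h w0 = row_mx (const_mx t) (chart QQ k z.1) by rewrite /h x0 row_mxKl.
split; first by apply: filterS nx => y [yk _ _]; exact: yk i.
apply/Coo_atP.
have sGt := sG t z.1 tI; rewrite /smooth_covector_field -/k -h0 in sGt.
have sGh := smv_comp sh sGt.
apply: (@smv_eq _ _ _ _ (fun y => row_mx (submxrow (lsubmx (rsubmx y)) i)
  (submxrow (((fun y : 'rV[R]_(1 + d) =>
    let z := chart_inv QQ k (rsubmx y) in
    G (lsubmx y 0 0) z *m (jac QQ k (chart_at QQ z) z)^T) \o h) y) i))).
  apply: filterS nx => y [yk _ yE].
  have sq := atlas_dom aQQ (chart_inv QQ k (lsubmx (rsubmx y))).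
  rewrite /comp /h row_mxKl row_mxKr (submxrow_jacT aQ)//.
  rewrite -{1}yE /= mxrowK transp_tchange; congr row_mx.
by apply: smv_row_mx; exact: smv_submxrow.
Qed.

(** Provides, in a chart fixed at [t0], the regularity of the force needed to localize the forced
    principles. *)
Lemma force_fields_along t1 t2 (F : forall i, R -> tangent QQ -> 'rV[R]_(dim (Q i)))
    (c : R -> pontryagin QQ) t0 i :
  force_fields t1 t2 F -> t1 <= t0 <= t2 ->
  smooth_in c (chart_at QQ (base (c t0))) t0 ->
  smv (fun s => F i s (tpart (c s)) *m (jac (Q i) (chart_at (Q i) (base (c t0) i))
    (chart_at (Q i) (base (c s) i)) (base (c s) i))^T) t0.
Proof.
move=> fF t0I [nc sc]; set k := chart_at QQ (base (c t0)) in nc sc *.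
have [_ /Coo_atP H] := fF i t0 (tpart (c t0)) t0I.
pose h s : 'rV[R]_(1 + (d + d)) := row_mx (const_mx s) (chart (tangent QQ) k (tpart (c s))).
have sh : smv h t0.
  apply: smv_row_mx; first by apply: smv_const_mx; exact: sm_id.
  apply: (@smv_eq _ _ _ _ (fun s => lsubmx ((chart (pontryagin QQ) k \o c) s))).
    by apply: (@filterE _ (nbhs t0)) => s; exact: lsubmx_chart.
  exact: smv_lsubmx.
have := smv_comp sh H => /smv_rsubmx.
apply: smv_eq; apply: filterS nc => s sk.
have E : chart_inv (tangent QQ) k (chart (tangent QQ) k (tpart (c s))) = tpart (c s).
  exact: (atlasK (atlas_tangent aQQ) (i := k) (x := tpart (c s)) sk).
have E' : chart_inv (prod2 (line R) (tangent QQ)) (tt, k) (h s) = (s, tpart (c s)).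
  transitivity (lsubmx (h s) 0 0, chart_inv (tangent QQ) k (rsubmx (h s))); first by [].
  by rewrite row_mxKl row_mxKr E mxE.
pose f (y : prod2 (line R) (tangent QQ)) :=
  rsubmx (chart (cotangent (Q i)) (k i) (y.2.1 i, F i y.1 y.2)).
by apply: (etrans (congr1 f E')); rewrite /f row_mxKr transp_tchange.
Qed.

End Product.

Lemma lda_pontryagin_unforced (R : realType) (Q : charted R) (L : tangent Q -> R)
    (D : distribution Q) t1 t2 c :
  lda_pontryagin L D t1 t2 c <-> forced_lda_pontryagin L (fun=> 0) D t1 t2 c.
Proof.
have I0 g : \int[@lebesgue_measure R]_(t in `[t1, t2]) pair 0 (base_variation g t) = 0 :> R.
  rewrite /Rintegral integral0_eq// => t _; by rewrite pair0l.
by split=> H g /H; rewrite I0 addr0.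
Qed.

Lemma implicit_lagrange_cap (R : realType) (Q : charted R) (L : tangent Q -> R)
    (D E : distribution Q) c t F :
  ann [set` E (base (c t))] F -> implicit_lagrange L (D (base (c t))) c t F ->
  implicit_lagrange L (dist_cap D E (base (c t))) c t 0.
Proof.
move=> FE [fp vq H]; split=> // u; rewrite memv_cap => /andP[uD uE].
by have := H u uD; rewrite !pairDl pair0l (FE u uE).
Qed.

(** The equations are affine in the force, so they are kept by combinations with coefficients of sum
    1; the annihilator condition is linear. *)
Lemma pointwise_equations_convex (R : realType) (Q : charted R) (L : tangent Q -> R)
    (D E : {vspace 'rV[R]_(dim Q)}) k c t (s : seq R) (l : R -> R) (b : R -> 'rV[R]_(dim Q)) :
  \sum_(i <- s) l i = 1 ->
  (forall i, i \in s -> l i != 0 -> ann [set` E] (b i) /\ pointwise_equations L D k c t (b i)) ->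
  ann [set` E] (\sum_(i <- s) l i *: b i) /\
  pointwise_equations L D k c t (\sum_(i <- s) l i *: b i).
Proof.
move=> l1 H; split.
  move=> w wE; rewrite pair_suml big_seq big1// => i si; rewrite pairZl.
  have [->|li] := eqVneq (l i) 0; first by rewrite mul0r.
  by have [/(_ w wE) -> _] := H i si li; rewrite mulr0.
move=> w u uD wu.
have -> : forced_euler_lagrange L k c t (\sum_(i <- s) l i *: b i) w =
    \sum_(i <- s) l i * forced_euler_lagrange L k c t (b i) w.
  rewrite /forced_euler_lagrange mulmx_suml pair_suml.
  under [RHS]eq_bigr do rewrite mulrDr.
  rewrite big_split /= -mulr_suml l1 mul1r; congr (_ + _).
  by apply: eq_bigr => i _; rewrite -scalemxAl pairZl.
rewrite big_seq big1// => i si.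
have [->|li] := eqVneq (l i) 0; first by rewrite mul0r.
by have [_ /(_ w u uD wu) ->] := H i si li; rewrite mulr0.
Qed.

Theorem theorem6p6 (R : realType) (n : nat) (Q : 'I_n -> charted R)
  (L : forall i, tangent (Q i) -> R)
  (Delta : forall i, distribution (Q i)) (Sigma : distribution (prodn Q))
  (t1 t2 : R) (c : R -> pontryagin (prodn Q)) :
  (forall i, smooth_manifold (Q i)) ->
  (forall i, smooth_lagrangian (L i)) ->
  (forall i, smooth_distribution (Delta i)) ->
  smooth_distribution Sigma ->
  intersect_cleanly (dist_sum Delta) Sigma ->
  t1 < t2 ->
  smooth_curve t1 t2 c ->
  let LQ := lagrangian_sum L in
  let DeltaQ := dist_cap (dist_sum Delta) Sigma in
  let ci := fun i => pontryagin_comp Q i \o c in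
  let on_Sigma := forall t, t1 <= t <= t2 ->
    velocity (base \o c) t \in Sigma (base (c t)) in
  let in_ann_Sigma :=
    fun F : forall i, R -> tangent (prodn Q) -> 'rV[R]_(dim (Q i)) =>
    forall t, t1 <= t <= t2 ->
      ann [set` Sigma (base (c t))] (\mxrow_(i < n) F i t (tpart (c t))) in
  let stmt_i :=
    forall t, t1 <= t <= t2 ->
      in_dirac (interconnected_dirac Delta Sigma) (cpart (c t))
        (velocity (@cpart R (prodn Q) \o c) t)
        (dirac_differential LQ (tpart (c t))) in
  let stmt_ii :=
    exists F, [/\ force_fields t1 t2 F,
      forall i t, t1 <= t <= t2 ->
        in_dirac (induced_dirac (Delta i)) (cpart (ci i t))
          (velocity (@cpart R (Q i) \o ci i) t)
          (sub_force (dirac_differential (L i) (tpart (ci i t)))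
                     (F i t (tpart (c t)))),
      on_Sigma & in_ann_Sigma F] in
  let stmt_iii :=
    lda_pontryagin LQ DeltaQ t1 t2 c /\
    (forall t, t1 <= t <= t2 ->
       velocity (base \o c) t \in DeltaQ (base (c t))) in
  let stmt_iv :=
    exists F, [/\ force_fields t1 t2 F,
      forall i, forced_lda_pontryagin (L i) (fun t => F i t (tpart (c t)))
                  (Delta i) t1 t2 (ci i) /\
        (forall t, t1 <= t <= t2 ->
           velocity (base \o ci i) t \in Delta i (base (ci i t))),
      on_Sigma & in_ann_Sigma F] in
  [/\ stmt_i <-> stmt_ii, stmt_i <-> stmt_iii & stmt_i <-> stmt_iv].
Proof.
move=> mQ sL sD sS cl t12 sc LQ DeltaQ ci on_Sigma in_ann_Sigma
  stmt_i stmt_ii stmt_iii stmt_iv.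
have aQ i := smooth_manifold_atlas (mQ i).
have aQQ := atlas_prodn aQ.
have sLQ : smooth_lagrangian LQ by exact: (smooth_lagrangian_sum aQ sL).
have cc t : t1 <= t <= t2 -> smooth_in c (chart_at (pontryagin (prodn Q)) (c t)) t.
  by move=> tI; apply/smooth_at_curve; exact: sc.
have cci i t : t1 <= t <= t2 -> smooth_in (ci i) (chart_at (pontryagin (Q i)) (ci i t)) t.
  by move=> tI; exact: (smooth_in_comp aQ i (cc t tI)).
have sci i : smooth_curve t1 t2 (ci i).
  by move=> t tI; apply/smooth_at_curve; exact: cci.
have dirac_i t : t1 <= t <= t2 ->
    in_dirac (interconnected_dirac Delta Sigma) (cpart (c t))
      (velocity (@cpart R (prodn Q) \o c) t) (dirac_differential LQ (tpart (c t))) <->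
    velocity (base \o c) t \in Sigma (base (c t)) /\
    exists2 F, ann [set` Sigma (base (c t))] F &
      implicit_lagrange LQ (dist_sum Delta (base (c t))) c t F /\
      velocity (base \o c) t \in dist_sum Delta (base (c t)).
  move=> tI.
  have E F := induced_dirac_force aQQ LQ (dist_sum Delta) F (cc t tI).
  have vE : lsubmx (velocity (@cpart R (prodn Q) \o c) t) = velocity (base \o c) t.
    by rewrite (velocity_cpart (cc t tI)) row_mxKl.
  rewrite /in_dirac (interconnected_diracE aQ) vE; split.
    move=> [e [vS [F FS H]]]; split => //; exists F => //; apply/E.
    by rewrite /in_dirac /sub_force /= (pull_cotangent_proj aQQ).
  move=> [vS [F FS /E]]; rewrite /in_dirac /sub_force /= (pull_cotangent_proj aQQ) => -[e H].
  by split => //; split => //; exists F.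
have dirac_ii i t F : t1 <= t <= t2 ->
    in_dirac (induced_dirac (Delta i)) (cpart (ci i t)) (velocity (@cpart R (Q i) \o ci i) t)
      (sub_force (dirac_differential (L i) (tpart (ci i t))) F) <->
    implicit_lagrange (L i) (Delta i (base (ci i t))) (ci i) t F /\
    velocity (base \o ci i) t \in Delta i (base (ci i t)).
  by move=> tI; exact: (induced_dirac_force (aQ i) _ _ _ (cci i t tI)).
have vel_sum t : t1 <= t <= t2 -> velocity (base \o c) t \in dist_sum Delta (base (c t)) <->
    forall i, velocity (base \o ci i) t \in Delta i (base (ci i t)).
  move=> tI; have vE i := velocity_comp (cc t tI) i.
  by split=> [/mem_dist_sum H i|H]; [rewrite -vE|apply/mem_dist_sum => i; rewrite vE].
(* The common statement: forces are eliminated by restricting the equations to the intersection,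
   where every covector annihilating Sigma vanishes. *)
pose reduced := forall t, t1 <= t <= t2 ->
  implicit_lagrange LQ (DeltaQ (base (c t))) c t 0 /\
  velocity (base \o c) t \in DeltaQ (base (c t)).
have i_reduced : stmt_i -> reduced.
  move=> Hi t tI; have [vS [F FS [H vD]]] := (dirac_i t tI).1 (Hi t tI).
  by split; [exact: implicit_lagrange_cap FS H|rewrite memv_cap vD vS].
have reduced_iii : reduced -> stmt_iii.
  move=> Hr; split; last by move=> t /Hr[].
  apply/lda_pontryagin_unforced; apply: (forced_principle_of_equations aQQ sLQ t12 sc).
  move=> t tI; exists (chart_at (pontryagin (prodn Q)) (c t)).
    exact: (smooth_in_dom (cc t tI)).
  by apply/(pointwise_equationsE aQQ _ _ _ (cc t tI)); have [] := Hr t tI.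
have frames t0 : t1 <= t0 <= t2 -> let k := chart_at (prodn Q) (base (c t0)) in
    exists m l (A : R -> 'M[R]_(m, dim (prodn Q))) (B : R -> 'M[R]_(l, dim (prodn Q)))
      (W : R -> 'M[R]_(dim (prodn Q), m + l)),
    [/\ frame_along (dist_sum Delta) k (base \o c) A t0,
        frame_along Sigma k (base \o c) B t0, smv W t0 &
        \forall s \near t0,
          col_mx (A s) (B s) *m W s *m col_mx (A s) (B s) = col_mx (A s) (B s)].
  move=> t0I k; have bk : smooth_in (base \o c) k t0 := smooth_in_base (cc t0 t0I).
  have [m [A fA]] := dist_sum_frame aQ sD bk.
  have [l [B fB]] := distribution_frame aQQ sS bk.
  have [W sW nW] := intersection_ginv aQQ bk cl fA fB.
  by exists m, l, A, B, W; split.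
have iii_reduced : stmt_iii -> reduced.
  move=> [/lda_pontryagin_unforced fl vD] t0 t0I; split; last exact: vD.
  have [m [l [A [B [W [fA fB sW nW]]]]]] := frames t0 t0I.
  have ck := cc t0 t0I; have bk := smooth_in_base ck.
  apply/(pointwise_equationsE aQQ _ _ _ ck).
  apply: (pointwise_equations_of_principle aQQ sLQ t12 sc fl t0I (smooth_in_dom ck)).
    by move=> u uD; exact: (cap_section aQQ fA fB sW bk nW uD).
  apply: (@smv_eq _ _ _ _ (fun=> 0)); last exact: smv_cst.
  by apply: (@filterE _ (nbhs t0)) => s; rewrite mul0mx.
have reduced_ii : reduced -> stmt_ii.
  move=> Hr.
  have [G PG sG] : exists2 G : R -> prodn Q -> 'rV[R]_(dim (prodn Q)),
      forall t, t1 <= t <= t2 -> ann [set` Sigma (base (c t))] (G t (base (c t))) /\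
        pointwise_equations LQ (dist_sum Delta (base (c t)))
          (chart_at (pontryagin (prodn Q)) (c t)) c t (G t (base (c t))) &
      forall t x, t1 <= t <= t2 -> smooth_covector_field G t x.
    pose P t b := ann [set` Sigma (base (c t))] b /\
      pointwise_equations LQ (dist_sum Delta (base (c t)))
        (chart_at (pontryagin (prodn Q)) (c t)) c t b.
    have hM := prodn_hausdorff (fun i => @manifold_hausdorff _ _ (mQ i)).
    apply: (glue_covector_fields aQQ hM (q := base \o c) (P := P)).
      by move=> t s l b _ l1 H; exact: pointwise_equations_convex l1 H.
    move=> t0 t0I; have ck := cc t0 t0I.
    have [m [l [A [B [W [fA fB sW nW]]]]]] := frames t0 t0I.
    have [beta sbeta nbeta] := constraint_force aQQ sLQ ck fA fB sW nW.
    exists (chart_at (prodn Q) (base (c t0))), beta; split => //.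
      exact: smooth_in_base.
    (* [beta] and its frames refer to the chart fixed at [t0], while [P s] refers to the preferred
       chart at [c s]: the equations are moved to the former chart and back. *)
    apply: filterS2 (smooth_in_near ck) nbeta => s cs Hs sI.
    have [Hrs _] := Hr s sI; have css := cc s sI.
    have PW := (pointwise_equationsE aQQ _ _ _ css).2 Hrs.
    have [H1 H2] := Hs (pointwise_equations_chart aQQ sLQ css (smooth_in_dom cs) PW).
    by split => //; apply: (pointwise_equations_chart aQQ sLQ cs _ H2); exact: (smooth_in_dom css).
  exists (fun i t (z : tangent (prodn Q)) => submxrow (G t z.1) i); split.
  - exact: product_force_fields.
  - move=> i t tI; apply/(dirac_ii i t _ tI).
    have [_ PW] := PG t tI; have [_ vD] := Hr t tI.
    split; last by move: i; apply/(vel_sum t tI); move: vD; rewrite memv_cap => /andP[].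
    have H := (pointwise_equationsE aQQ _ _ _ (cc t tI)).1 PW.
    exact: (implicit_lagrange_split aQ sL (cc t tI) _ _).1 H i.
  - by move=> t tI; have [_] := Hr t tI; rewrite memv_cap => /andP[].
  - by move=> t tI; rewrite submxrowK; have [] := PG t tI.
have ii_i : stmt_ii -> stmt_i.
  move=> [F [_ Hii vS FS]] t tI; apply/(dirac_i t tI); split; first exact: vS.
  exists (\mxrow_i F i t (tpart (c t))); first exact: FS.
  split.
    apply/(implicit_lagrange_split aQ sL (cc t tI)) => i; rewrite mxrowK.
    by have [] := (dirac_ii i t _ tI).1 (Hii i t tI).
  by apply/(vel_sum t tI) => i; have [] := (dirac_ii i t _ tI).1 (Hii i t tI).
have ii_iv : stmt_ii -> stmt_iv.
  move=> [F [fF Hii vS FS]]; exists F; split => // i.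
  have H t tI := (dirac_ii i t _ tI).1 (Hii i t tI).
  split; last by move=> t tI; have [] := H t tI.
  apply: (forced_principle_of_equations (aQ i) (sL i) t12 (sci i)) => t tI.
  exists (chart_at (pontryagin (Q i)) (ci i t)); first exact: (smooth_in_dom (cci i t tI)).
  by apply/(pointwise_equationsE (aQ i) _ _ _ (cci i t tI)); have [] := H t tI.
have iv_ii : stmt_iv -> stmt_ii.
  move=> [F [fF Hiv vS FS]]; exists F; split => // i t tI.
  have [fl vD] := Hiv i; apply/(dirac_ii i t _ tI); split; last exact: vD.
  have ck := cci i t tI; have bk := smooth_in_base ck.
  apply/(pointwise_equationsE (aQ i) _ _ _ ck).
  apply: (pointwise_equations_of_principle (aQ i) (sL i) t12 (sci i) fl tI (smooth_in_dom ck)).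
    have [m [A fA]] := distribution_frame (aQ i) (@sD i) bk.
    by move=> u uD; exact: (frame_section (aQ i) bk fA uD).
  exact: (force_fields_along aQ fF tI (cc t tI)).
split; split.
- by move=> /i_reduced/reduced_ii.
- exact: ii_i.
- by move=> /i_reduced.
- by move=> /iii_reduced/reduced_ii/ii_i.
- by move=> /i_reduced/reduced_ii/ii_iv.
- by move=> /iv_ii/ii_i.
Qed.
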